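(* Let $\lambda,\mu,\nu,\alpha,\gamma$ be partitions such that $|\lambda|\cdot|\mu|=|\nu|$ and $a_{d\alpha,\mu}^{d\gamma}=1$ for all integers $d\geq 1$. Then the sequence $\left(a_{\lambda+d\alpha,\mu}^{\nu+d\gamma}\right)_{d\in\mathbb{N}}$ is non-decreasing and is constant for $d$ large enough.
   Context: For partitions $\lambda,\mu,\nu$, the plethysm coefficient $a_{\lambda,\mu}^\nu$ is the multiplicity of the irreducible $\mathrm{GL}(V)$-representation $\mathbb{S}^\nu(V)$ in $\mathbb{S}^\lambda(\mathbb{S}^\mu(V))$, where $\mathbb{S}$ denotes the Schur functor and $V$ is any complex vector space with $\dim V\geq\max(\ell(\mu),\ell(\nu))$ (this multiplicity does not depend on such a choice; it is the coefficient of the Schur function $s_\nu$ in the plethysm $s_\lambda[s_\mu]$). Partitions are added componentwise (with $\lambda_i=0$ for $i>\ell(\lambda)$) and $d\alpha=(d\alpha_1,d\alpha_2,\dots)$. *)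

(* Defs.v *)
From HB Require Import structures.
From mathcomp Require Import all_boot all_order all_algebra.
From mathcomp Require Import mpoly.
Set Implicit Arguments. Unset Strict Implicit. Unset Printing Implicit Defensive.
Import Order.TTheory GRing.Theory Num.Theory.

(* Partitions are represented as weakly decreasing sequences of naturals;
   trailing zeros are allowed and are irrelevant everywhere below. *)
Definition is_partition (s : seq nat) : bool := sorted geq s.

Definition plen (s : seq nat) : nat := count (fun x => 0 < x) s.

Definition padd (a b : seq nat) : seq nat :=
  mkseq (fun i => nth 0 a i + nth 0 b i) (maxn (size a) (size b)).

Definition pscale (d : nat) (a : seq nat) : seq nat := map (muln d) a.

(* Fillings of the Young diagram of la (cells (i,j), i < size la, j < la_i)
   by entries in {0,..,N-1}; cells of the bounding rectangle outside the
   diagram carry None. *)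
Definition filling (la : seq nat) (N : nat) :=
  {ffun 'I_(size la) * 'I_(head 0 la) -> option 'I_N}.

Definition ssyt (la : seq nat) (N : nat) (t : filling la N) : bool :=
  [forall c, (t c == None) == (nth 0 la c.1 <= c.2)] &&
  [forall c, forall c',
     match t c, t c' with
     | Some x, Some y =>
         ((c.1 == c'.1) && (c.2 < c'.2) ==> (x <= y)) &&
         ((c.2 == c'.2) && (c.1 < c'.1) ==> (x < y))
     | _, _ => true
     end].

Local Open Scope ring_scope.

Definition schur (R : comNzRingType) (N : nat) (la : seq nat) : {mpoly R[N]} :=
  \sum_(t : filling la N | ssyt t)
     \prod_(c : 'I_(size la) * 'I_(head 0 la))
        (if t c is Some k then 'X_k else 1).

Definition monomial_list (N : nat) (f : {mpoly int[N]}) : seq 'X_{1..N} :=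
  flatten [seq nseq `|f@_m|%N m | m <- msupp f].

(* plethysm s_la[f] for f with nonnegative coefficients (as s_mu):
   s_la evaluated at the monomials of f (with multiplicity) *)
Definition plethysm (N : nat) (la : seq nat) (f : {mpoly int[N]})
  : {mpoly int[N]} :=
  let L := monomial_list f in
  (schur {mpoly int[N]} (size L) la).@[fun i : 'I_(size L) => 'X_[nth 0%MM L i]].

Definition vandermonde (N : nat) : {mpoly int[N]} :=
  \prod_(i < N) \prod_(j < N | (i < j)%N) ('X_i - 'X_j).

(* coefficient of s_nu in a symmetric polynomial g in N >= l(nu) variables:
   the coefficient of x^(nu + delta) in a_delta * g *)
Definition schur_coeff (N : nat) (g : {mpoly int[N]}) (nu : seq nat) : int :=
  (vandermonde N * g)@_[multinom (nth 0 nu i + (N - 1 - i))%N | i < N].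

Definition pleth_coeff (la mu nu : seq nat) : int :=
  let N := maxn (plen mu) (plen nu) in
  schur_coeff (plethysm la (schur int N mu)) nu.

(* Main.v *)
(* Let W = S^mu(C^N) for N large. The multiplicity of S^nu(C^N) in S^la(W) is,
   by Cauchy's identity, the dimension of the space A_(nu,la) of polynomials on
   the gl_N x gl_l-module V = W (x) C^l that are highest weight vectors of
   weight (nu, la). These spaces form a graded domain A. The hypothesis says
   that A_(k ga, k al) is a line for every k, spanned by f^k for any nonzero f
   in A_(ga,al), and multiplication by f embeds A_(w) in A_(w + (ga,al)), so the
   sequence is nondecreasing. It is bounded because the elements of weights
   (nu, la) + k (ga, al) generate a finite module over F[f]: they lift to
   invariants of a larger polynomial ring, to which Hilbert's argument (basis
   theorem and Reynolds operator) applies.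

   Everything is done over the rationals with explicit matrices carrying a
   positive diagonal form for which E_ij is adjoint to E_ji. This gives the
   Reynolds operator (invariants are the orthogonal of the images of the E_ij),
   and Freudenthal's trace identity for the Casimir operator gives the number of
   highest weight vectors as a coefficient of the Vandermonde determinant times
   the character. The Jacobi-Trudi formula for sums over tableaux links this
   with Schur polynomials. W itself is cut out as the space of gl_l'-highest
   weight vectors of weight mu in the polynomials on C^N (x) C^l'. *)
Require Import Defs.
From HB Require Import structures.
From mathcomp Require Import all_boot all_order all_algebra all_fingroup.
From mathcomp Require Import mpoly mxtens.
From mathcomp Require Import ring lra zify.
From Stdlib Require Import Classical ClassicalEpsilon.
Set Implicit Arguments.
Unset Strict Implicit.
Unset Printing Implicit Defensive.
Import Order.TTheory GRing.Theory Num.Theory.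
Local Open Scope ring_scope.

(** * Hilbert's basis theorem *)

(** The obstacle is boundedness. [A] consists of vectors killed by raising operators only, and a
    nilpotent algebra has no Reynolds operator. The remedy is to adjoin variables z carrying the
    dual of a finite-dimensional module that contains [f] and one nonzero vector [m0] of some weight
    psi + k0 chi, where chi and psi stand for the weights (ga, al) and (nu, la). The whole Levi
    subalgebra acts on the larger ring. Setting z to a vector [g] killed by the raising operators
    maps invariants to highest weight vectors. Conversely, products of the linear forms of [f] and
    [m0] give, in every weight psi + k chi with k at least k0, a highest weight polynomial in z; if
    [g] pairs nontrivially with both [f] and [m0], it does not vanish at [g], and this is what
    lifting by an intertwiner requires. Invariant coefficients of the generators then contribute
    only in multiples of chi, where they are scalars times powers of [f], so the number of
    generators bounds the dimensions. The block function [b] lets one theory serve gl_N x gl_l,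
    which counts multiplicities, and torus x gl_l, which gives the weight multiplicities of W. *)

Lemma dickson (n : nat) (P : (nat -> nat) -> Prop) :
  exists l : list (nat -> nat),
    (forall y, List.In y l -> P y) /\
    (forall x, P x -> exists2 y, List.In y l & forall i, (i < n)%N -> (y i <= x i)%N).
Proof.
elim: n P => [|n IH] P.
  have [[y Py]|nP] := classic (exists y, P y); last first.
    by exists [::]; split=> // x Px; case: nP; exists x.
  exists [:: y]; split=> [z [<-|[]] //|x Px]; exists y => //; by left.
(* [l0] settles the first [n] coordinates and [A] bounds its last ones, so points whose last
   coordinate is at least [A] are covered. The finitely many slices below [A] are treated one by one
   with the induction hypothesis. *)
have [l0 [l0P l0d]] := IH P.
have [A HA] : exists A, forall y, List.In y l0 -> (y n <= A)%N.
  elim: l0 {l0P l0d} => [|y l0 [A HA]]; first by exists 0%N.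
  exists (maxn (y n) A) => z [<-|/HA]; first exact: leq_maxl.
  by move=> h; apply: leq_trans h (leq_maxr _ _).
have [l1 [l1P l1d]] : exists l1 : list (nat -> nat), (forall y, List.In y l1 -> P y) /\
    (forall x, P x -> (x n < A)%N ->
       exists2 y, List.In y l1 & forall i, (i < n.+1)%N -> (y i <= x i)%N).
  elim: A {HA} => [|A [l1 [l1P l1d]]]; first by exists [::].
  have [l2 [l2P l2d]] := IH (fun x => P x /\ x n = A).
  exists (l1 ++ l2)%list; split=> [y|x Px].
    by move=> /(@List.in_app_or _ _ _ _) [/l1P|/l2P []].
  rewrite ltnS leq_eqVlt => /orP[/eqP xn|xn].
    have [y yl le] := l2d x (conj Px xn); exists y.
      by apply: List.in_or_app; right.
    move=> i; rewrite ltnS leq_eqVlt => /orP[/eqP->|]; last exact: le.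
    by have [_ ->] := l2P y yl; rewrite xn.
  have [y yl le] := l1d x Px xn; exists y => //.
  by apply: List.in_or_app; left.
exists (l0 ++ l1)%list; split=> [y|x Px].
  by move=> /(@List.in_app_or _ _ _ _) [/l0P|/l1P].
have [xn|xn] := ltnP (x n) A.
  have [y yl le] := l1d x Px xn; exists y => //.
  by apply: List.in_or_app; right.
have [y yl le] := l0d x Px; exists y.
  by apply: List.in_or_app; left.
move=> i; rewrite ltnS leq_eqVlt => /orP[/eqP->|]; last exact: le.
exact: leq_trans (HA y yl) xn.
Qed.

Section HilbertBasis.
Variables (F : fieldType) (n : nat).
Implicit Types (p q : {mpoly F[n]}) (S : {mpoly F[n]} -> Prop).

Inductive ideal_span S : {mpoly F[n]} -> Prop :=
| ideal_span0 : ideal_span S 0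
| ideal_spanS c p q : S p -> ideal_span S q -> ideal_span S (c * p + q).

Lemma ideal_spanD S p q : ideal_span S p -> ideal_span S q -> ideal_span S (p + q).
Proof.
move=> Ip Iq; elim: Ip => [|c r s Sr _ IH]; first by rewrite add0r.
by rewrite -addrA; apply: ideal_spanS.
Qed.

Lemma ideal_spanM S c p : ideal_span S p -> ideal_span S (c * p).
Proof.
elim=> [|a r s Sr _ IH]; first by rewrite mulr0; apply: ideal_span0.
by rewrite mulrDr mulrA; apply: ideal_spanS.
Qed.

Lemma ideal_span_gen S p : S p -> ideal_span S p.
Proof.
by move=> Sp; rewrite -[p]addr0 -[X in X + _]mul1r; apply: ideal_spanS => //; apply: ideal_span0.
Qed.

Lemma ideal_span_trans S S' p :
  (forall q, S q -> ideal_span S' q) -> ideal_span S p -> ideal_span S' p.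
Proof.
move=> SS'; elim=> [|c q r Sq _ IH]; first exact: ideal_span0.
by apply: ideal_spanD => //; apply/ideal_spanM/SS'.
Qed.

Lemma ideal_span_list (l : list {mpoly F[n]}) p :
  ideal_span (fun q => List.In q l) p ->
  exists c : 'I_(size l) -> {mpoly F[n]}, p = \sum_(i < size l) c i * nth 0 l i.
Proof.
elim=> [|c q r ql _ [d ->]].
  by exists (fun=> 0); rewrite big1 // => i _; rewrite mul0r.
have [i ->] : exists i : 'I_(size l), q = nth 0 l i.
  elim: l ql {d} => [//|a l IH] /= [<-|/IH [i ->]].
    by exists ord0.
  by exists (lift ord0 i).
exists (fun j => (if j == i then c else 0) + d j).
under [RHS]eq_bigr do rewrite mulrDl.
rewrite big_split /=; congr (_ + _).
rewrite (bigD1 i) //= eqxx big1 ?addr0 // => j /negPf->.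
by rewrite mul0r.
Qed.

(** Each element of the ideal involves finitely many members of [S]. Generators can thus be taken in
    [S] itself, which matters later: members of [S] will be invariants of controlled weight, general
    elements of the ideal will not. *)
Lemma ideal_span_fin S (l : list {mpoly F[n]}) :
  (forall q, List.In q l -> ideal_span S q) ->
  exists l' : list {mpoly F[n]}, (forall q, List.In q l' -> S q) /\
    forall q, List.In q l -> ideal_span (fun r => List.In r l') q.
Proof.
elim: l => [|p l IH] H; first by exists [::].
have [l1 [l1S l1g]] := IH (fun q ql => H q (or_intror ql)).
have [l2 [l2S l2g]] : exists l2 : list {mpoly F[n]}, (forall q, List.In q l2 -> S q) /\
    ideal_span (fun r => List.In r l2) p.
  elim: (H p (or_introl erefl)) => [|c q r Sq _ [l2 [l2S l2g]]].
    by exists [::]; split=> //; apply: ideal_span0.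
  exists (q :: l2); split=> [s [<-//|/l2S//]|].
  apply: ideal_spanS; first by left.
  by apply: ideal_span_trans l2g => s sl; apply: ideal_span_gen; right.
exists (l2 ++ l1)%list; split=> [q|q [<-|/l1g]].
- by move=> /(@List.in_app_or _ _ _ _) [/l2S|/l1S].
- apply: ideal_span_trans l2g => s sl; apply: ideal_span_gen.
  by apply: List.in_or_app; left.
- apply: ideal_span_trans => s sl; apply: ideal_span_gen.
  by apply: List.in_or_app; right.
Qed.

Definition mnm_of_fun (f : nat -> nat) : 'X_{1..n} := [multinom f i | i < n].

(* Finitely many leading monomials generate all leading monomials of the
   ideal (Dickson); division by the corresponding polynomials terminates. *)
Lemma hilbert_basis S :
  exists l : list {mpoly F[n]}, (forall q, List.In q l -> S q) /\
    forall p, S p -> ideal_span (fun q => List.In q l) p.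
Proof.
pose I := ideal_span S.
pose LM (x : nat -> nat) := exists p, [/\ I p, p != 0 & mlead p = mnm_of_fun x].
have [l [lP ld]] := dickson n LM.
have [g [gI gd]] : exists g : list {mpoly F[n]}, (forall q, List.In q g -> I q) /\
    forall x, List.In x l -> exists p, [/\ List.In p g, p != 0 & mlead p = mnm_of_fun x].
  elim: l lP {ld} => [|x l IH] lP; first by exists [::].
  have [g [gI gd]] := IH (fun y yl => lP y (or_intror yl)).
  have [p [Ip p0 pm]] := lP x (or_introl erefl).
  exists (p :: g); split=> [q [<-//|/gI//]|y [<-|/gd [q [qg q0 qm]]]].
    by exists p; split=> //; left.
  by exists q; split=> //; right.
have Ig p : I p -> ideal_span (fun q => List.In q g) p.
  elim/mleadrect: p => p IH Ip.
  have [->|p0] := eqVneq p 0; first exact: ideal_span0.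
  pose x i := if insub i is Some j then mlead p j else 0%N.
  have xE : mnm_of_fun x = mlead p.
    by apply/mnmP => i; rewrite mnmE /x insubT //= => h; congr (mlead p _); apply: val_inj.
  have [y yl le] : exists2 y, List.In y l & forall i, (i < n)%N -> (y i <= x i)%N.
    by apply: ld; exists p.
  have [q [qg q0 qm]] := gd y yl.
  have lepm : (mlead q <= mlead p)%MM.
    by apply/mnm_lepP => i; rewrite qm -xE !mnmE le.
  pose a := mleadc p / mleadc q.
  pose h := a *: 'X_[mlead p - mlead q] * q.
  have a0 : a != 0 by rewrite mulf_neq0 ?invr_eq0 ?mleadc_eq0.
  have X0 : a *: 'X_[mlead p - mlead q] != 0 :> {mpoly F[n]}.
    by rewrite mscalerI negb_or a0 -msupp_eq0 msuppX.
  have hm : mlead h = mlead p.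
    by rewrite mleadM // mleadZ // mleadXm submK.
  have hc : h@_(mlead p) = mleadc p.
    have -> : h = a *: (q * 'X_[mlead p - mlead q]) by rewrite /h -scalerAl mulrC.
    rewrite mcoeffZ; move: (mcoeffMX q (mlead p - mlead q) (mlead q)).
    by rewrite submK // => ->; rewrite /a divfK // mleadc_eq0.
  rewrite -[p](subrK h); apply: ideal_spanD; last first.
    exact/ideal_spanM/ideal_span_gen.
  have [->|d0] := eqVneq (p - h) 0; first exact: ideal_span0.
  apply: IH; last first.
    apply: ideal_spanD => //; rewrite -mulN1r; do 2![apply: ideal_spanM]; exact: gI.
  rewrite lt_neqAle; apply/andP; split; last first.
    by apply: le_trans (mleadB_le _ _) _; rewrite hm joinxx.
  by apply: contraNneq d0 => e; rewrite -mleadc_eq0 e mcoeffB hc subrr.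
have [l' [l'S l'g]] := ideal_span_fin gI.
exists l'; split=> // p Sp.
exact: ideal_span_trans l'g (Ig p (ideal_span_gen Sp)).
Qed.
End HilbertBasis.

(** * Modules over a Levi subalgebra of gl_r *)

Section Gram.
Variables (n : nat) (d : 'I_n -> rat).
Hypothesis d_gt0 : forall k, 0 < d k.

Definition gram : 'M[rat]_n := diag_mx (\row_k d k).

Lemma gramE k l : gram k l = d k *+ (k == l).
Proof. by rewrite !mxE. Qed.

Lemma mul_mx_gram m (A : 'M_(m, n)) i k : (A *m gram) i k = A i k * d k.
Proof.
rewrite mxE (bigD1 k) //= big1 ?addr0 ?gramE ?eqxx // => l /negPf lk.
by rewrite gramE lk mulr0.
Qed.

Lemma gram_form (v : 'rV_n) : (v *m gram *m v^T) 0 0 = \sum_k d k * v 0 k ^+ 2.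
Proof. by rewrite mxE; apply: eq_bigr => k _; rewrite mul_mx_gram mxE; ring. Qed.

Lemma gram_eq0 (v : 'rV_n) : v *m gram *m v^T = 0 -> v = 0.
Proof.
move=> /matrixP/(_ 0 0); rewrite gram_form [RHS]mxE => s0.
apply/rowP => k; rewrite mxE.
have := psumr_eq0P _ s0 => /(_ (fun k _ => mulr_ge0 (ltW (d_gt0 k)) (sqr_ge0 _)) k isT).
by move/eqP; rewrite mulf_eq0 expf_eq0 /= gt_eqF ?d_gt0 //= => /eqP.
Qed.

Lemma gram_ge0 (v : 'rV_n) : 0 <= (v *m gram *m v^T) 0 0.
Proof.
rewrite gram_form sumr_ge0 // => k _.
by rewrite mulr_ge0 ?sqr_ge0 // ltW.
Qed.

Lemma gram_neq0 (v : 'rV_n) : v != 0 -> 0 < (v *m gram *m v^T) 0 0.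
Proof.
move=> v0; rewrite lt_def gram_ge0 andbT; apply: contra_neq v0 => h.
by apply: gram_eq0; apply/matrixP => i j; rewrite !ord1 h mxE.
Qed.

Lemma gram_unit m (U : 'M_(m, n)) : row_free U -> U *m gram *m U^T \in unitmx.
Proof.
move=> Uf; rewrite -row_free_unit; apply/row_freeP.
have: kermx (U *m gram *m U^T) = 0.
  apply/row_matrixP => i; rewrite row0; set v := row i _.
  have vU : v *m (U *m gram *m U^T) = 0 by rewrite -row_mul mulmx_ker row0.
  have /gram_eq0 : (v *m U) *m gram *m (v *m U)^T = 0.
    by rewrite trmx_mul !mulmxA -(mulmxA v) -(mulmxA v) vU mul0mx.
  by move=> h; apply: (row_free_inj Uf); rewrite h mul0mx.
by move/eqP; rewrite kermx_eq0 => /row_freeP.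
Qed.

(** Orthogonal projection onto the row space of [A], computed in a basis [U] of that space, whose
    Gram matrix is invertible; [s'] is the orthogonal remainder. *)
Lemma gram_decomp m (A : 'M_(m, n)) (s : 'rV_n) :
  exists a s', s = a *m A + s' /\ s' *m gram *m A^T = 0.
Proof.
pose U := row_base A.
have Uu : U *m gram *m U^T \in unitmx by apply/gram_unit/row_base_free.
pose c := s *m gram *m U^T *m invmx (U *m gram *m U^T).
have /submxP [e eU] : (U <= A)%MS by rewrite /U eq_row_base.
have /submxP [f fA] : (A <= U)%MS by rewrite /U eq_row_base.
exists (c *m e), (s - c *m U); split.
  by rewrite -mulmxA -eU addrC subrK.
have cU : c *m U *m gram *m U^T = s *m gram *m U^T.
  by rewrite -!(mulmxA c) /c mulmxKV.
have -> : A^T = U^T *m f^T by rewrite -trmx_mul -fA.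
by rewrite mulmxA !mulmxBl cU subrr.
Qed.

End Gram.

Section Rank.
Variable F : fieldType.

(** In a rank factorization [L *m R] of an idempotent, [R *m L] is the identity matrix of size the
    rank, and exchanging the factors preserves the trace. *)
Lemma mxtrace_idem n (P : 'M[F]_n) : P *m P = P -> \tr P = (\rank P)%:R.
Proof.
move=> PP; have := mulmx_base P; set L := col_base P; set R := row_base P => LR.
have RL : R *m L = 1%:M.
  have: L *m (R *m L) *m R = L *m 1%:M *m R.
    transitivity ((L *m R) *m (L *m R)); first by rewrite !mulmxA.
    by rewrite mulmx1 LR PP.
  move/(row_free_inj (row_base_free P)).
  by apply: (row_full_inj (col_base_full P)).
by rewrite -(congr1 mxtrace LR) mxtrace_mulC RL mxtrace1.
Qed.

End Rank.

Section GMod.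
Variables (r : nat) (b : 'I_r -> nat).

(* The matrices E i j with b i = b j represent, acting on row vectors from the
   right, the elementary matrices of the Levi subalgebra of gl_r with blocks
   the fibres of b; wt gives the weights of the standard basis vectors, and
   E i j is adjoint to E j i for the diagonal form with positive entries d. *)
Record gmod n (E : 'I_r -> 'I_r -> 'M[rat]_n) (wt : 'I_n -> 'X_{1..r})
    (d : 'I_n -> rat) : Prop := GMod {
  gmod_comm : forall i j k l, b i = b j -> b k = b l ->
    E k l *m E i j - E i j *m E k l = (j == k)%:R *: E i l - (l == i)%:R *: E k j;
  gmod_diag : forall i k l, E i i k l = (wt k i)%:R *+ (k == l);
  gmod_adj : forall i j k l, b i = b j -> E i j k l * d l = d k * E j i l k;
  gmod_gt0 : forall k, 0 < d k }.

(** These are the strictly dominant functionals. Comparing weights through all of them, as [prec]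
    does, stands in for the order by sums of positive roots and makes transitivity and irreflexivity
    immediate. *)
Definition bdec (g : 'I_r -> rat) := forall i j : 'I_r, (i < j)%N -> b i = b j -> g j < g i.

Definition wdot (g : 'I_r -> rat) (w : 'X_{1..r}) : rat := \sum_i g i * (w i)%:R.

Definition prec (w w' : 'X_{1..r}) := forall g, bdec g -> wdot g w < wdot g w'.

Definition wdom (w : 'X_{1..r}) := forall i j : 'I_r, (i < j)%N -> b i = b j -> (w j <= w i)%N.

Lemma wdotD g w w' : wdot g (w + w')%MM = wdot g w + wdot g w'.
Proof. by rewrite -big_split; apply: eq_bigr => i _; rewrite mnmDE natrD mulrDr. Qed.

Lemma wdotU g i : wdot g U_(i)%MM = g i.
Proof.
rewrite /wdot (bigD1 i) //= big1 ?addr0 => [|j /negPf ji]; rewrite mnm1E ?eqxx ?mulr1 //.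
by rewrite eq_sym ji mulr0.
Qed.

Lemma bdec_opp : bdec (fun i => - (i : nat)%:R).
Proof. by move=> i j ij _; rewrite ltrN2 ltr_nat. Qed.

Lemma precxx w : ~ prec w w.
Proof. by move=> /(_ _ bdec_opp); rewrite ltxx. Qed.

Lemma prec_trans w2 w1 w3 : prec w1 w2 -> prec w2 w3 -> prec w1 w3.
Proof. by move=> h1 h2 g gd; apply: lt_trans (h1 g gd) (h2 g gd). Qed.

Lemma prec_shift w w' (i j : 'I_r) : (i < j)%N -> b i = b j ->
  (w' + U_(j) = w + U_(i))%MM -> prec w w'.
Proof.
move=> ij bij e g gd; have := congr1 (wdot g) e; rewrite !wdotD !wdotU.
by have := gd i j ij bij; lra.
Qed.

(** The sum 2 rho of the positive roots, so that [cas w] is the scalar product of w with w + 2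
    rho. *)
Definition rho2 (i : 'I_r) : rat :=
  \sum_(j | b j == b i) ((i < j)%N%:R - (j < i)%N%:R).

Definition cas (w : 'X_{1..r}) : rat := \sum_i (w i)%:R * ((w i)%:R + rho2 i).

Lemma bdec_rho2 : bdec rho2.
Proof.
move=> i j ij bij; rewrite /rho2 -bij -subr_gt0 -sumrB (bigD1 i) //=.
rewrite ltnn ij (ltnNge j i) (ltnW ij) /=.
apply: ltr_pwDl; first by lra.
apply: sumr_ge0 => k _.
case: (ltngtP i k) => ik; case: (ltngtP j k) => jk //=; try lra; lia.
Qed.

(** The difference of the two values is the pairing of [w' - w] with [w + w' + rho2], and the latter
    is strictly dominant. *)
Lemma cas_lt w w' : wdom w -> wdom w' -> prec w w' -> cas w < cas w'.
Proof.
move=> wd wd' /(_ (fun i => (w i)%:R + (w' i)%:R + rho2 i)) h.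
rewrite -subr_gt0; suff -> : cas w' - cas w =
    wdot (fun i => (w i)%:R + (w' i)%:R + rho2 i) w' -
    wdot (fun i => (w i)%:R + (w' i)%:R + rho2 i) w.
  rewrite subr_gt0; apply: h => i j ij bij.
  by rewrite ler_ltD ?bdec_rho2 // lerD // ler_nat ?wd ?wd'.
by rewrite -!sumrB; apply: eq_bigr => i _; ring.
Qed.

Section Theory.
Variables (n : nat) (E : 'I_r -> 'I_r -> 'M[rat]_n).
Variables (wt : 'I_n -> 'X_{1..r}) (d : 'I_n -> rat).
Hypothesis M : gmod E wt d.

Local Notation D := (gram d).

Lemma gmod_diagE i : E i i = diag_mx (\row_k (wt k i)%:R).
Proof. by apply/matrixP => k l; rewrite (gmod_diag M) !mxE. Qed.

Lemma mul_gmod_diag m (A : 'M_(m, n)) i k l : (A *m E i i) k l = A k l * (wt l i)%:R.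
Proof. by rewrite gmod_diagE mul_mx_diag !mxE. Qed.

Lemma gmod_diag_mul m (A : 'M_(n, m)) i k l : (E i i *m A) k l = (wt k i)%:R * A k l.
Proof. by rewrite gmod_diagE mul_diag_mx !mxE. Qed.

Lemma gmod_adjE i j : b i = b j -> E i j *m D = D *m (E j i)^T.
Proof.
move=> bij; apply/matrixP => k l; rewrite mul_mx_gram (gmod_adj M) //.
by rewrite mul_diag_mx !mxE.
Qed.

(** Entry [(k, l)] of the commutator of [E i j] with each diagonal [E p p] compares the two
    weights. *)
Lemma gmod_shift i j k l : b i = b j -> E i j k l != 0 ->
  (wt l + U_(j) = wt k + U_(i))%MM.
Proof.
move=> bij e0; apply/mnmP => p; rewrite !mnmDE !mnm1E.
have := congr1 (fun A : 'M_n => A k l) (gmod_comm M bij (erefl (b p))).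
rewrite [LHS]mxE [X in _ + X]mxE gmod_diag_mul mul_gmod_diag !mxE.
have -> : (j == p)%:R * E i p k l = (j == p)%:R * E i j k l by case: eqP => [->|_]; rewrite ?mul0r.
have -> : (p == i)%:R * E p j k l = (p == i)%:R * E i j k l by case: eqP => [->|_]; rewrite ?mul0r.
move=> h; have {}h : (wt k p)%:R - (wt l p)%:R = (j == p)%:R - (i == p)%:R :> rat.
  by apply: (mulIf e0); rewrite (eq_sym i); move: h; lra.
have {}h : ((wt l p)%:R + (j == p)%:R = (wt k p)%:R + (i == p)%:R :> rat) by lra.
by apply/eqP; rewrite -(eqr_nat rat) !natrD; apply/eqP.
Qed.
End Theory.
End GMod.

(** * The Casimir operator and highest weight vectors *)

Section HighestWeight.
Variables (r : nat) (b : 'I_r -> nat).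
Variables (n : nat) (E : 'I_r -> 'I_r -> 'M[rat]_n).
Variables (wt : 'I_n -> 'X_{1..r}) (d : 'I_n -> rat).
Hypothesis M : gmod b E wt d.

Local Notation D := (gram d).

Definition casimir : 'M[rat]_n := \sum_i \sum_(j | b j == b i) E i j *m E j i.

(** The commutator is a derivation, so each product [E i j *m E j i] yields four terms; after
    summation the Kronecker symbols leave four single sums that cancel in pairs. *)
Lemma casimir_comm k l : b k = b l -> E k l *m casimir = casimir *m E k l.
Proof.
move=> bkl; apply/eqP; rewrite -subr_eq0; apply/eqP.
rewrite /casimir mulmx_sumr mulmx_suml -sumrB.
have -> : \sum_i (E k l *m (\sum_(j | b j == b i) E i j *m E j i) -
     (\sum_(j | b j == b i) E i j *m E j i) *m E k l) =
  \sum_i \sum_(j | b j == b i)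
    (((j == k)%:R *: E i l - (l == i)%:R *: E k j) *m E j i +
     E i j *m ((i == k)%:R *: E j l - (l == j)%:R *: E k i)).
  apply: eq_bigr => i _; rewrite mulmx_sumr mulmx_suml -sumrB.
  apply: eq_bigr => j /eqP bij.
  rewrite -(gmod_comm M (esym bij) bkl) -(gmod_comm M bij bkl).
  by rewrite mulmxBl mulmxBr !mulmxA addrA subrK.
have split4 i j : ((j == k)%:R *: E i l - (l == i)%:R *: E k j) *m E j i +
     E i j *m ((i == k)%:R *: E j l - (l == j)%:R *: E k i) =
  (j == k)%:R *: (E i l *m E j i) - (l == i)%:R *: (E k j *m E j i) +
  ((i == k)%:R *: (E i j *m E j l) - (l == j)%:R *: (E i j *m E k i)).
  by rewrite mulmxBl mulmxBr -!scalemxAl -!scalemxAr.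
under eq_bigr do under eq_bigr do rewrite split4.
under eq_bigr do rewrite big_split /= !sumrB.
rewrite big_split /= !sumrB.
have sum1 (G : 'I_r -> 'I_r -> 'M[rat]_n) :
    \sum_i \sum_(j | b j == b i) (j == k)%:R *: G i j = \sum_(i | b i == b k) G i k.
  rewrite [RHS]big_mkcond; apply: eq_bigr => i _.
  have [bik|bik] := eqVneq (b i) (b k).
    rewrite (bigD1 k) ?bik //= eqxx scale1r big1 ?addr0 // => j /andP[_ /negPf->].
    by rewrite scale0r.
  rewrite big1 // => j /eqP bji; case: eqP => [jk|_]; last by rewrite scale0r.
  by rewrite -bji jk eqxx in bik.
have sum2 (G : 'I_r -> 'I_r -> 'M[rat]_n) p :
    \sum_i \sum_(j | b j == b i) (i == p)%:R *: G i j = \sum_(j | b j == b p) G p j.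
  rewrite (bigD1 p) //= eqxx; under eq_bigr do rewrite scale1r.
  rewrite [X in _ + X]big1 ?addr0 // => i /negPf->.
  by rewrite big1 // => j _; rewrite scale0r.
have sum1' (G : 'I_r -> 'I_r -> 'M[rat]_n) :
    \sum_i \sum_(j | b j == b i) (l == j)%:R *: G i j = \sum_(i | b i == b l) G i l.
  rewrite [RHS]big_mkcond; apply: eq_bigr => i _.
  have [bik|bik] := eqVneq (b i) (b l).
    rewrite (bigD1 l) ?bik //= eqxx scale1r big1 ?addr0 // => j /andP[_ /negPf].
    by rewrite eq_sym => ->; rewrite scale0r.
  rewrite big1 // => j /eqP bji; case: eqP => [jk|_]; last by rewrite scale0r.
  by rewrite -bji -jk eqxx in bik.
rewrite (sum1 (fun i j => E i l *m E j i)) (sum2 (fun i j => E i j *m E j l)).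
rewrite (sum1' (fun i j => E i j *m E k i)).
under [X in _ - X + _]eq_bigr do under eq_bigr do rewrite eq_sym.
rewrite (sum2 (fun i j => E k j *m E j i)) bkl.
by rewrite addrC addrA subrK subrr.
Qed.

Lemma casimir_adj : casimir *m D = D *m casimir^T.
Proof.
rewrite /casimir mulmx_suml raddf_sum mulmx_sumr; apply: eq_bigr => i _.
rewrite mulmx_suml raddf_sum mulmx_sumr; apply: eq_bigr => j /eqP bij.
rewrite -mulmxA (gmod_adjE M) // mulmxA (gmod_adjE M); last exact: esym.
by rewrite -mulmxA /= trmx_mul.
Qed.

Definition isw (w : 'X_{1..r}) (v : 'rV[rat]_n) := forall k, v 0 k != 0 -> wt k = w.

Lemma iswP w v : isw w v <-> forall i, v *m E i i = (w i)%:R *: v.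
Proof.
split=> [h i|h k vk].
  apply/rowP => k; rewrite (mul_gmod_diag M) mxE mulrC.
  by have [->|/h->//] := eqVneq (v 0 k) 0; rewrite !mulr0.
apply/mnmP => i; have /rowP/(_ k) := h i.
rewrite (mul_gmod_diag M) mxE mulrC => /(mulIf vk)/eqP.
by rewrite eqr_nat => /eqP.
Qed.

Definition hwv w v :=
  isw w v /\ forall i j : 'I_r, (i < j)%N -> b i = b j -> v *m E i j = 0.

(** For [i < j] the product [E i j *m E j i] starts with a raising operator, which kills [v]; for
    [j < i] it may be replaced by the commutator, worth [w j - w i]. These differences add up to the
    [rho2] part of [cas]. *)
Lemma casimir_hwv w v : hwv w v -> v *m casimir = cas b w *: v.
Proof.
case=> /iswP wv hv; rewrite /casimir mulmx_sumr.
have term i j : b j == b i -> v *m (E i j *m E j i) =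
   ((if i == j then (w i)%:R * (w i)%:R else 0) +
   (if (j < i)%N then (w j)%:R - (w i)%:R else 0)) *: v.
  move=> /eqP bij; rewrite mulmxA; case: (ltngtP j i) => ij.
  - have := gmod_comm M bij (esym bij); rewrite !eqxx !scale1r => /(congr1 (mulmx v)).
    rewrite !mulmxBr !mulmxA !wv (hv j i) // mul0mx subr0 => ->.
    by rewrite (gtn_eqF ij : i == j = false) add0r scalerBl.
  - by rewrite hv // mul0mx (ltn_eqF ij : i == j = false) addr0 scale0r.
  - by move/val_inj: ij => ->; rewrite eqxx addr0 wv -scalemxAl wv scalerA.
under eq_bigr do rewrite mulmx_sumr.
under eq_bigr do under eq_bigr do rewrite term //.
under eq_bigr do rewrite -scaler_suml.
rewrite -scaler_suml; congr (_ *: _).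
rewrite /cas; under eq_bigr do rewrite big_split /=.
under [RHS]eq_bigr do rewrite mulrDr.
rewrite !big_split /=; congr (_ + _).
  apply: eq_bigr => i _; rewrite (bigD1 i) //= eqxx big1 ?addr0 // => j /andP[_ /negPf].
  by rewrite eq_sym => ->.
have -> : \sum_(i < r) \sum_(j < r | b j == b i)
    (if (j < i)%N then (w j)%:R - (w i)%:R else 0) =
  \sum_(i < r) \sum_(j < r | b j == b i) (j < i)%N%:R * (w j)%:R -
  \sum_(i < r) \sum_(j < r | b j == b i) (j < i)%N%:R * (w i)%:R :> rat.
  rewrite -sumrB; apply: eq_bigr => i _; rewrite -sumrB; apply: eq_bigr => j _.
  by case: (j < i)%N; rewrite ?mul1r ?mul0r ?subrr.
rewrite [X in X - _](exchange_big_dep xpredT) //= -sumrB; apply: eq_bigr => i _.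
rewrite /rho2 sumrB mulrBr [_ * \sum_(_ | _) _]mulr_sumr [X in _ = _ - X]mulr_sumr.
by congr (_ - _); [apply: eq_big => [j|j _]|apply: eq_bigr => j _];
  rewrite 1?eq_sym 1?mulrC.
Qed.

Lemma isw_neq0 w v : v != 0 -> isw w v -> exists k, wt k = w.
Proof. by move=> /rV0Pn [k vk] h; exists k; apply: h. Qed.

Lemma isw_shift w v i j l : isw w v -> b i = b j -> (v *m E i j) 0 l != 0 ->
  (wt l + U_(j) = w + U_(i))%MM.
Proof.
move=> wv bij; rewrite mxE => h.
have [k] : exists k, v 0 k * E i j k l != 0.
  apply/existsP; apply: contraNT h; rewrite negb_exists => /forallP h.
  by rewrite big1 // => k _; apply/eqP; rewrite -[_ == _]negbK.
by rewrite mulf_eq0 negb_or => /andP[/wv <- /(gmod_shift M bij)].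
Qed.

Lemma isw_raise w v (i j : 'I_r) : isw w v -> (i < j)%N -> b i = b j -> v *m E i j != 0 ->
  exists2 w', isw w' (v *m E i j) & prec b w w'.
Proof.
move=> wv ij bij v0; have /rV0Pn [l vl] := v0.
exists (wt l); last exact: prec_shift ij bij (isw_shift wv bij vl).
move=> k vk; apply: (@addIm _ U_(j)%MM).
by rewrite (isw_shift wv bij vl) (isw_shift wv bij vk).
Qed.

(** Raising operators are applied as long as one of them does not kill the vector. The height [ht]
    grows strictly each time and stays below [hm], because only weights of basis vectors occur. [S]
    carries along any property preserved by raising. *)
Lemma hw_exists (S : 'rV[rat]_n -> Prop) w v :
  (forall (i j : 'I_r) u, (i < j)%N -> b i = b j -> S u -> S (u *m E i j)) ->
  isw w v -> v != 0 -> S v ->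
  exists w' v', [/\ v' != 0, hwv w' v', S v' & w' = w \/ prec b w w'].
Proof.
move=> Sst; pose ht (u : 'X_{1..r}) := (\sum_(i < r) (r - i) * u i)%N.
pose hm := (\sum_k ht (wt k))%N.
have hm_le u : (exists k, wt k = u) -> (ht u <= hm)%N.
  by case=> k <-; rewrite /hm (bigD1 k) //= leq_addr.
have [N] := ubnP (hm - ht w); elim: N w v => // N IH w v hN wv v0 Sv.
have [[[i j] /= [ij [bij vE]]]|nE] :=
    classic (exists p : 'I_r * 'I_r, (p.1 < p.2)%N /\ b p.1 = b p.2 /\ v *m E p.1 p.2 != 0).
  have /rV0Pn [l vl] := vE; have [w1 w1v pw] := isw_raise wv ij bij vE.
  have wtl := w1v _ vl; have e := isw_shift wv bij vl; rewrite wtl in e.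
  have hlt : (ht w < ht w1)%N.
    have : (\sum_(p < r) (r - p) * (w1 + U_(j))%MM p = \sum_(p < r) (r - p) * (w + U_(i))%MM p)%N.
      by rewrite e.
    under eq_bigr do rewrite mnmDE mulnDr; under [RHS]eq_bigr do rewrite mnmDE mulnDr.
    rewrite !big_split /= -!/(ht _).
    have hU (p : 'I_r) : ht U_(p)%MM = (r - p)%N.
      rewrite /ht (bigD1 p) //= big1 ?addn0 => [|q /negPf qp]; rewrite mnm1E ?eqxx ?muln1 //.
      by rewrite eq_sym qp muln0.
    by rewrite !hU; have := ltn_ord i; have := ltn_ord j; lia.
  have := hm_le w1 (isw_neq0 vE w1v) => hle.
  have [|w2 [v2 [v20 hv2 S2 w12]]] := IH w1 _ _ w1v vE (Sst _ _ _ ij bij Sv).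
    by lia.
  exists w2, v2; split=> //; right.
  by case: w12 => [->//|]; apply: prec_trans pw.
exists w, v; split=> //; last by left.
split=> // i j ij bij; apply/eqP; apply: contra_notT nE => vE.
by exists (i, j).
Qed.

(** By adjointness and the commutation relation, the squared length of [v *m E j i] is [w i - w j]
    times that of [v]. *)
Lemma hwv_dominant w v : v != 0 -> hwv w v -> wdom b w.
Proof.
move=> v0 [/iswP wv hv] i j ij bij.
have : 0 <= ((v *m E j i) *m D *m (v *m E j i)^T) 0 0 by apply: gram_ge0; apply: gmod_gt0 M.
have -> : v *m E j i *m D *m (v *m E j i)^T = ((w i)%:R - (w j)%:R) *: (v *m D *m v^T).
  rewrite trmx_mul mulmxA -(mulmxA _ D) -(gmod_adjE M) // !mulmxA.
  have := gmod_comm M bij (esym bij); rewrite !eqxx !scale1r => /(congr1 (mulmx v)).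
  rewrite !mulmxBr !mulmxA !wv (hv i j) // mul0mx subr0 => ->.
  by rewrite -scalerBl -!scalemxAl.
rewrite mxE pmulr_lge0 ?subr_ge0 ?ler_nat //.
by apply: gram_neq0 v0; apply: gmod_gt0 M.
Qed.

(* A highest weight vector above nu would have a strictly larger Casimir
   eigenvalue. *)
Lemma casimir_max nu w v : wdom b nu -> v != 0 -> isw w v ->
  v *m casimir = cas b nu *: v -> ~ prec b nu w.
Proof.
move=> nud v0 wv cv pw.
have [|w' [v' [v'0 hv' cv' ww']]] :=
    @hw_exists (fun u => u *m casimir = cas b nu *: u) w v _ wv v0 cv.
  by move=> i j u _ bij cu; rewrite -mulmxA (casimir_comm bij) mulmxA cu scalemxAl.
have pw' : prec b nu w' by case: ww' => [->//|]; apply: prec_trans.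
have := cas_lt nud (hwv_dominant v'0 hv') pw'.
suff -> : cas b w' = cas b nu by rewrite ltxx.
apply/eqP; rewrite -subr_eq0; have/eqP := cv'; rewrite (casimir_hwv hv') -subr_eq0 -scalerBl.
by rewrite scaler_eq0 (negPf v'0) orbF.
Qed.

Definition HW (w : 'X_{1..r}) : 'M[rat]_n :=
  ((\bigcap_(p : 'I_r * 'I_r | (p.1 < p.2)%N && (b p.1 == b p.2)) kermx (E p.1 p.2)) :&:
   (\bigcap_i kermx (E i i - ((w i)%:R)%:M)))%MS.

Lemma HWP w (v : 'rV_n) : (v <= HW w)%MS <-> hwv w v.
Proof.
rewrite /HW sub_capmx; split=> [/andP[/sub_bigcapmxP h /sub_bigcapmxP k]|[/iswP wv hv]].
  split=> [|i j ij /eqP bij].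
    apply/iswP => i; apply/eqP; rewrite -subr_eq0 -mul_mx_scalar -mulmxBr.
    by apply/eqP/sub_kermxP/k.
  by apply/sub_kermxP; apply: (h (i, j)); rewrite /= ij.
apply/andP; split; [apply/sub_bigcapmxP => -[i j] /= /andP[ij /eqP bij]|
  apply/sub_bigcapmxP => i _]; apply/sub_kermxP.
  exact: hv.
by rewrite mulmxBr wv mul_mx_scalar subrr.
Qed.

End HighestWeight.

(** * Counting highest weight vectors *)

Section Euler.
Variable r : nat.
Implicit Types p q : {mpoly rat[r]}.

Definition eul (i : 'I_r) p := 'X_i * p^`M(i).

Lemma eulD i p q : eul i (p + q) = eul i p + eul i q.
Proof. by rewrite /eul mderivD mulrDr. Qed.

Lemma eulB i p q : eul i (p - q) = eul i p - eul i q.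
Proof. by rewrite /eul mderivB mulrBr. Qed.

Lemma eulZ i c p : eul i (c *: p) = c *: eul i p.
Proof. by rewrite /eul mderivZ scalerAr. Qed.

Lemma eulM i p q : eul i (p * q) = eul i p * q + p * eul i q.
Proof. by rewrite /eul mderivM; ring. Qed.

Lemma eul1 i : eul i 1 = 0.
Proof. by rewrite /eul -(@mpolyC1 r rat) mderivC mulr0. Qed.

Lemma eul_sum i (I : Type) (s : seq I) P (G : I -> {mpoly rat[r]}) :
  eul i (\sum_(x <- s | P x) G x) = \sum_(x <- s | P x) eul i (G x).
Proof. by rewrite /eul linear_sum mulr_sumr. Qed.

Lemma eulX i m : eul i 'X_[m] = (m i)%:R *: 'X_[m].
Proof.
rewrite /eul mderivX -scalerAr; have [->|mi] := eqVneq (m i) 0%N; first by rewrite !scale0r.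
by rewrite -mpolyXD addmC submK // lep1mP.
Qed.

Lemma mcoeff_eul i p m : (eul i p)@_m = (m i)%:R * p@_m.
Proof.
rewrite {1}(mpolyE p) eul_sum [in RHS](mpolyE p) !raddf_sum mulr_sumr.
apply: eq_bigr => k _; rewrite eulZ eulX /= !mcoeffZ mcoeffX.
by case: eqP => [->|_]; rewrite ?mulr0 // !mulr1 mulrC.
Qed.

Lemma eul_prod i (I : eqType) (s : seq I) P (f : I -> {mpoly rat[r]}) : uniq s ->
  eul i (\prod_(x <- s | P x) f x) =
  \sum_(x <- s | P x) eul i (f x) * \prod_(y <- s | P y && (y != x)) f y.
Proof.
elim: s => [|z s IH] /=; first by rewrite !big_nil eul1.
case/andP=> zs us; rewrite !big_cons; case: ifP => Pz; last first.
  by rewrite IH //; apply: eq_bigr => x _; rewrite big_cons Pz.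
rewrite eulM IH // eqxx andbF mulr_sumr; congr (_ * _ + _).
  rewrite big_seq_cond [RHS]big_seq_cond; apply: eq_bigl => x.
  have [->|] := eqVneq x z; first by rewrite (negPf zs).
  by rewrite andbT.
rewrite [LHS]big_seq_cond [RHS]big_seq_cond; apply: eq_bigr => x /andP[xs _].
rewrite big_cons Pz; case: eqP => [zx|_] /=; first by rewrite zx xs in zs.
by rewrite mulrCA.
Qed.

End Euler.

Section Freudenthal.
Variables (r : nat) (b : 'I_r -> nat).

Definition posroot (p : 'I_r * 'I_r) := (p.1 < p.2)%N && (b p.1 == b p.2).

Definition vdm : {mpoly rat[r]} := \prod_(p | posroot p) ('X_p.1 - 'X_p.2).

Definition nsim (i : 'I_r) : nat := \sum_(j | (b j == b i) && (j != i)) 1.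

(** Up to a constant, the squared length of [m] recentred at [nsim / 2]. Since [rdelta] is rho plus
    [nsim / 2], a shift that makes its exponents natural numbers, this is the form for which
    [qf_shift] yields the Casimir eigenvalue. *)
Definition qf (m : 'X_{1..r}) : rat := \sum_i (m i)%:R * ((m i)%:R - (nsim i)%:R).

Definition lap (p : {mpoly rat[r]}) :=
  \sum_i (eul i (eul i p) - (nsim i)%:R *: eul i p).

Definition rdelta : 'X_{1..r} := [multinom \sum_(j : 'I_r | (i < j)%N && (b i == b j)) 1 | i < r]%N.

Lemma mcoeff_lap p m : (lap p)@_m = qf m * p@_m.
Proof.
rewrite /lap raddf_sum /qf mulr_suml; apply: eq_bigr => i _ /=.
by rewrite mcoeffB mcoeffZ !mcoeff_eul; ring.
Qed.

Lemma sum_pairs (V : zmodType) (G : 'I_r -> 'I_r -> V) :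
  \sum_i \sum_(j | (b j == b i) && (j != i)) G i j =
  \sum_(p | posroot p) (G p.1 p.2 + G p.2 p.1).
Proof.
rewrite pair_big_dep (bigID (fun p : 'I_r * 'I_r => (p.1 < p.2)%N)) /= big_split /=.
congr (_ + _).
  apply: eq_bigl => -[i j]; rewrite /posroot /= eq_sym [j == i]eq_sym -val_eqE /=.
  by rewrite neq_ltn; case: ltngtP; rewrite ?andbT ?andbF.
rewrite (reindex_inj (inv_inj (@swap_pairK _ _))) /=.
apply: eq_bigl => -[i j]; rewrite /posroot /= -val_eqE /= -leqNgt neq_ltn.
by case: ltngtP; rewrite ?andbT ?andbF.
Qed.

Lemma qf_shift nu : qf (nu + rdelta) - qf rdelta = cas b nu.
Proof.
rewrite /qf -sumrB; apply: eq_bigr => i _; rewrite mnmDE natrD.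
suff -> : rho2 b i = (rdelta i)%:R + (rdelta i)%:R - (nsim i)%:R by ring.
have -> : (nsim i)%:R = (rdelta i)%:R + \sum_(j | b j == b i) (j < i)%N%:R :> rat.
  rewrite /nsim mnmE !natr_sum /= [\sum_(_ | (_ < _)%N && _) _](_ : _ =
    \sum_(j | b j == b i) (i < j)%N%:R); last first.
    rewrite big_mkcond [RHS]big_mkcond; apply: eq_bigr => j _.
    by rewrite eq_sym; case: (b j == b i); rewrite ?andbF ?andbT //=; case: (i < j)%N.
  rewrite -big_split big_mkcond [RHS]big_mkcond; apply: eq_bigr => j _.
  rewrite -val_eqE /=; case: (b j == b i) => //=.
  by case: ltngtP => /= _; rewrite ?addr0 ?add0r.
rewrite /rho2 sumrB opprD addrA addrK mnmE natr_sum; congr (_ - _).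
rewrite big_mkcond [RHS]big_mkcond; apply: eq_bigr => j _.
by rewrite [b i == _]eq_sym; case: (b j == b i); rewrite ?andbF ?andbT //=; case: (i < j)%N.
Qed.

Definition leads (p : {mpoly rat[r]}) (m : 'X_{1..r}) :=
  forall t, t \in msupp (p - 'X_[m]) -> prec b t m.

Lemma leads1 : leads 1 0%MM.
Proof. by move=> t; rewrite mpolyX0 subrr msupp0. Qed.

Lemma precD2r t m m' : prec b t m -> prec b (t + m')%MM (m + m')%MM.
Proof. by move=> h g gd; rewrite !wdotD ltrD2r h. Qed.

Lemma leadsM p q m m' : leads p m -> leads q m' -> leads (p * q) (m + m')%MM.
Proof.
move=> pm qm t.
have -> : p * q - 'X_[m + m'] = (p - 'X_[m]) * 'X_[m'] + 'X_[m] * (q - 'X_[m']) +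
   (p - 'X_[m]) * (q - 'X_[m']) by rewrite mpolyXD; ring.
move=> /msuppD_le; rewrite mem_cat => /orP[/msuppD_le|].
  rewrite mem_cat => /orP[] /msuppM_le /allpairsP [[t1 t2] /= [h1 h2 ->]].
    by move: h2 => /mem_msuppXP <-; apply/precD2r/pm.
  by move: h1 => /mem_msuppXP <-; rewrite !(addmC m); apply/precD2r/qm.
move=> /msuppM_le /allpairsP [[t1 t2] /= [/pm h1 /qm h2 ->]].
by apply: prec_trans (precD2r _ h1) _; rewrite !(addmC m); apply/precD2r.
Qed.

Lemma leads_vdm : leads vdm rdelta.
Proof.
have -> : rdelta = (\big[+%MM/0%MM]_(p | posroot p) U_(p.1))%MM.
  apply/mnmP => i; rewrite mnmE mnm_sumE.
  rewrite (eq_bigl (fun p => xpredT p.1 && posroot (p.1, p.2))); last by case.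
  rewrite -(pair_big_dep xpredT (fun i j => posroot (i, j)) (fun j k => U_(j)%MM i)) /=.
  rewrite [RHS](bigD1 i) //= [X in (_ + X)%N]big1 => [|j /negPf ji]; last first.
    by rewrite big1 // => k _; rewrite mnm1E ji.
  by rewrite addn0; apply: eq_bigr => j _; rewrite mnm1E eqxx.
rewrite /vdm; elim/big_rec2: _ => [|[i j] p m /andP[/= ij /eqP bij] IH]; first exact: leads1.
apply: leadsM IH => t; have -> : 'X_i - 'X_j - 'X_i = - 'X_j :> {mpoly rat[r]} by ring.
rewrite (perm_mem (msuppN _)) => /mem_msuppXP <- g gd.
by rewrite !wdotU gd.
Qed.

Section Char.
Variables (n : nat) (E : 'I_r -> 'I_r -> 'M[rat]_n).
Variables (wt : 'I_n -> 'X_{1..r}) (d : 'I_n -> rat).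
Hypothesis M : gmod b E wt d.

Definition chr (Q : 'M[rat]_n) : {mpoly rat[r]} := \sum_k Q k k *: 'X_[wt k].

Lemma chr_sum (I : Type) (s : seq I) P (G : I -> 'M[rat]_n) :
  chr (\sum_(x <- s | P x) G x) = \sum_(x <- s | P x) chr (G x).
Proof.
rewrite /chr exchange_big; apply: eq_bigr => k _.
by rewrite summxE scaler_suml.
Qed.

Lemma chrB A B : chr (A - B) = chr A - chr B.
Proof. by rewrite /chr -sumrB; apply: eq_bigr => k _; rewrite !mxE scalerBl. Qed.

Lemma chr_diag i Q : chr (E i i *m Q) = eul i (chr Q).
Proof.
rewrite /chr eul_sum; apply: eq_bigr => k _.
by rewrite (gmod_diag_mul M) eulZ eulX scalerA mulrC.
Qed.

Definition gcomm (Q : 'M[rat]_n) := forall i j, b i = b j -> E i j *m Q = Q *m E i j.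

(** Cyclicity of the trace. Moving [E i j] around changes the weight at which each term is recorded,
    and the factors ['X_i] and ['X_j] compensate for this. *)
Lemma chr_root Q i j : gcomm Q -> b i = b j ->
  'X_i * chr (E i j *m E j i *m Q) = 'X_j * chr (E j i *m E i j *m Q).
Proof.
move=> cQ bij.
have -> : E j i *m E i j *m Q = (E j i *m Q) *m E i j by rewrite -mulmxA cQ // mulmxA.
rewrite -mulmxA.
rewrite /chr !mulr_sumr.
under eq_bigr do rewrite mxE -scalerAr scaler_suml.
under [RHS]eq_bigr do rewrite mxE -scalerAr scaler_suml.
rewrite exchange_big; apply: eq_bigr => l _; apply: eq_bigr => k _ /=.
rewrite [_ * E i j k l]mulrC; have [->|e0] := eqVneq (E i j k l) 0.
  by rewrite !mul0r !scale0r.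
congr (_ *: _); rewrite -!mpolyXD addmC [(U_(j) + _)%MM]addmC.
by rewrite (gmod_shift M bij e0).
Qed.

Lemma chr_bracket Q i j : b i = b j ->
  chr (E j i *m E i j *m Q) - chr (E i j *m E j i *m Q) = eul i (chr Q) - eul j (chr Q).
Proof.
move=> bij; rewrite -!chr_diag -!chrB -!mulmxBl; congr (chr (_ *m _)).
by rewrite (gmod_comm M bij (esym bij)) !eqxx !scale1r.
Qed.

(** By the product rule, what remains beside [lap vdm * h] and [vdm] times the diagonal part of the
    Casimir trace is twice the mixed terms [eul i vdm * eul i h], minus the first-order terms in
    [nsim]. Grouped by the linear factors of [vdm], they give the Casimir contribution of one
    positive root each ([pairE]). *)
Lemma freudenthal Q : gcomm Q ->
  lap (vdm * chr Q) = vdm * chr (casimir b E *m Q) + lap vdm * chr Q.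
Proof.
move=> cQ; set h := chr Q.
have -> : chr (casimir b E *m Q) =
    \sum_i eul i (eul i h) +
    \sum_(p | posroot p) (chr (E p.1 p.2 *m E p.2 p.1 *m Q) + chr (E p.2 p.1 *m E p.1 p.2 *m Q)).
  rewrite -(sum_pairs (fun i j => chr (E i j *m E j i *m Q))) -big_split /=.
  rewrite /casimir mulmx_suml chr_sum; apply: eq_bigr => i _.
  rewrite mulmx_suml chr_sum (bigD1 i) //= -mulmxA !chr_diag; congr (_ + _).
have eul_vdm i : eul i vdm = \sum_(p | posroot p) ((i == p.1)%:R *: 'X_p.1 - (i == p.2)%:R *: 'X_p.2) *
     \prod_(q | posroot q && (q != p)) ('X_q.1 - 'X_q.2).
  rewrite /vdm eul_prod ?index_enum_uniq //; apply: eq_bigr => p _.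
  by rewrite eulB !eulX !mnm1E !(eq_sym i).
set ap := fun p : 'I_r * 'I_r => \prod_(q | posroot q && (q != p)) ('X_q.1 - 'X_q.2) : {mpoly rat[r]}.
have vdmE p : posroot p -> vdm = ('X_p.1 - 'X_p.2) * ap p.
  by move=> pp; rewrite /vdm (bigD1 p).
have cross : \sum_i eul i vdm * eul i h =
    \sum_(p | posroot p) ('X_p.1 * eul p.1 h - 'X_p.2 * eul p.2 h) * ap p.
  under eq_bigr do rewrite eul_vdm mulr_suml.
  rewrite exchange_big; apply: eq_bigr => p _ /=.
  have sel k : \sum_i (i == k)%:R *: 'X_k * eul i h = 'X_k * eul k h.
    rewrite (bigD1 k) //= eqxx scale1r big1 ?addr0 // => i /negPf->.
    by rewrite scale0r mul0r.
  rewrite -!sel -sumrB mulr_suml; apply: eq_bigr => i _; rewrite -/(ap p); ring.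
have nsumE : \sum_i (nsim i)%:R *: eul i h = \sum_(p | posroot p) (eul p.1 h + eul p.2 h).
  rewrite -(sum_pairs (fun i _ => eul i h)); apply: eq_bigr => i _.
  by rewrite /nsim natr_sum scaler_suml; apply: eq_bigr => j _; rewrite scale1r.
have pairE p : posroot p ->
   (('X_p.1 * eul p.1 h - 'X_p.2 * eul p.2 h) * ap p) *+ 2 - vdm * (eul p.1 h + eul p.2 h) =
   vdm * (chr (E p.1 p.2 *m E p.2 p.1 *m Q) + chr (E p.2 p.1 *m E p.1 p.2 *m Q)).
  move=> pp; have /andP[_ /eqP bp] := pp; rewrite (vdmE p pp).
  have := chr_root cQ bp; have := chr_bracket Q bp; rewrite -/h.
  move: (chr (E p.1 p.2 *m _ *m _)) (chr (E p.2 p.1 *m _ *m _)) => T T' e1 e2.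
  have -> : eul p.1 h = T' - T + eul p.2 h by rewrite e1; ring.
  have -> : 'X_p.1 * (T' - T + eul p.2 h) = 'X_p.1 * T' - 'X_p.2 * T' + 'X_p.1 * eul p.2 h.
    by rewrite -e2; ring.
  have -> : ('X_p.1 - 'X_p.2) * ap p * (T + T') =
     ('X_p.1 * T + 'X_p.1 * T' - 'X_p.2 * T - 'X_p.2 * T') * ap p by ring.
  have -> : ('X_p.1 - 'X_p.2) * ap p * (T' - T + eul p.2 h + eul p.2 h) =
     ('X_p.1 * T' - 'X_p.1 * T - 'X_p.2 * T' + 'X_p.2 * T
       + ('X_p.1 - 'X_p.2) * (eul p.2 h + eul p.2 h)) * ap p by ring.
  by rewrite e2; ring.
rewrite mulrDr [X in _ = _ + X + _]mulr_sumr.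
under [X in _ = _ + X + _]eq_bigr => p pp do rewrite -pairE //.
rewrite sumrB sumrMnl -cross -mulr_sumr -nsumE.
clearbody h; rewrite /lap mulr_suml !mulr_sumr -sumrMnl -!sumrB -!big_split /=.
apply: eq_bigr => i _; rewrite !eulM !eulD !eulM -!mul_mpolyC; ring.
Qed.

End Char.
End Freudenthal.

Lemma mul_mx_diag_row (F : fieldType) m n (A : 'M[F]_(m, n)) (f : 'I_n -> F) i j :
  (A *m diag_mx (\row_k f k)) i j = A i j * f j.
Proof. by rewrite mul_mx_diag !mxE. Qed.

Lemma mul_diag_row_mx (F : fieldType) m n (A : 'M[F]_(m, n)) (f : 'I_m -> F) i j :
  (diag_mx (\row_k f k) *m A) i j = f i * A i j.
Proof. by rewrite mul_diag_mx !mxE. Qed.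

Section HighestWeightCount.
Variables (r : nat) (b : 'I_r -> nat).
Variables (n : nat) (E : 'I_r -> 'I_r -> 'M[rat]_n).
Variables (wt : 'I_n -> 'X_{1..r}) (d : 'I_n -> rat).
Hypothesis M : gmod b E wt d.
Hypothesis vdm_qf : forall t, t \in msupp (vdm b) -> qf b t = qf b (rdelta b).
Variable nu : 'X_{1..r}.
Hypothesis nu_dom : wdom b nu.

Local Notation D := (gram d).
Local Notation C := (casimir b E).
Let X := C - (cas b nu)%:M.
Let P := proj_mx (kermx X) X.

Lemma lap_vdm : lap b (vdm b) = qf b (rdelta b) *: vdm b.
Proof.
apply/mpolyP => m; rewrite mcoeff_lap mcoeffZ.
have [/vdm_qf->//|/memN_msupp_eq0->] := boolP (m \in msupp (vdm b)).
by rewrite !mulr0.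
Qed.

Lemma shifted_casimir_comm i j : b i = b j -> E i j *m X = X *m E i j.
Proof.
by move=> bij; rewrite /X mulmxBr mulmxBl (casimir_comm M bij) mul_mx_scalar mul_scalar_mx.
Qed.

Lemma shifted_casimir_adj : X *m D = D *m X^T.
Proof.
rewrite /X mulmxBl (casimir_adj M) linearB /= tr_scalar_mx mulmxBr.
by rewrite mul_scalar_mx mul_mx_scalar.
Qed.

(** [X] is self-adjoint for a definite form, so a vector in both its kernel and its image is
    orthogonal to itself. Hence [P] is the projection onto the eigenspace along the image. *)
Lemma ker_im_casimir : (kermx X :&: X = 0)%MS.
Proof.
apply/eqP; rewrite -submx0; apply/rV_subP => u; rewrite sub_capmx submx0.
case/andP=> /sub_kermxP uX /submxP [v uE]; apply/eqP.
apply: (gram_eq0 (gmod_gt0 M)).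
by rewrite {1}uE -(mulmxA v) shifted_casimir_adj -!mulmxA -trmx_mul uX trmx0 !mulmx0.
Qed.

Lemma casproj_ker : P *m X = 0.
Proof. by apply/sub_kermxP; rewrite -[P]mul1mx proj_mx_sub. Qed.

Lemma casproj_id m (A : 'M_(m, n)) : A *m X = 0 -> A *m P = A.
Proof. by move=> /sub_kermxP AX; rewrite proj_mx_id // ker_im_casimir. Qed.

Lemma casproj_idem : P *m P = P.
Proof. exact: casproj_id casproj_ker. Qed.

Lemma casproj_im : X *m P = 0.
Proof. by rewrite proj_mx_0 // ker_im_casimir. Qed.

Lemma casproj_compl : exists Y, 1%:M - P = Y *m X.
Proof.
apply/submxP; have full : (1%:M <= kermx X + X)%MS.
  rewrite sub1mx /row_full; have := mxrank_sum_cap (kermx X) X.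
  by rewrite ker_im_casimir mxrank0 addn0 => ->; rewrite mxrank_ker subnK ?rank_leq_row.
have := add_proj_mx ker_im_casimir full; rewrite !mul1mx => /(canRL (addKr _)).
by rewrite addrC -/P => <-; rewrite -[proj_mx _ _]mul1mx proj_mx_sub.
Qed.

Lemma casproj_comm A : A *m X = X *m A -> A *m P = P *m A.
Proof.
move=> AX; have [Y PY] := casproj_compl.
have -> : A *m P = P *m A *m P.
  apply/eqP; rewrite -subr_eq0 -mulmxBl -[X in X - _]mul1mx -mulmxBl PY.
  by rewrite -!mulmxA (mulmxA X) -AX -(mulmxA A) casproj_im !mulmx0.
by rewrite casproj_id // -mulmxA AX mulmxA casproj_ker mul0mx.
Qed.

Lemma casproj_gcomm : gcomm b E P.
Proof. by move=> i j bij; apply/casproj_comm/shifted_casimir_comm. Qed.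

Lemma casproj_unit : X + P \in unitmx.
Proof.
rewrite -row_free_unit -kermx_eq0 -submx0; apply/rV_subP => v /sub_kermxP.
rewrite mulmxDr => h; have vP : v *m P = 0.
  by rewrite -casproj_idem mulmxA -[X in X *m _](addKr (v *m X)) h addr0 mulNmx -mulmxA casproj_im mulmx0 oppr0.
by move: h; rewrite vP addr0 => /casproj_id; rewrite vP => <-; rewrite sub0mx.
Qed.

(** The matrix [X + P] is invertible, and its inverse [Q] commutes with the action and satisfies
    [X *m Q = 1 - P]. The trace identity for [Q], read at [nu + rdelta], equates the trace of the
    Casimir times [Q] with [qf (nu + rdelta) - qf rdelta = cas b nu] times that of [Q], so the part
    belonging to [X *m Q] is zero. *)
Lemma chr_casproj_compl : (vdm b * chr wt (1%:M - P))@_(nu + rdelta b) = 0.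
Proof.
pose Q := invmx (X + P).
have XQ : X *m Q = 1%:M - P.
  have PQ : P *m Q = P.
    have PP : P *m (X + P) = P by rewrite mulmxDr casproj_ker add0r casproj_idem.
    by rewrite -{1}PP -mulmxA mulmxV ?mulmx1 // casproj_unit.
  by rewrite -[in RHS]PQ -(mulmxV casproj_unit) -mulmxBl addrK.
have cQ : gcomm b E Q.
  move=> i j bij; have e : E i j *m (X + P) = (X + P) *m E i j.
    by rewrite mulmxDr mulmxDl shifted_casimir_comm // casproj_gcomm.
  rewrite /Q -[LHS]mul1mx -(mulVmx casproj_unit) -!mulmxA; congr (_ *m _).
  by rewrite mulmxA -e -mulmxA mulmxV ?mulmx1 // casproj_unit.
rewrite -XQ /X mulmxBl chrB mul_scalar_mx.
have -> : chr wt (cas b nu *: Q) = cas b nu *: chr wt Q.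
  by rewrite /chr scaler_sumr; apply: eq_bigr => k _; rewrite mxE scalerA.
have /(congr1 (mcoeff (nu + rdelta b)%MM)) := freudenthal M cQ.
rewrite lap_vdm mcoeff_lap mcoeffD -scalerAl mcoeffZ => h.
rewrite mulrBr mcoeffB -scalerAr mcoeffZ -qf_shift.
by apply: (addIr (qf b (rdelta b) * (vdm b * chr wt Q)@_(nu + rdelta b))); rewrite addrAC -h; ring.
Qed.

Lemma casproj_row k : isw wt (wt k) (row k P).
Proof.
move=> l; rewrite mxE => Pkl; apply/mnmP => i.
have := congr1 (fun A : 'M_n => A k l) (casproj_gcomm (erefl (b i))).
rewrite (gmod_diag_mul M) (mul_gmod_diag M) mulrC => /(mulfI Pkl)/eqP.
by rewrite eqr_nat => /eqP.
Qed.

Lemma mcoeff_chr (Q : 'M[rat]_n) w : (chr wt Q)@_w = \sum_(k | wt k == w) Q k k.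
Proof.
rewrite /chr raddf_sum /= [RHS]big_mkcond; apply: eq_bigr => k _.
by rewrite mcoeffZ mcoeffX; case: eqP => _; rewrite ?mulr1 ?mulr0.
Qed.

Lemma chr_casproj_max w : prec b nu w -> (chr wt P)@_w = 0.
Proof.
move=> pw; rewrite mcoeff_chr big1 // => k /eqP wk.
apply/eqP; apply: contraT => Pkk; exfalso.
have r0 : row k P != 0 by apply/rV0Pn; exists k; rewrite mxE.
apply: (casimir_max M nu_dom r0 (casproj_row (k := k)) _ _); last by rewrite wk.
have : row k P *m X = 0 by rewrite -row_mul casproj_ker row0.
by rewrite /X mulmxBr mul_mx_scalar => /eqP; rewrite subr_eq0 => /eqP.
Qed.

(** A monomial of [p] other than [m] would have to meet a coefficient of [q] strictly above [w],
    where [q] vanishes. *)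
Lemma leads_mcoeff p m : leads b p m -> forall q w,
  (forall w', prec b w w' -> q@_w' = 0) -> (p * q)@_(w + m) = q@_w.
Proof.
move=> pm q w qw; rewrite -[p](subrK 'X_[m]) mulrDl mcoeffD [_ * q]mulrC addmC.
rewrite [X in X + _ = _]memN_msupp_eq0 ?add0r; first by rewrite mulrC mcoeffMX.
apply/negP => /msuppM_le /allpairsP [[t1 t2] /= [h1 h2 e]].
move: h1; rewrite mcoeff_msupp qw ?eqxx // => g gd.
have := congr1 (wdot g) e; rewrite !wdotD.
by have := pm _ h2 g gd; lra.
Qed.

(* Weyl's character formula, read off at nu: the alternating product of the
   character with the denominator vdm counts highest weight vectors. *)
Lemma rank_HW : (\rank (HW b E nu))%:R =
  (vdm b * \sum_k 'X_[wt k])@_(nu + rdelta b) :> rat.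
Proof.
have -> : \sum_k 'X_[wt k] = chr wt (1%:M - P) + chr wt P.
  rewrite /chr -big_split; apply: eq_bigr => k _ /=.
  by rewrite -scalerDl !mxE eqxx subrK scale1r.
rewrite mulrDr mcoeffD chr_casproj_compl add0r.
rewrite (leads_mcoeff (@leads_vdm _ b)); last exact: chr_casproj_max.
(* [pi] projects onto weight [nu]. In the eigenspace cut out by [P] no weight lies above [nu], so
   its vectors of weight [nu] are killed by raising: [P *m pi] is a projection onto [HW b E nu], and
   its trace is the rank. *)
pose pi := diag_mx (\row_k (wt k == nu)%:R : 'rV[rat]_n).
have Ppi : P *m pi = pi *m P.
  apply/matrixP => k l; rewrite mul_mx_diag_row mul_diag_row_mx.
  have [->|Pkl] := eqVneq (P k l) 0; first by rewrite mulr0 mul0r.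
  by rewrite mulrC; congr (_%:R * _); rewrite (@casproj_row k l) // mxE.
have pipi : pi *m pi = pi.
  apply/matrixP => k l; rewrite mul_mx_diag !mxE.
  by case: (k =P l) => [<-|_]; case: (wt k == nu); case: (wt l == nu); rewrite ?mulr1n ?mulr0n ?mulr1 ?mulr0 ?mul0r.
have idem : (P *m pi) *m (P *m pi) = P *m pi.
  by rewrite {1}Ppi -mulmxA (mulmxA P) casproj_idem Ppi mulmxA pipi.
have -> : (chr wt P)@_nu = \tr (P *m pi).
  rewrite mcoeff_chr /mxtrace [LHS]big_mkcond; apply: eq_bigr => k _.
  by rewrite mul_mx_diag_row; case: eqP; rewrite ?mulr1 ?mulr0.
rewrite (mxtrace_idem idem); congr (_%:R).
apply/eqP; rewrite eqn_leq; apply/andP; split; apply: mxrankS; apply/rV_subP => v.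
  move=> /(HWP M) hv; have := casimir_hwv M hv => /eqP; rewrite -subr_eq0 -mul_mx_scalar -mulmxBr.
  move=> /eqP/casproj_id vP; apply/submxP; exists v; rewrite mulmxA vP.
  apply/rowP => k; rewrite mul_mx_diag_row.
  have [->|vk] := eqVneq (v 0 k) 0; first by rewrite mul0r.
  by case: hv => /(_ k vk) ->; rewrite eqxx mulr1.
case/submxP=> y vE; apply/(HWP M).
have wv : isw wt nu v.
  move=> k; rewrite vE mulmxA mul_mx_diag_row; case: (wt k =P nu) => // _.
  by rewrite mulr0 eqxx.
have vX : v *m C = cas b nu *: v.
  have : v *m X = 0 by rewrite vE Ppi (mulmxA y) -(mulmxA (y *m pi)) casproj_ker mulmx0.
  by rewrite /X mulmxBr mul_mx_scalar => /eqP; rewrite subr_eq0 => /eqP.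
split=> // i j ij bij; apply/eqP; apply: contraT => v0; exfalso.
have [w' w'v] := isw_raise M wv ij bij v0.
apply: (casimir_max M nu_dom v0 w'v).
by rewrite -mulmxA (casimir_comm M bij) mulmxA vX scalemxAl.
Qed.

End HighestWeightCount.

(** * The Reynolds operator and intertwiners *)

(** A matrix whose row space lies in [S] is enlarged by vectors of [S] outside it; the rank is
    bounded by [n], so this stops. Excluded middle decides whether such a vector is left. *)
Lemma subspace_mx (F : fieldType) n (S : 'rV[F]_n -> Prop) :
  S 0 -> (forall c u v, S u -> S v -> S (c *: u + v)) ->
  exists A : 'M[F]_n, forall v, S v <-> (v <= A)%MS.
Proof.
move=> S0 Slin; pose good (A : 'M[F]_n) := forall v, (v <= A)%MS -> S v.
have : forall A, good A -> exists A' : 'M[F]_n, forall v, S v <-> (v <= A')%MS.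
  move=> A; have [N] := ubnP (n - \rank A); elim: N A => // N IH A hN gA.
  have [[v [Sv vA]]|nv] := classic (exists v, S v /\ ~~ (v <= A)%MS); last first.
    exists A => v; split=> [Sv|/gA//]; apply/negPn/negP => vA.
    by apply: nv; exists v.
  have lt : (\rank A < \rank (A + v)%MS)%N.
    have : (A < A + v)%MS.
      by rewrite ltmxE addsmxSl; apply: contra vA => h; apply: submx_trans (addsmxSr A v) h.
    by rewrite ltmxErank => /andP[].
  apply: (IH (A + v)%MS); first by have := rank_leq_row (A + v)%MS; lia.
  move=> w /sub_addsmxP [[w1 w2] /= ->]; rewrite addrC (mx11_scalar w2) mul_scalar_mx.
  by apply: Slin => //; apply: gA; rewrite submxMl.
by move=> /(_ 0); apply => v; rewrite submx0 => /eqP->.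
Qed.

Section Reynolds.
Variables (r : nat) (b : 'I_r -> nat) (n : nat).
Variables (E : 'I_r -> 'I_r -> 'M[rat]_n) (d : 'I_n -> rat).
Hypothesis d_gt0 : forall k, 0 < d k.
Hypothesis E_adj : forall i j k l, b i = b j -> E i j k l * d l = d k * E j i l k.

Local Notation D := (gram d).

Lemma adjE i j : b i = b j -> E i j *m D = D *m (E j i)^T.
Proof.
move=> bij; apply/matrixP => k l; rewrite mul_mx_gram E_adj //.
by rewrite mul_diag_mx !mxE.
Qed.

(** A vector orthogonal to the image of [E j i] is killed by its adjoint [E i j]. The section is
    phrased with adjointness and positivity instead of [gmod] because it must cover dual actions,
    whose negative weights have no place in ['X_{1..r}]. *)
Lemma reynolds_decomp (s : 'rV[rat]_n) : exists s' (y : 'I_r * 'I_r -> 'rV[rat]_n),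
  s = s' + \sum_(p | b p.1 == b p.2) y p *m E p.1 p.2 /\
  forall i j, b i = b j -> s' *m E i j = 0.
Proof.
pose A := (\sum_(p : 'I_r * 'I_r | b p.1 == b p.2) <<E p.1 p.2>>)%MS.
have [a [s' [sE s'A]]] := gram_decomp d_gt0 A s.
have /sub_sumsmxP [y yE] : (a *m A <= A)%MS by rewrite submxMl.
have gE (p : 'I_r * 'I_r) : exists c, <<E p.1 p.2>>%MS = c *m E p.1 p.2.
  by apply/submxP; rewrite genmxE.
have [c cE] := choice _ gE.
exists s', (fun p => y p *m c p); split.
  by rewrite sE yE addrC; congr (_ + _); apply: eq_bigr => p _; rewrite cE mulmxA.
move=> i j bij; have /submxP [e eE] : (E j i <= A)%MS.
  by rewrite (sumsmx_sup (j, i)) //= ?bij // genmxE.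
have : s' *m E i j *m D = 0.
  by rewrite -mulmxA adjE // mulmxA eE trmx_mul mulmxA s'A mul0mx.
move=> /rowP h; apply/rowP => k; have := h k; rewrite mul_mx_gram !mxE => /eqP.
by rewrite mulf_eq0 (gt_eqF (d_gt0 k)) orbF => /eqP.
Qed.

Lemma reynolds_uniq (y : 'I_r * 'I_r -> 'rV[rat]_n) :
  let s := \sum_(p | b p.1 == b p.2) y p *m E p.1 p.2 in
  (forall i j, b i = b j -> s *m E i j = 0) -> s = 0.
Proof.
move=> s sE; apply: (gram_eq0 d_gt0); rewrite {1}/s !mulmx_suml big1 // => p /eqP bp.
by rewrite -(mulmxA (y p)) adjE // mulmxA -mulmxA -trmx_mul sE ?trmx0 ?mulmx0.
Qed.

End Reynolds.

Section DirectSum.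
Variables (r : nat) (b : 'I_r -> nat) (n1 n2 : nat).
Variables (E1 : 'I_r -> 'I_r -> 'M[rat]_n1) (E2 : 'I_r -> 'I_r -> 'M[rat]_n2).
Variables (wt1 : 'I_n1 -> 'X_{1..r}) (wt2 : 'I_n2 -> 'X_{1..r}).
Variables (d1 : 'I_n1 -> rat) (d2 : 'I_n2 -> rat).

Definition gsumE i j := block_mx (E1 i j) 0 0 (E2 i j).
Definition gsumw k := match split k with inl i => wt1 i | inr i => wt2 i end.
Definition gsumd k := match split k with inl i => d1 i | inr i => d2 i end.

Lemma gsumw_l k : gsumw (lshift n2 k) = wt1 k.
Proof. by rewrite /gsumw (unsplitK (inl k)). Qed.

Lemma gsumw_r k : gsumw (rshift n1 k) = wt2 k.
Proof. by rewrite /gsumw (unsplitK (inr k)). Qed.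

Lemma gsumd_l k : gsumd (lshift n2 k) = d1 k.
Proof. by rewrite /gsumd (unsplitK (inl k)). Qed.

Lemma gsumd_r k : gsumd (rshift n1 k) = d2 k.
Proof. by rewrite /gsumd (unsplitK (inr k)). Qed.

Lemma gmod_sum : gmod b E1 wt1 d1 -> gmod b E2 wt2 d2 -> gmod b gsumE gsumw gsumd.
Proof.
move=> M1 M2; split.
- move=> i j k l bij bkl; rewrite /gsumE !mulmx_block !mulmx0 !mul0mx !addr0 !add0r.
  rewrite !scale_block_mx !opp_block_mx !add_block_mx !scaler0 !subr0.
  by rewrite (gmod_comm M1) // (gmod_comm M2).
- move=> i k l; rewrite /gsumE; case: (split_ordP k) => k' ->; case: (split_ordP l) => l' ->.
  + by rewrite block_mxEul (gmod_diag M1) eq_lshift gsumw_l.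
  + by rewrite block_mxEur mxE eq_lrshift.
  + by rewrite block_mxEdl mxE eq_rlshift.
  + by rewrite block_mxEdr (gmod_diag M2) eq_rshift gsumw_r.
- move=> i j k l bij; rewrite /gsumE.
  case: (split_ordP k) => k' ->; case: (split_ordP l) => l' ->.
  + by rewrite !block_mxEul !gsumd_l (gmod_adj M1).
  + by rewrite block_mxEur block_mxEdl !mxE mul0r mulr0.
  + by rewrite block_mxEur block_mxEdl !mxE mul0r mulr0.
  + by rewrite !block_mxEdr !gsumd_r (gmod_adj M2).
- by move=> k; rewrite /gsumd; case: split => i; [exact: (gmod_gt0 M1)|exact: (gmod_gt0 M2)].
Qed.

Lemma hwv_sum w u1 u2 : hwv b E1 wt1 w u1 -> hwv b E2 wt2 w u2 ->
  hwv b gsumE gsumw w (row_mx u1 u2).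
Proof.
move=> [w1 h1] [w2 h2]; split.
  move=> k; rewrite mxE /gsumw; case: split => i; [exact: w1|exact: w2].
move=> i j ij bij; rewrite /gsumE mul_row_block !mulmx0 addr0 add0r.
by rewrite h1 // h2 // row_mx0.
Qed.

End DirectSum.

(** * The submodule generated by a highest weight vector *)

Section LowerSpan.
Variables (r : nat) (b : 'I_r -> nat).
Variables (n : nat) (E : 'I_r -> 'I_r -> 'M[rat]_n).
Variables (wt : 'I_n -> 'X_{1..r}) (d : 'I_n -> rat).
Hypothesis M : gmod b E wt d.
Variables (nu : 'X_{1..r}) (h : 'rV[rat]_n).
Hypothesis h_hw : hwv b E wt nu h.

Inductive lspan : 'rV[rat]_n -> Prop :=
| lspan_gen : lspan h
| lspan_lin c u v : lspan u -> lspan v -> lspan (c *: u + v)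
| lspan_low (i j : 'I_r) u : (j < i)%N -> b i = b j -> lspan u -> lspan (u *m E i j).

Lemma lspan0 : lspan 0.
Proof. by rewrite -[0](addNr h) -scaleN1r; apply: lspan_lin; apply: lspan_gen. Qed.

Lemma lspanZ c u : lspan u -> lspan (c *: u).
Proof. by move=> hu; rewrite -[_ *: _]addr0; apply: lspan_lin => //; apply: lspan0. Qed.

(** Raising and diagonal operators are commuted past the lowering operators until they reach [h]. *)
Lemma lspan_stable u i j : lspan u -> b i = b j -> lspan (u *m E i j).
Proof.
move=> hu; elim: hu i j => [|c u1 u2 _ IH1 _ IH2|k l u1 lk bkl hu1 IH] i j bij.
- case: (ltngtP i j) => ij.
  + by case: h_hw => _ ->//; apply: lspan0.
  + by apply: lspan_low => //; apply: lspan_gen.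
  + move/val_inj: ij => ->; case: h_hw => /(iswP M) -> _.
    by apply/lspanZ/lspan_gen.
- by rewrite mulmxDl -scalemxAl; apply: lspan_lin; [apply: IH1|apply: IH2].
- have -> : u1 *m E k l *m E i j = u1 *m E i j *m E k l +
      ((j == k)%:R *: (u1 *m E i l) - (l == i)%:R *: (u1 *m E k j)).
    rewrite -!mulmxA !scalemxAr -mulmxBr -(gmod_comm M bij bkl) mulmxBr.
    by rewrite addrC subrK.
  rewrite -[X in X + _]scale1r; apply: lspan_lin; first by apply: lspan_low => //; apply: IH.
  have H1 : lspan ((j == k)%:R *: (u1 *m E i l)).
    case: eqP => [jk|_]; last by rewrite scale0r; apply: lspan0.
    by apply/lspanZ/IH; rewrite bij jk.
  have H2 : lspan ((l == i)%:R *: (u1 *m E k j)).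
    case: eqP => [li|_]; last by rewrite scale0r; apply: lspan0.
    by apply/lspanZ/IH; rewrite bkl li.
  by rewrite addrC -scaleN1r; apply: lspan_lin.
Qed.

Lemma lspan_top u : lspan u ->
  exists c u', u = c *: h + u' /\ forall k, u' 0 k != 0 -> prec b (wt k) nu.
Proof.
elim=> [|c u1 u2 _ [c1 [v1 [-> p1]]] _ [c2 [v2 [-> p2]]]|i j v ji bij _ [c [v' [-> pv]]]].
- by exists 1, 0; rewrite scale1r addr0; split=> // k; rewrite mxE eqxx.
- exists (c * c1 + c2), (c *: v1 + v2); split.
    by rewrite scalerDr scalerDl scalerA !addrA; congr (_ + _); rewrite addrAC.
  move=> k; rewrite !mxE; have [->|/p1//] := eqVneq (v1 0 k) 0.
  by rewrite mulr0 add0r => /p2.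
- exists 0, ((c *: h + v') *m E i j); rewrite scale0r add0r; split=> // l.
  rewrite mxE => s0.
  have [k] : exists k, (c *: h + v') 0 k * E i j k l != 0.
    apply/existsP; apply: contraNT s0; rewrite negb_exists => /forallP s0.
    by rewrite big1 // => k _; apply/eqP; rewrite -[_ == _]negbK.
  rewrite mulf_eq0 negb_or => /andP[cv /(gmod_shift M bij) e].
  have pk : prec b (wt l) (wt k) by apply: prec_shift ji (esym bij) (esym e).
  move: cv; rewrite !mxE; have [v0|/pv] := eqVneq (v' 0 k) 0; last first.
    by move=> p2 _; apply: prec_trans p2.
  rewrite v0 addr0 mulf_eq0 negb_or => /andP[_ hk].
  by case: h_hw => /(_ k hk) <-.
Qed.

Lemma lspan_casimir u : lspan u -> u *m casimir b E = cas b nu *: u.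
Proof.
elim=> [|c u1 u2 _ e1 _ e2|i j v ji bij _ e]; first exact: (casimir_hwv M h_hw).
  by rewrite mulmxDl -scalemxAl e1 e2 scalerDr !scalerA mulrC.
by rewrite -mulmxA (casimir_comm M bij) mulmxA e scalemxAl.
Qed.

(** The Casimir operator acts on the whole span by [cas b nu], while every weight of the span other
    than [nu] lies strictly below [nu]; by [cas_lt] no highest weight vector can sit there. In
    weight [nu] only multiples of [h] remain. *)
Lemma lspan_hwv w u : lspan u -> u != 0 -> hwv b E wt w u -> exists c, u = c *: h.
Proof.
move=> hu u0 uw; have [c [u' [uE pu]]] := lspan_top hu.
have h0 : h != 0.
  apply: contra_neq u0 => h0; elim: hu => // [a u1 u2 _ -> _ ->|i j v _ _ _ ->].
    by rewrite scaler0 addr0.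
  by rewrite mul0mx.
have casw : cas b w = cas b nu.
  apply/eqP; rewrite -subr_eq0; have /eqP := lspan_casimir hu.
  rewrite (casimir_hwv M uw) -subr_eq0 -scalerBl scaler_eq0 (negPf u0) orbF //.
have npw : ~ prec b w nu.
  move=> p; have := cas_lt (hwv_dominant M u0 uw) (hwv_dominant M h0 h_hw) p.
  by rewrite casw ltxx.
exists c; rewrite uE; suff -> : u' = 0 by rewrite addr0.
have [wnu|wnu] := eqVneq w nu.
  apply/rowP => k; rewrite [RHS]mxE; apply/eqP; apply: contraT => u'k.
  have pk := pu k u'k.
  have hk : h 0 k = 0.
    apply/eqP; apply: contraT; case: h_hw => wh _ /wh wk.
    by move: pk; rewrite wk => /precxx.
  have : u 0 k != 0 by rewrite uE !mxE hk mulr0 add0r.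
  by case: uw => wu _ /wu wk; move: pk; rewrite wk wnu => /precxx.
have /rV0Pn [k uk] := u0; have wk : wt k = w by case: uw => wu _; apply: wu.
have hk : h 0 k = 0.
  apply/eqP; apply: contraT; case: h_hw => wh _ /wh; rewrite wk => e.
  by rewrite e eqxx in wnu.
have u'k : u' 0 k != 0 by move: uk; rewrite uE !mxE hk mulr0 add0r.
by case: npw; rewrite -wk; apply: pu.
Qed.

(** Subtracting from some [E i i] its eigenvalue at coordinate [k] kills this coordinate but not a
    coordinate [l] of different weight, so the support shrinks until a single weight remains. *)
Lemma wt_extract (S : 'rV[rat]_n -> Prop) v :
  (forall i u, S u -> S (u *m E i i)) -> (forall c u1 u2, S u1 -> S u2 -> S (c *: u1 + u2)) ->
  S v -> v != 0 -> exists w u, [/\ S u, u != 0 & isw wt w u].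
Proof.
move=> SE Slin; have [N] := ubnP #|[pred k | v 0 k != 0]|.
elim: N v => // N IH v hN Sv v0; have /rV0Pn [k vk] := v0.
have [[l [vl wl]]|nl] := classic (exists l, v 0 l != 0 /\ wt l <> wt k); last first.
  exists (wt k), v; split=> // l vl; apply/eqP; apply: contra_notT nl => /eqP wl.
  by exists l.
have [i wi] : exists i, wt l i <> wt k i.
  by apply: not_all_ex_not => e; apply: wl; apply/mnmP.
pose u := - (wt k i)%:R *: v + v *m E i i.
have uE p : u 0 p = ((wt p i)%:R - (wt k i)%:R) * v 0 p.
  by rewrite mxE (mul_gmod_diag M) mxE; ring.
apply: (IH u); [|by apply: Slin => //; apply: SE|]; last first.
  apply/rV0Pn; exists l; rewrite uE mulf_neq0 // subr_eq0 eqr_nat.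
  exact/eqP.
rewrite ltnS in hN; apply: leq_trans hN; apply: proper_card; apply/properP; split.
  by apply/subsetP => p; rewrite !inE uE mulf_eq0 negb_or => /andP[].
by exists k; rewrite !inE // uE subrr mul0r eqxx.
Qed.

End LowerSpan.

Section Intertwiner.
Variables (r : nat) (b : 'I_r -> nat) (n1 n2 : nat).
Variables (E1 : 'I_r -> 'I_r -> 'M[rat]_n1) (E2 : 'I_r -> 'I_r -> 'M[rat]_n2).
Variables (wt1 : 'I_n1 -> 'X_{1..r}) (wt2 : 'I_n2 -> 'X_{1..r}).
Variables (d1 : 'I_n1 -> rat) (d2 : 'I_n2 -> rat).
Hypothesis (M1 : gmod b E1 wt1 d1) (M2 : gmod b E2 wt2 d2).
Variables (nu : 'X_{1..r}) (m : 'rV[rat]_n1) (u : 'rV[rat]_n2).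
Hypothesis (m_hw : hwv b E1 wt1 nu m) (u_hw : hwv b E2 wt2 nu u) (u_neq0 : u != 0).

Local Notation E := (gsumE E2 E1).
Local Notation wt := (gsumw wt2 wt1).
Let M := gmod_sum M2 M1.
Let h_hw := hwv_sum u_hw m_hw.
Local Notation H := (lspan b E (row_mx u m)).

(** The vectors of the span with zero left part form a submodule. If nonzero, it contains a highest
    weight vector, hence a nonzero multiple of [(u, m)], whose left part is not zero. *)
Lemma lspan_graph v : H v -> lsubmx v = 0 -> v = 0.
Proof.
move=> Hv v0; apply/eqP; apply: contraT => vn0; exfalso.
pose S x := H x /\ lsubmx x = 0.
have SE i j x : b i = b j -> S x -> S (x *m E i j).
  move=> bij [Hx x0]; split; first exact: (lspan_stable M h_hw).
  rewrite -[x]hsubmxK x0 /gsumE mul_row_block !mul0mx !mulmx0 addr0.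
  by rewrite row_mxKl.
have Slin c x y : S x -> S y -> S (c *: x + y).
  move=> [Hx x0] [Hy y0]; split; first exact: lspan_lin.
  by rewrite linearD linearZ /= x0 y0 scaler0 addr0.
have [|w [x [Sx xn0 xw]]] := wt_extract M _ Slin (conj Hv v0 : S v) vn0.
  by move=> i x; apply: SE.
have [|w' [y [yn0 yhw [Hy y0] _]]] := @hw_exists _ _ _ _ _ _ M S w x _ xw xn0 Sx.
  by move=> i j z _; apply: SE.
have [c yc] := lspan_hwv M h_hw Hy yn0 yhw.
move: y0; rewrite yc linearZ /= row_mxKl => /eqP; rewrite scaler_eq0 (negPf u_neq0) orbF.
by move=> /eqP c0; move: yn0; rewrite yc c0 scale0r eqxx.
Qed.

(* The lower span of (u, m) is the graph of a morphism of modules sending u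
   to m; it is extended by zero to the orthogonal of its domain. *)
Lemma intertwiner : exists T : 'M[rat]_(n2, n1),
  (forall i j, b i = b j -> E2 i j *m T = T *m E1 i j) /\
  forall phi : 'cV_n2,
    (forall i j : 'I_r, (j < i)%N -> b i = b j -> E2 i j *m phi = 0) ->
    forall e : 'rV_n2, e *m gram d2 = phi^T ->
    e *m T = ((u *m phi) 0 0 / (u *m gram d2 *m u^T) 0 0) *: m.
Proof.
have d2_gt0 := gmod_gt0 M2.
have [A AH] := subspace_mx (lspan0 _ _ _) (@lspan_lin _ b _ E (row_mx u m)).
pose B := row_base A; have BH v : H v <-> (v <= B)%MS by rewrite AH eq_row_base.
pose U := lsubmx B; pose R := rsubmx B; have BE : B = row_mx U R by rewrite hsubmxK.
have Ufree : row_free U.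
  rewrite -kermx_eq0 -submx0; apply/rV_subP => a /sub_kermxP aU.
  have : a *m B = 0.
    apply: lspan_graph; first by apply/BH; rewrite submxMl.
    by rewrite BE mul_mx_row row_mxKl.
  by rewrite -[0](mul0mx _ B) => /(row_free_inj (row_base_free A)) ->; rewrite sub0mx.
pose G := U *m gram d2 *m U^T; have Gu : G \in unitmx by apply: gram_unit.
have [a [aU aR]] : exists a, u = a *m U /\ m = a *m R.
  have /BH/submxP [a] := lspan_gen b E (row_mx u m).
  by rewrite BE mul_mx_row => /eq_row_mx [-> ->]; exists a.
(* The rows of [B = (U, R)] form a basis of the graph. This matrix takes the coordinates of the
   orthogonal projection onto the row space of [U] and reads the image off [R]. *)
exists (gram d2 *m U^T *m invmx G *m R); split.
  move=> i j bij.
  have stab i' j' : b i' = b j' -> exists C, U *m E2 i' j' = C *m U /\ R *m E1 i' j' = C *m R.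
    move=> bij'; have /submxP [C] : (B *m E i' j' <= B)%MS.
      apply/row_subP => k; rewrite row_mul; apply/BH; apply: (lspan_stable M h_hw) => //.
      by apply/BH; rewrite row_sub.
    rewrite BE /gsumE mul_row_block !mulmx0 addr0 add0r mul_mx_row => /eq_row_mx [e1 e2].
    by exists C.
  have [C [C1 C2]] := stab i j bij; have [C' [C'1 _]] := stab j i (esym bij).
  have GC : G *m C'^T = C *m G.
    rewrite /G -mulmxA -trmx_mul -C'1 trmx_mul !mulmxA -(mulmxA U) -(gmod_adjE M2) //.
    by rewrite mulmxA C1.
  rewrite -!mulmxA C2 !mulmxA (gmod_adjE M2) // -(mulmxA (gram d2)) -trmx_mul C'1 trmx_mul.
  have eG : C'^T *m invmx G = invmx G *m C.
    by rewrite -[LHS]mul1mx -(mulVmx Gu) -mulmxA (mulmxA G) GC -mulmxA mulmxV // mulmx1.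
  by rewrite !mulmxA -(mulmxA _ C'^T) eG !mulmxA.
move=> phi phiE e eD.
(* [phi] and the pairing with [u] both vanish on images of lowering operators, so on the lower span
   each is determined by its value at the generator, and the two are proportional. *)
have key v : H v -> (lsubmx v *m phi) 0 0 * (u *m gram d2 *m u^T) 0 0 =
    (u *m phi) 0 0 * (lsubmx v *m gram d2 *m u^T) 0 0.
  elim=> [|c v1 v2 _ e1 _ e2|i j v1 ji bij _ _]; first by rewrite row_mxKl.
    have lin (x y : 'rV[rat]_n2) (z : 'cV_n2) :
        ((c *: x + y) *m z) 0 0 = c * (x *m z) 0 0 + (y *m z) 0 0.
      by rewrite mulmxDl -scalemxAl !mxE.
    move: e1 e2; rewrite linearD linearZ /= -!(mulmxA _ (gram d2)) !lin => e1 e2.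
    by rewrite mulrDl -mulrA e1 e2; ring.
  have -> : lsubmx (v1 *m E i j) = lsubmx v1 *m E2 i j.
    by rewrite -[v1]hsubmxK /gsumE mul_row_block !mulmx0 addr0 !row_mxKl.
  rewrite -(mulmxA (lsubmx v1)) phiE // mulmx0 -(mulmxA (lsubmx v1)) (gmod_adjE M2) //.
  rewrite mulmxA -(mulmxA _ (E2 j i)^T) -trmx_mul; case: u_hw => _ -> //.
  by rewrite trmx0 mulmx0 !mxE mul0r mulr0.
pose k := (u *m phi) 0 0 / (u *m gram d2 *m u^T) 0 0.
have uu0 : (u *m gram d2 *m u^T) 0 0 != 0 by rewrite gt_eqF // gram_neq0.
have Uphi : U *m phi = k *: (U *m gram d2 *m u^T).
  apply/colP => s; rewrite [RHS]mxE.
  have Hs : H (row s B) by apply/BH; rewrite row_sub.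
  have rowU : lsubmx (row s B) = row s U by apply/rowP => l; rewrite !mxE.
  have := key _ Hs; rewrite rowU.
  have -> : (row s U *m phi) 0 0 = (U *m phi) s 0 by rewrite -row_mul mxE.
  have -> : (row s U *m gram d2 *m u^T) 0 0 = (U *m gram d2 *m u^T) s 0.
    by rewrite -!row_mul mxE.
  by move=> e1; apply: (mulIf uu0); rewrite e1 /k mulrAC divfK.
rewrite -/k !mulmxA eD -trmx_mul Uphi.
have -> : (k *: (U *m gram d2 *m u^T))^T = k *: (a *m G).
  rewrite linearZ /= !trmx_mul trmxK /gram tr_diag_mx -/(gram d2) aU /G !mulmxA.
  by [].
by rewrite -!scalemxAl mulmxK // -aR.
Qed.

End Intertwiner.

(** * Polynomial functions on a module *)

Lemma mpoly_alg_ind (R : comNzRingType) n (P : {mpoly R[n]} -> Prop) :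
  (forall c, P c%:MP) -> (forall i, P 'X_i) ->
  (forall p q, P p -> P q -> P (p + q)) -> (forall p q, P p -> P q -> P (p * q)) ->
  forall p, P p.
Proof.
move=> PC PX PD PM p; have P1 : P 1 by rewrite -mpolyC1.
have P0 : P 0 by rewrite -mpolyC0.
rewrite (mpolyE p); apply: (big_ind P P0 PD) => m _.
rewrite -mul_mpolyC; apply: (PM) => //; rewrite mpolyXE_id; apply: (big_ind P P1 PM) => i _.
by elim: (m i) => [|k IH]; rewrite ?expr0 // exprS; apply: PM.
Qed.

(* The derivation extending the linear map x_k |-> \sum_l A k l x_l. *)
HB.lock Definition der n (A : 'M[rat]_n) (p : {mpoly rat[n]}) : {mpoly rat[n]} :=
  \sum_k \sum_l A k l *: ('X_l * p^`M(k)).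

Section Derivation.
Variable n : nat.
Implicit Types (A B : 'M[rat]_n) (p q : {mpoly rat[n]}).

Let derE A p : der A p = \sum_k \sum_l A k l *: ('X_l * p^`M(k)).
Proof. by rewrite der.unlock. Qed.

Lemma derD A p q : der A (p + q) = der A p + der A q.
Proof.
rewrite !derE -big_split; apply: eq_bigr => k _; rewrite -big_split; apply: eq_bigr => l _ /=.
by rewrite mderivD mulrDr scalerDr.
Qed.

Lemma derZ A c p : der A (c *: p) = c *: der A p.
Proof.
rewrite !derE scaler_sumr; apply: eq_bigr => k _; rewrite scaler_sumr; apply: eq_bigr => l _.
by rewrite mderivZ -scalerAr !scalerA mulrC.
Qed.

Lemma derM A p q : der A (p * q) = der A p * q + p * der A q.
Proof.
rewrite !derE mulr_suml mulr_sumr -big_split; apply: eq_bigr => k _.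
rewrite mulr_suml mulr_sumr -big_split; apply: eq_bigr => l _ /=.
by rewrite mderivM -!mul_mpolyC; ring.
Qed.

Lemma derC A c : der A c%:MP = 0.
Proof. by rewrite derE big1 // => k _; rewrite big1 // => l _; rewrite mderivC mulr0 scaler0. Qed.

Lemma der0 A : der A 0 = 0. Proof. by rewrite -mpolyC0 derC. Qed.
Lemma der1 A : der A 1 = 0. Proof. by rewrite -mpolyC1 derC. Qed.

Lemma derN A p : der A (- p) = - der A p.
Proof. by rewrite -scaleN1r derZ scaleN1r. Qed.

Lemma derB A p q : der A (p - q) = der A p - der A q.
Proof. by rewrite derD derN. Qed.

Lemma der_sum A (I : Type) (s : seq I) P (f : I -> {mpoly rat[n]}) :
  der A (\sum_(x <- s | P x) f x) = \sum_(x <- s | P x) der A (f x).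
Proof. exact: (big_morph _ (derD A) (der0 A)). Qed.

Lemma der_var A k : der A 'X_k = \sum_l A k l *: 'X_l.
Proof.
rewrite derE (bigD1 k) //= [X in _ + X]big1 ?addr0 => [|i /negPf ik].
  have UU : (U_(k) - U_(k))%MM = 0%MM by apply/mnmP => j; rewrite mnmBE mnm0E subnn.
  by apply: eq_bigr => l _; rewrite mderivX mnm1E eqxx scale1r UU mpolyX0 mulr1.
by rewrite big1 // => l _; rewrite mderivX mnm1E eq_sym ik scale0r mulr0 scaler0.
Qed.

Lemma derZl c A p : der (c *: A) p = c *: der A p.
Proof.
rewrite !derE scaler_sumr; apply: eq_bigr => k _; rewrite scaler_sumr; apply: eq_bigr => l _.
by rewrite mxE scalerA.
Qed.

Lemma derBl A B p : der (A - B) p = der A p - der B p.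
Proof.
rewrite !derE -sumrB; apply: eq_bigr => k _; rewrite -sumrB; apply: eq_bigr => l _.
by rewrite !mxE scalerBl.
Qed.

Lemma der_mon A m : der A 'X_[m] =
  \sum_k \sum_l (A k l * (m k)%:R) *: 'X_[U_(l) + (m - U_(k))].
Proof.
rewrite derE; apply: eq_bigr => k _; apply: eq_bigr => l _.
by rewrite mderivX -scalerAr scalerA mpolyXD.
Qed.

(** The products are reversed because matrices act on row vectors from the right. *)
Lemma der_bracket A B p : der A (der B p) - der B (der A p) = der (B *m A - A *m B) p.
Proof.
apply/eqP; rewrite -subr_eq0; apply/eqP; elim/mpoly_alg_ind: p => [c|k|p q Ep Eq|p q Ep Eq].
- by rewrite !derC ?der0 ?subr0.
- have var2 A' B' : der A' (der B' 'X_k) = der (B' *m A') 'X_k.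
    rewrite der_var der_sum; under eq_bigr do rewrite derZ der_var scaler_sumr.
    rewrite exchange_big der_var; apply: eq_bigr => l _ /=.
    by rewrite mxE scaler_suml; apply: eq_bigr => m _; rewrite scalerA.
  by rewrite !var2 derBl subrr.
- have -> : der A (der B (p + q)) - der B (der A (p + q)) - der (B *m A - A *m B) (p + q) =
     (der A (der B p) - der B (der A p) - der (B *m A - A *m B) p) +
     (der A (der B q) - der B (der A q) - der (B *m A - A *m B) q).
    by rewrite !derD; ring.
  by rewrite Ep Eq addr0.
- have -> : der A (der B (p * q)) - der B (der A (p * q)) - der (B *m A - A *m B) (p * q) =
     (der A (der B p) - der B (der A p) - der (B *m A - A *m B) p) * q +
     p * (der A (der B q) - der B (der A q) - der (B *m A - A *m B) q).
    by rewrite !derM !derD !derM; ring.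
  by rewrite Ep Eq mul0r mulr0 addr0.
Qed.

Lemma msize_der A p K : (msize p <= K)%N -> (msize (der A p) <= K)%N.
Proof.
move=> pK; rewrite {1}(mpolyE p) der_sum.
apply: leq_trans (msize_sum _ _ _) _; apply/bigmax_leqP_seq => m mp _.
rewrite derZ; apply: leq_trans (msizeZ_le _ _) _; rewrite der_mon.
apply: leq_trans (msize_sum _ _ _) _; apply/bigmax_leqP_seq => k _ _.
apply: leq_trans (msize_sum _ _ _) _; apply/bigmax_leqP_seq => l _ _.
have [mk|mk] := eqVneq (m k) 0%N; first by rewrite mk mulr0 scale0r msize0.
apply: leq_trans (msizeZ_le _ _) _; rewrite msizeX addmC mdegD mdeg1.
have <- : mdeg m = (mdeg (m - U_(k)) + 1)%N.
  by rewrite -[in LHS](@submK _ U_(k) m) ?mdegD ?mdeg1 // lep1mP.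
exact: leq_trans (msize_mdeg_lt mp) pK.
Qed.

End Derivation.

Section PolyVec.
Variables (D K : nat).

Local Notation T := 'X_{1..D < K.+1}.

Definition bm (s : 'I_#|{: T}|) : 'X_{1..D} := bmnm (enum_val s).

Definition vec (p : {mpoly rat[D]}) : 'rV[rat]_#|{: T}| := \row_t p@_(bm t).

Definition pol (v : 'rV[rat]_#|{: T}|) : {mpoly rat[D]} := \sum_t v 0 t *: 'X_[bm t].

Lemma bm_inj : injective bm.
Proof. by move=> s t /val_inj/enum_val_inj. Qed.

Lemma bm_deg s : (mdeg (bm s) <= K)%N.
Proof. by rewrite -ltnS /bm bmdeg. Qed.

Lemma bm_ex m : (mdeg m <= K)%N -> exists s, bm s = m.
Proof.
move=> mK; have mK' : (mdeg m < K.+1)%N by [].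
by exists (enum_rank (BMultinom mK')); rewrite /bm enum_rankK.
Qed.

Lemma vecD p q : vec (p + q) = vec p + vec q.
Proof. by apply/rowP => t; rewrite !mxE mcoeffD. Qed.

Lemma vecB p q : vec (p - q) = vec p - vec q.
Proof. by apply/rowP => t; rewrite !mxE mcoeffB. Qed.

Lemma vecZ c p : vec (c *: p) = c *: vec p.
Proof. by apply/rowP => t; rewrite !mxE mcoeffZ. Qed.

Lemma vec_sum (I : Type) (s : seq I) P (f : I -> {mpoly rat[D]}) :
  vec (\sum_(x <- s | P x) f x) = \sum_(x <- s | P x) vec (f x).
Proof.
apply: (big_morph _ vecD); by apply/rowP => t; rewrite !mxE mcoeff0.
Qed.

Lemma vec_mon s : vec 'X_[bm s] = delta_mx 0 s.
Proof. by apply/rowP => t; rewrite !mxE mcoeffX (inj_eq bm_inj) eqxx eq_sym. Qed.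

Lemma polK v : vec (pol v) = v.
Proof.
rewrite /pol vec_sum [RHS]row_sum_delta; apply: eq_bigr => s _.
by rewrite vecZ vec_mon.
Qed.

Lemma polD u v : pol (u + v) = pol u + pol v.
Proof. by rewrite -big_split; apply: eq_bigr => s _; rewrite mxE scalerDl. Qed.

Lemma polZ c v : pol (c *: v) = c *: pol v.
Proof. by rewrite scaler_sumr; apply: eq_bigr => s _; rewrite mxE scalerA. Qed.

Lemma vecK p : (msize p <= K.+1)%N -> pol (vec p) = p.
Proof.
move=> pK; apply/mpolyP => m; rewrite /pol raddf_sum /=.
have [mK|mK] := leqP (mdeg m) K.
  have [s <-] := bm_ex mK; rewrite (bigD1 s) //= mxE mcoeffZ mcoeffX eqxx mulr1.
  rewrite big1 ?addr0 // => t ts; rewrite mcoeffZ mcoeffX (inj_eq bm_inj).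
  by rewrite (negPf ts) mulr0.
rewrite memN_msupp_eq0 ?msize_mdeg_ge ?(leq_trans pK) // big1 // => t _.
rewrite mcoeffZ mcoeffX; case: eqP => [e|_]; last by rewrite mulr0.
by have := bm_deg t; rewrite e leqNgt mK.
Qed.

Lemma msize_pol v : (msize (pol v) <= K.+1)%N.
Proof.
apply: leq_trans (msize_sum _ _ _) _; apply/bigmax_leqP_seq => s _ _.
by apply: leq_trans (msizeZ_le _ _) _; rewrite msizeX ltnS bm_deg.
Qed.

Definition dermx (A : 'M[rat]_D) : 'M[rat]_#|{: T}| :=
  \matrix_(s, t) (der A 'X_[bm s])@_(bm t).

Lemma vec_der A p : (msize p <= K.+1)%N -> vec (der A p) = vec p *m dermx A.
Proof.
move=> pK; rewrite -[p in LHS]vecK // /pol der_sum vec_sum.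
apply/rowP => t; rewrite summxE mxE; apply: eq_bigr => s _.
by rewrite derZ vecZ !mxE.
Qed.

Lemma pol_der A v : pol (v *m dermx A) = der A (pol v).
Proof. by rewrite -{1}[v]polK -vec_der ?msize_pol // vecK // msize_der // msize_pol. Qed.

End PolyVec.

Section PolyModule.
Variables (r : nat) (b : 'I_r -> nat) (D K : nat).
Variables (E : 'I_r -> 'I_r -> 'M[rat]_D).
Variables (wt : 'I_D -> 'X_{1..r}) (d : 'I_D -> rat).

Definition polE i j := dermx K (E i j).

Definition mwt (m : 'X_{1..D}) : 'X_{1..r} := (\sum_k wt k *+ m k)%MM.

Definition polw (s : 'I_#|{: 'X_{1..D < K.+1}}|) := mwt (bm s).

(** Squared length of the monomial [m] in the Fischer scalar product attached to [d]. The factorials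
    are what makes derivations of adjoint matrices adjoint to each other. *)
Definition fischer (m : 'X_{1..D}) : rat := \prod_k ((m k)`!%:R * d k ^+ m k).

Definition pold (s : 'I_#|{: 'X_{1..D < K.+1}}|) := fischer (bm s).

Lemma mwtD m m' : mwt (m + m') = (mwt m + mwt m')%MM.
Proof.
apply/mnmP => i; rewrite mnmDE /mwt !mnm_sumE -big_split; apply: eq_bigr => k _ /=.
by rewrite !mulmnE mnmDE mulnDr.
Qed.

Lemma mwtU k : mwt U_(k) = wt k.
Proof.
rewrite /mwt (bigD1 k) //= big1 ?addm0 => [|l /negPf lk]; rewrite mnm1E ?eqxx ?mulm1n //.
by rewrite eq_sym lk mulm0n.
Qed.

Lemma fischerU m l : fischer (m + U_(l)) = fischer m * (m l).+1%:R * d l.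
Proof.
rewrite /fischer (bigD1 l) //= [in RHS](bigD1 l) //= mnmDE mnm1E eqxx addn1.
rewrite factS natrM exprS [X in _ * X](_ : _ = \prod_(i < D | i != l) ((m i)`!%:R * d i ^+ m i)).
  by move: (\prod_(_ < D | _) _) (d l ^+ m l) => x y; ring.
by apply: eq_bigr => k /negPf kl; rewrite mnmDE mnm1E eq_sym kl addn0.
Qed.

Lemma mcoeff_der_mon n (A : 'M[rat]_n) s t : (der A 'X_[s])@_t =
  \sum_k \sum_l A k l * (s k)%:R * (U_(l) + (s - U_(k)) == t)%MM%:R.
Proof.
rewrite der_mon raddf_sum; apply: eq_bigr => k _ /=.
by rewrite raddf_sum; apply: eq_bigr => l _ /=; rewrite mcoeffZ mcoeffX.
Qed.

(** For given [k] and [l] only exponents of the form [s = m + U_(k)], [t = m + U_(l)] contribute,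
    and then both sides carry the factors [(m k).+1] and [(m l).+1]. *)
Lemma der_adj (A B : 'M[rat]_D) s t :
  (forall k l, A k l * d l = d k * B l k) ->
  (der A 'X_[s])@_t * fischer t = fischer s * (der B 'X_[t])@_s.
Proof.
move=> AB; rewrite !mcoeff_der_mon [in RHS]exchange_big /= mulr_suml mulr_sumr.
apply: eq_bigr => k _; rewrite mulr_suml mulr_sumr; apply: eq_bigr => l _.
have subU i (m m' : 'X_{1..D}) : m = (m' + U_(i))%MM -> (m - U_(i))%MM = m'.
  by move=> ->; rewrite addmK.
have exU i (m : 'X_{1..D}) : m i != 0%N -> exists m', m = (m' + U_(i))%MM.
  by move=> mi; exists (m - U_(i))%MM; rewrite submK // lep1mP.
have [sk|/exU [m sE]] := eqVneq (s k) 0%N.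
  rewrite sk mulr0 !mul0r; case: eqP => [e|_]; last by rewrite !mulr0.
  have /mnmP/(_ k) := e; rewrite mnmDE mnm1E eqxx sk => //.
rewrite (subU _ _ _ sE); have [tE|tE] := eqVneq (U_(l) + m)%MM t.
  rewrite addmC in tE; rewrite -tE sE addmK [(U_(k) + _)%MM]addmC eqxx !fischerU !mnmDE !mnm1E !eqxx !addn1 !mulr1.
  have -> : A k l * (m k).+1%:R * (fischer m * (m l).+1%:R * d l) =
    (A k l * d l) * (m k).+1%:R * (fischer m * (m l).+1%:R) by ring.
  by rewrite AB; ring.
rewrite mulr0 mul0r; have [tl|/exU [m' t'E]] := eqVneq (t l) 0%N.
  by rewrite tl mulr0 mul0r mulr0.
rewrite (subU _ _ _ t'E); case: eqP => [e|_]; last by rewrite !mulr0.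
have mm' : m' = m by apply: (@addmI _ U_(k)%MM); rewrite e sE addmC.
by rewrite t'E mm' addmC eqxx in tE.
Qed.

Lemma mwtE m i : mwt m i = (\sum_k wt k i * m k)%N.
Proof. by rewrite /mwt mnm_sumE; apply: eq_bigr => k _; rewrite mulmnE. Qed.

Lemma gmod_poly : gmod b E wt d -> gmod b polE polw pold.
Proof.
move=> M; have d_gt0 := gmod_gt0 M; split.
- move=> i j k l bij bkl; apply/row_matrixP => s; rewrite !rowE -!vec_mon.
  have sz : (msize ('X_[bm s] : {mpoly rat[D]}) <= K.+1)%N by rewrite msizeX ltnS bm_deg.
  rewrite mulmxBr !mulmxA -!vec_der ?msize_der // -vecB der_bracket.
  rewrite (gmod_comm M) // derBl !derZl mulmxBr -!scalemxAr -!vec_der //.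
  by rewrite vecB !vecZ.
- move=> i s t; rewrite mxE mcoeff_der_mon /polw mwtE natr_sum -sumrMnl.
  apply: eq_bigr => k _; rewrite (bigD1 k) //= big1 ?addr0 => [|l /negPf lk].
    rewrite (gmod_diag M) eqxx natrM; have [->|sk] := eqVneq (bm s k) 0%N.
      by rewrite !mulr0 !mul0r mul0rn.
    rewrite addmC submK ?lep1mP // (inj_eq (@bm_inj D K)).
    by case: eqP; rewrite ?mulr1 ?mulr1n ?mulr0 ?mulr0n.
  by rewrite (gmod_diag M) eq_sym lk !mul0r.
- move=> i j s t bij; rewrite !mxE; apply: der_adj => k l.
  exact: (gmod_adj M).
- move=> s; rewrite /pold /fischer prodr_gt0 // => k _.
  by rewrite mulr_gt0 ?ltr0n ?fact_gt0 // exprn_gt0.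
Qed.

Definition phw (w : 'X_{1..r}) (p : {mpoly rat[D]}) :=
  (forall m, m \in msupp p -> mwt m = w) /\
  forall i j : 'I_r, (i < j)%N -> b i = b j -> der (E i j) p = 0.

Lemma phw_vec w p : (msize p <= K.+1)%N -> phw w p <-> hwv b polE polw w (vec K p).
Proof.
move=> pK; split=> [[pw ph]|[vw vh]]; split.
- by move=> t; rewrite mxE -mcoeff_msupp => /pw.
- move=> i j ij bij; rewrite -vec_der // ph //.
  by apply/rowP => t; rewrite !mxE mcoeff0.
- move=> m mp; have [t tm] : exists t, @bm D K t = m.
    by apply: bm_ex; rewrite -ltnS; apply: leq_trans (msize_mdeg_lt mp) pK.
  by rewrite -tm; apply: vw; rewrite mxE tm -mcoeff_msupp.
- move=> i j ij bij; have := vh i j ij bij; rewrite -vec_der // => h.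
  rewrite -[LHS](@vecK D K) ?msize_der // h.
  by rewrite /pol big1 // => s _; rewrite mxE scale0r.
Qed.

End PolyModule.

Section PolyReynolds.
Variables (r : nat) (b : 'I_r -> nat) (n : nat).
Variables (E : 'I_r -> 'I_r -> 'M[rat]_n) (d : 'I_n -> rat).
Hypothesis d_gt0 : forall k, 0 < d k.
Hypothesis E_adj : forall i j k l, b i = b j -> E i j k l * d l = d k * E j i l k.

Definition pinv (p : {mpoly rat[n]}) := forall i j, b i = b j -> der (E i j) p = 0.

Lemma pold_gt0 K s : 0 < pold (K := K) d s.
Proof.
rewrite /pold /fischer prodr_gt0 // => k _.
by rewrite mulr_gt0 ?ltr0n ?fact_gt0 // exprn_gt0.
Qed.

Lemma polE_adj K i j k l : b i = b j ->
  polE K E i j k l * pold d l = pold d k * polE K E j i l k.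
Proof. by move=> bij; rewrite !mxE; apply: der_adj => s t; apply: E_adj. Qed.

Lemma pinv_vec K p : (msize p <= K.+1)%N ->
  pinv p <-> forall i j, b i = b j -> vec K p *m polE K E i j = 0.
Proof.
move=> pK; split=> h i j bij; have := h i j bij.
  by rewrite -vec_der // => ->; apply/rowP => t; rewrite !mxE mcoeff0.
rewrite -vec_der // => e; rewrite -[LHS](@vecK _ K) ?msize_der // e.
by rewrite /pol big1 // => s _; rewrite mxE scale0r.
Qed.

Lemma pol_sum K (I : Type) (s : seq I) P (f : I -> 'rV[rat]_#|{: 'X_{1..n < K.+1}}|) :
  pol (\sum_(x <- s | P x) f x) = \sum_(x <- s | P x) pol (f x).
Proof.
apply: (big_morph _ (@polD n K)); by rewrite /pol big1 // => s' _; rewrite mxE scale0r.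
Qed.

Lemma poly_reynolds_decomp (s : {mpoly rat[n]}) :
  exists s' (y : 'I_r * 'I_r -> {mpoly rat[n]}),
  s = s' + \sum_(p | b p.1 == b p.2) der (E p.1 p.2) (y p) /\ pinv s'.
Proof.
pose K := msize s; have sK : (msize s <= K.+1)%N by [].
have [v [y [sE vE]]] := reynolds_decomp (pold_gt0 (K := K)) (@polE_adj K) (vec K s).
exists (pol v), (fun p => pol (y p)); split.
  rewrite -[LHS](vecK sK) sE polD pol_sum; congr (_ + _).
  by apply: eq_bigr => p _; rewrite pol_der.
by apply/(pinv_vec (msize_pol v)) => i j bij; rewrite polK vE.
Qed.

Lemma poly_reynolds_uniq (y : 'I_r * 'I_r -> {mpoly rat[n]}) :
  let s := \sum_(p | b p.1 == b p.2) der (E p.1 p.2) (y p) in pinv s -> s = 0.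
Proof.
move=> s sinv; pose K := (\max_p msize (y p))%N.
have yK p : (msize (y p) <= K.+1)%N by apply: leqW; apply: (leq_bigmax p).
have sK : (msize s <= K.+1)%N.
  apply: leq_trans (msize_sum _ _ _) _; apply/bigmax_leqP_seq => p _ _.
  exact: msize_der.
have vs : vec K s = \sum_(p | b p.1 == b p.2) vec K (y p) *m polE K E p.1 p.2.
  by rewrite vec_sum; apply: eq_bigr => p _; rewrite -vec_der.
rewrite -[LHS](vecK sK) vs.
rewrite (reynolds_uniq (pold_gt0 (K := K)) (@polE_adj K) (y := fun p => vec K (y p))).
  by rewrite /pol big1 // => t _; rewrite mxE scale0r.
by rewrite -vs; apply/(pinv_vec sK).
Qed.

End PolyReynolds.

Lemma der_chain n m (phi : {rmorphism {mpoly rat[n]} -> {mpoly rat[m]}})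
    (A : 'M[rat]_n) (B : 'M[rat]_m) :
  (forall c, phi c%:MP = c%:MP) ->
  (forall k, der B (phi 'X_k) = phi (der A 'X_k)) ->
  forall p, der B (phi p) = phi (der A p).
Proof.
move=> phiC phiX; elim/mpoly_alg_ind => [c|k|p q Ep Eq|p q Ep Eq].
- by rewrite phiC !derC rmorph0.
- exact: phiX.
- by rewrite rmorphD !derD rmorphD Ep Eq.
- by rewrite rmorphM !derM rmorphD !rmorphM Ep Eq.
Qed.

Section WeightComponent.
Variables (r : nat) (b : 'I_r -> nat) (D : nat).
Variables (E : 'I_r -> 'I_r -> 'M[rat]_D).
Variables (wt : 'I_D -> 'X_{1..r}) (d : 'I_D -> rat).
Hypothesis M : gmod b E wt d.
Implicit Types p q : {mpoly rat[D]}.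

Definition wcomp (w : 'X_{1..r}) p : {mpoly rat[D]} :=
  \sum_(m <- msupp p | mwt wt m == w) p@_m *: 'X_[m].

Lemma mcoeff_wcomp w p m : (wcomp w p)@_m = if mwt wt m == w then p@_m else 0.
Proof.
rewrite /wcomp raddf_sum /=; have [mp|mp] := boolP (m \in msupp p); last first.
  rewrite (memN_msupp_eq0 mp) if_same big_seq_cond big1 // => k /andP[kp _].
  rewrite mcoeffZ mcoeffX; case: eqP => [km|_]; last by rewrite mulr0.
  by rewrite -km kp in mp.
rewrite big_mkcond (bigD1_seq m) //= mcoeffZ mcoeffX eqxx mulr1 big1 ?addr0 // => k /negPf km.
by rewrite mcoeffZ mcoeffX km mulr0 if_same.
Qed.

Lemma wcompD w p q : wcomp w (p + q) = wcomp w p + wcomp w q.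
Proof.
by apply/mpolyP => m; rewrite mcoeffD !mcoeff_wcomp mcoeffD; case: ifP; rewrite ?addr0.
Qed.

Lemma wcomp_sum w (I : Type) (s : seq I) P (f : I -> {mpoly rat[D]}) :
  wcomp w (\sum_(x <- s | P x) f x) = \sum_(x <- s | P x) wcomp w (f x).
Proof.
apply: (big_morph _ (wcompD w)).
by apply/mpolyP => m; rewrite mcoeff_wcomp mcoeff0 if_same.
Qed.

Lemma wcomp_id w p : (forall m, m \in msupp p -> mwt wt m = w) -> wcomp w p = p.
Proof.
move=> pw; apply/mpolyP => m; rewrite mcoeff_wcomp; case: eqP => // mw.
by rewrite memN_msupp_eq0 //; apply: contra_notN mw; apply: pw.
Qed.

Lemma wcompM w v p q : (forall m, m \in msupp q -> mwt wt m = v) ->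
  wcomp (w + v)%MM (p * q) = wcomp w p * q.
Proof.
move=> qv; rewrite {1}(mpolyE p) mulr_suml wcomp_sum {2}/wcomp mulr_suml [RHS]big_mkcond.
apply: eq_bigr => m mp; have Xq k : k \in msupp ('X_[m] * q) -> mwt wt k = (mwt wt m + v)%MM.
  by move=> /msuppM_le /allpairsP [[k1 k2] /= [/mem_msuppXP <- /qv <- ->]]; rewrite mwtD.
have cXq k : k \in msupp (p@_m *: 'X_[m] * q) -> mwt wt k = (mwt wt m + v)%MM.
  by rewrite -scalerAl => /msuppZ_le; apply: Xq.
case: eqP => [<-|mw]; first exact: wcomp_id.
apply/mpolyP => k; rewrite mcoeff_wcomp mcoeff0; case: eqP => // kw.
apply: memN_msupp_eq0; apply/negP => /cXq; rewrite kw => /addIm.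
by move=> e; apply: mw.
Qed.

Lemma wcompM0 w v p q : (forall m, m \in msupp q -> mwt wt m = v) ->
  (forall w', w <> (w' + v)%MM) -> wcomp w (p * q) = 0.
Proof.
move=> qv wv; apply/mpolyP => m; rewrite mcoeff_wcomp mcoeff0; case: eqP => // mw.
apply: memN_msupp_eq0; apply/negP => /msuppM_le /allpairsP [[k1 k2] /= [_ /qv kv e]].
by apply: (wv (mwt wt k1)); rewrite -mw e mwtD kv.
Qed.

Lemma der_mon_wt i j s t : b i = b j -> (der (E i j) 'X_[s])@_t != 0 ->
  (mwt wt t + U_(j) = mwt wt s + U_(i))%MM.
Proof.
move=> bij; rewrite mcoeff_der_mon => h.
have [k] : exists k, \sum_l E i j k l * (s k)%:R * (U_(l) + (s - U_(k)) == t)%MM%:R != 0.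
  apply/existsP; apply: contraNT h; rewrite negb_exists => /forallP h.
  by rewrite big1 // => k _; apply/eqP; rewrite -[_ == _]negbK.
move=> {}h; have [l] : exists l, E i j k l * (s k)%:R * (U_(l) + (s - U_(k)) == t)%MM%:R != 0.
  apply/existsP; apply: contraNT h; rewrite negb_exists => /forallP h.
  by rewrite big1 // => l _; apply/eqP; rewrite -[_ == _]negbK.
case: (_ =P t) => [<-|_]; last by rewrite mulr0 eqxx.
rewrite mulr1 mulf_eq0 negb_or pnatr_eq0 => /andP[/(gmod_shift M bij) e sk].
have sE : mwt wt s = (mwt wt (s - U_(k)) + wt k)%MM.
  by rewrite -[wt k](mwtU wt) -mwtD submK // lep1mP.
rewrite sE mwtD mwtU [(wt l + _)%MM]addmC -!addmA; congr (_ + _)%MM.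
exact: e.
Qed.

(** [E i j] shifts all weights by the same amount, so the images of different weight components
    share no monomial and vanish separately. *)
Lemma der_wcomp w p i j : b i = b j -> der (E i j) p = 0 -> der (E i j) (wcomp w p) = 0.
Proof.
move=> bij pE; apply/mpolyP => t; rewrite mcoeff0 /wcomp der_sum raddf_sum /=.
have [tw|tw] := eqVneq (mwt wt t + U_(j))%MM (w + U_(i))%MM; last first.
  rewrite big1 // => m /eqP mw; rewrite derZ mcoeffZ.
  case: (eqVneq (der (E i j) 'X_[m])@_t 0) => [->|/(der_mon_wt bij)]; first by rewrite mulr0.
  by rewrite mw => e; rewrite e eqxx in tw.
have := congr1 (mcoeff t) pE; rewrite {1}(mpolyE p) der_sum raddf_sum mcoeff0 /= => pE0.
apply: etrans pE0; rewrite [LHS]big_mkcond; apply: eq_bigr => m _; case: eqP => // mw.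
rewrite derZ mcoeffZ; case: (eqVneq (der (E i j) 'X_[m])@_t 0) => [->|/(der_mon_wt bij)].
  by rewrite mulr0.
by rewrite tw => /addIm e; case: mw.
Qed.

End WeightComponent.

(** * The algebra of highest weight polynomials *)

Section GradedAlgebra.
Variables (r : nat) (b : 'I_r -> nat) (D : nat).
Variables (E : 'I_r -> 'I_r -> 'M[rat]_D).
Variables (wt : 'I_D -> 'X_{1..r}) (d : 'I_D -> rat).
Hypothesis M : gmod b E wt d.
Variable degw : 'X_{1..r} -> nat.
Hypothesis degw_mdeg : forall m : 'X_{1..D}, degw (mwt wt m) = mdeg m.
Implicit Types p q f : {mpoly rat[D]}.

Local Notation A := (phw b E wt).

(** The weight determines the degree through [degw], so truncation at degree [degw w] loses nothing
    of weight [w]. *)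
Definition dimA (w : 'X_{1..r}) : nat := \rank (HW b (polE (degw w) E) w).

Lemma phw_size w p : A w p -> (msize p <= (degw w).+1)%N.
Proof.
move=> [pw _]; rewrite msizeE; apply/bigmax_leqP_seq => m mp _.
by rewrite ltnS -degw_mdeg pw.
Qed.

Lemma phwM w w' p q : A w p -> A w' q -> A (w + w')%MM (p * q).
Proof.
move=> [pw ph] [qw qh]; split=> [m /msuppM_le/allpairsP [[k1 k2] /= [/pw e1 /qw e2 ->]]|i j ij bij].
  by rewrite mwtD e1 e2.
by rewrite derM ph // qh // mul0r mulr0 addr0.
Qed.

Lemma phw1 : A 0%MM 1.
Proof.
split=> [m|i j _ _]; last exact: der1.
by rewrite -mpolyX0 => /mem_msuppXP <-; apply/mnmP => i; rewrite mwtE big1 ?mnm0E // => k _; rewrite mnm0E muln0.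
Qed.

Lemma phwX w p k : A w p -> A (w *+ k)%MM (p ^+ k).
Proof.
move=> pw; elim: k => [|k IH]; first by rewrite mulm0n expr0; apply: phw1.
by rewrite mulmS exprS; apply: phwM.
Qed.

Lemma HW_phw w v : (v <= HW b (polE (degw w) E) w)%MS <-> A w (pol v).
Proof.
rewrite (HWP (gmod_poly (degw w) M)) -[v in hwv _ _ _ _ v]polK.
by symmetry; apply: phw_vec; apply: msize_pol.
Qed.

Lemma phw_HW w p : A w p -> (vec (degw w) p <= HW b (polE (degw w) E) w)%MS.
Proof. by move=> pA; apply/HW_phw; rewrite vecK // phw_size. Qed.

Lemma dimA_le w w' (L : {mpoly rat[D]} -> {mpoly rat[D]}) :
  (forall p q, L (p + q) = L p + L q) -> (forall c p, L (c *: p) = c *: L p) ->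
  (forall p, A w p -> L p = 0 -> p = 0) -> (forall p, A w p -> A w' (L p)) ->
  (dimA w <= dimA w')%N.
Proof.
move=> LD LZ L0 LA; rewrite /dimA.
have L00 : L 0 = 0 by have := LZ 0 0; rewrite !scale0r.
set H := HW _ _ w; set H' := HW _ _ w'.
pose B := row_base H.
have BA i : A w (pol (row i B)).
  by apply/HW_phw; rewrite (submx_trans (row_sub i B)) // /B eq_row_base.
pose B' := \matrix_i vec (degw w') (L (pol (row i B))).
have B'H : (B' <= H')%MS.
  by apply/row_subP => i; rewrite rowK; apply/phw_HW/LA.
suff /eqP e : row_free B' by rewrite -[X in (X <= _)%N]e; apply: mxrankS.
rewrite -kermx_eq0 -submx0; apply/rV_subP => a /sub_kermxP aB'.
have aB : A w (pol (a *m B)).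
  by apply/HW_phw; rewrite (submx_trans (submxMl a B)) // /B eq_row_base.
have : L (pol (a *m B)) = 0.
  rewrite -[LHS](@vecK D (degw w')); last exact/phw_size/LA.
  suff -> : vec (degw w') (L (pol (a *m B))) = a *m B'.
    by rewrite aB' /pol big1 // => s _; rewrite mxE scale0r.
  rewrite !mulmx_sum_row pol_sum (big_morph L LD L00) vec_sum; apply: eq_bigr => i _.
  by rewrite rowK polZ LZ vecZ.
move=> /(L0 _ aB) /(congr1 (vec (degw w))); rewrite polK => aB0.
have : a *m B = 0 *m B by rewrite aB0 mul0mx; apply/rowP => s; rewrite !mxE mcoeff0.
by move=> /(row_free_inj (row_base_free H)) ->; rewrite sub0mx.
Qed.

Lemma dimA_mono w w' f : A w' f -> f != 0 -> (dimA w <= dimA (w + w')%MM)%N.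
Proof.
move=> fA f0; apply: (@dimA_le _ _ (fun p => p * f)) => [p q|c p|p _|p pA].
- by rewrite mulrDl.
- by rewrite scalerAl.
- by move=> /eqP; rewrite mulf_eq0 (negPf f0) orbF => /eqP.
- exact: phwM.
Qed.

Lemma dimA_eq0 w : (forall p, A w p -> p = 0) -> dimA w = 0%N.
Proof.
move=> h; apply/eqP; rewrite mxrank_eq0 -submx0; apply/rV_subP => v /HW_phw/h v0.
by rewrite -[v]polK v0 submx0; apply/eqP/rowP => s; rewrite !mxE mcoeff0.
Qed.

Lemma dimA_span w (l : seq {mpoly rat[D]}) :
  (forall p, A w p -> exists c : 'I_(size l) -> rat, p = \sum_i c i *: l`_i) ->
  (dimA w <= size l)%N.
Proof.
move=> h; pose B := \matrix_(i < size l) vec (degw w) l`_i.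
apply: leq_trans (rank_leq_row B); apply: mxrankS; apply/rV_subP => v /HW_phw/h [c cE].
apply/submxP; exists (\row_i c i); rewrite -[LHS]polK cE vec_sum mulmx_sum_row.
by apply: eq_bigr => i _; rewrite vecZ rowK mxE.
Qed.

Lemma dimA1P w f : A w f -> f != 0 -> dimA w = 1%N ->
  forall p, A w p -> exists c, p = c *: f.
Proof.
move=> fA f0 d1 p pA; have fs := phw_size fA.
have v0 : vec (degw w) f != 0.
  by apply: contra_neq f0 => v0; rewrite -(vecK fs) v0 /pol big1 // => s _; rewrite mxE scale0r.
have : (HW b (polE (degw w) E) w <= vec (degw w) f)%MS.
  by rewrite -mxrank_leqif_sup ?phw_HW // -/(dimA w) d1 rank_rV v0.
move=> /(submx_trans (phw_HW pA)) /submxP [c cE]; exists (c 0 0).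
rewrite -(vecK (phw_size pA)) cE -(vecK fs) -polZ polK; congr pol.
by rewrite [c]mx11_scalar mul_scalar_mx mxE.
Qed.

Lemma dimA_neq0 w : dimA w != 0%N -> exists2 f, A w f & f != 0.
Proof.
rewrite /dimA mxrank_eq0 => /rowV0Pn [v vH v0]; exists (pol v); first exact/HW_phw.
by apply: contra_neq v0 => p0; rewrite -[v]polK p0; apply/rowP => s; rewrite !mxE mcoeff0.
Qed.

End GradedAlgebra.

(** * Lifting highest weight polynomials to invariants *)

Section Lift.
Variables (r : nat) (b : 'I_r -> nat) (D : nat).
Variables (E : 'I_r -> 'I_r -> 'M[rat]_D).
Variables (wt : 'I_D -> 'X_{1..r}) (d : 'I_D -> rat).
Hypothesis M : gmod b E wt d.
Variable K1 : nat.

Local Notation n1 := #|{: 'X_{1..D < K1.+1}}|.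
Local Notation E1 := (polE K1 E).
Local Notation w1 := (polw (K := K1) wt).
Local Notation d1 := (pold (K := K1) d).
Let M1 : gmod b E1 w1 d1 := gmod_poly K1 M.

Variable g : 'rV[rat]_n1.
Hypothesis g_hw : forall i j : 'I_r, (i < j)%N -> b i = b j -> g *m E1 i j = 0.

(* The variables z_s stand for the basis of the module of polynomials of degree
   at most K1; they carry the action dual to E1, and are evaluated at a vector
   fixed by the raising operators. *)
Definition cz (s : 'I_n1) : rat := d1 s * g 0 s.

(** The dual action is minus the transpose; taken with respect to the form, the transpose of
    [E1 i j] is [E1 j i]. *)
Definition Etot i j : 'M[rat]_(D + n1) := block_mx (E i j) 0 0 (- E1 j i).

Lemma Etot_adj i j k l : b i = b j ->
  Etot i j k l * gsumd d d1 l = gsumd d d1 k * Etot j i l k.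
Proof.
move=> bij; rewrite /Etot; case: (split_ordP k) => k' ->; case: (split_ordP l) => l' ->.
- by rewrite !block_mxEul !gsumd_l (gmod_adj M).
- by rewrite block_mxEur block_mxEdl !mxE mul0r mulr0.
- by rewrite block_mxEur block_mxEdl !mxE mul0r mulr0.
- by rewrite !block_mxEdr !gsumd_r ![(- _ : 'M_n1) _ _]mxE mulNr mulrN (gmod_adj M1).
Qed.

Lemma gsumd_gt0 k : 0 < gsumd d d1 k.
Proof. by rewrite /gsumd; case: split => i; [exact: (gmod_gt0 M)|exact: (gmod_gt0 M1)]. Qed.

Definition ex : {mpoly rat[D]} -> {mpoly rat[D + n1]} :=
  mmap (@mpolyC _ rat) (fun k => 'X_(lshift n1 k)).
Definition ez : {mpoly rat[n1]} -> {mpoly rat[D + n1]} :=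
  mmap (@mpolyC _ rat) (fun k => 'X_(rshift D k)).
Definition evt : {mpoly rat[D + n1]} -> {mpoly rat[D]} :=
  mmap (@mpolyC _ rat) (fun k => match split k with inl i => 'X_i | inr s => (cz s)%:MP end).

HB.instance Definition _ := GRing.RMorphism.copy ex
  (mmap (@mpolyC _ rat) (fun k => 'X_(lshift n1 k))).
HB.instance Definition _ := GRing.RMorphism.copy ez
  (mmap (@mpolyC _ rat) (fun k => 'X_(rshift D k))).
HB.instance Definition _ := GRing.RMorphism.copy evt
  (mmap (@mpolyC _ rat) (fun k => match split k with inl i => 'X_i | inr s => (cz s)%:MP end)).

Lemma exC c : ex c%:MP = c%:MP. Proof. exact: mmapC. Qed.
Lemma ezC c : ez c%:MP = c%:MP. Proof. exact: mmapC. Qed.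
Lemma evtC c : evt c%:MP = c%:MP. Proof. exact: mmapC. Qed.
Lemma exX k : ex 'X_k = 'X_(lshift n1 k). Proof. by rewrite /ex mmapX mmap1U. Qed.
Lemma ezX k : ez 'X_k = 'X_(rshift D k). Proof. by rewrite /ez mmapX mmap1U. Qed.
Lemma exZ c p : ex (c *: p) = c *: ex p. Proof. by rewrite -!mul_mpolyC rmorphM /= exC. Qed.
Lemma ezZ c p : ez (c *: p) = c *: ez p. Proof. by rewrite -!mul_mpolyC rmorphM /= ezC. Qed.
Lemma evtZ c p : evt (c *: p) = c *: evt p. Proof. by rewrite -!mul_mpolyC rmorphM /= evtC. Qed.

Lemma evtXl k : evt 'X_(lshift n1 k) = 'X_k.
Proof. by rewrite /evt mmapX mmap1U (unsplitK (inl k)). Qed.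

Lemma evtXr s : evt 'X_(rshift D s) = (cz s)%:MP.
Proof. by rewrite /evt mmapX mmap1U (unsplitK (inr s)). Qed.

Lemma evt_ex p : evt (ex p) = p.
Proof.
elim/mpoly_alg_ind: p => [c|k|p q Ep Eq|p q Ep Eq].
- by rewrite exC evtC.
- by rewrite exX evtXl.
- by rewrite !rmorphD /= Ep Eq.
- by rewrite !rmorphM /= Ep Eq.
Qed.

Lemma evt_ez q : evt (ez q) = (q.@[cz])%:MP.
Proof.
elim/mpoly_alg_ind: q => [c|k|p q Ep Eq|p q Ep Eq].
- by rewrite ezC evtC mevalC.
- by rewrite ezX evtXr mevalXU.
- by rewrite !rmorphD /= Ep Eq ?mevalD ?mpolyCD.
- by rewrite !rmorphM /= Ep Eq ?mevalM ?mpolyCM.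
Qed.

Lemma der_ex i j p : der (Etot i j) (ex p) = ex (der (E i j) p).
Proof.
apply: (der_chain exC) => k /=; rewrite exX !der_var big_split_ord /= [X in _ + X]big1 ?addr0.
  by rewrite rmorph_sum /=; apply: eq_bigr => l _; rewrite /Etot block_mxEul exZ exX.
by move=> l _; rewrite /Etot block_mxEur mxE scale0r.
Qed.

Lemma der_ez i j q : der (Etot i j) (ez q) = ez (der (- E1 j i) q).
Proof.
apply: (der_chain ezC) => k /=; rewrite ezX !der_var big_split_ord /= [X in X + _]big1 ?add0r.
  by rewrite rmorph_sum /=; apply: eq_bigr => l _; rewrite /Etot block_mxEdr ezZ ezX.
by move=> l _; rewrite /Etot block_mxEdl mxE scale0r.
Qed.

Lemma cz_low (i j : 'I_r) s : (j < i)%N -> b i = b j -> \sum_l E1 i j s l * cz l = 0.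
Proof.
move=> ji bij; have /rowP/(_ s) := g_hw ji (esym bij); rewrite mxE [RHS]mxE => h.
rewrite -[RHS](mulr0 (d1 s)) -[in RHS]h mulr_sumr; apply: eq_bigr => l _.
by rewrite /cz mulrA (gmod_adj M1) // -mulrA [g 0 l * _]mulrC.
Qed.

(** Restricted to raising operators: on the z variables these act through lowering operators of
    [E1], which annihilate [cz] because their adjoints kill [g]. *)
Lemma der_evt (i j : 'I_r) p : (i < j)%N -> b i = b j ->
  der (E i j) (evt p) = evt (der (Etot i j) p).
Proof.
move=> ij bij; apply: (der_chain evtC) => k /=; rewrite der_var big_split_ord /= rmorphD !rmorph_sum /=.
case: (split_ordP k) => k' ->.
  rewrite evtXl der_var [X in _ + X]big1 ?addr0 => [|l _]; last first.
    by rewrite /Etot block_mxEur mxE scale0r rmorph0.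
  by apply: eq_bigr => l _; rewrite /Etot block_mxEul evtZ evtXl.
rewrite evtXr derC big1 ?add0r => [|l _]; last first.
  by rewrite /Etot block_mxEdl mxE scale0r rmorph0.
under eq_bigr do rewrite /Etot block_mxEdr mxE evtZ evtXr scaleNr -mul_mpolyC -mpolyCM.
by rewrite sumrN -raddf_sum /= (cz_low _ ij) ?oppr0 // bij.
Qed.

Lemma meval_low (i j : 'I_r) q : (j < i)%N -> b i = b j -> (der (E1 i j) q).@[cz] = 0.
Proof.
move=> ji bij; elim/mpoly_alg_ind: q => [c|s|p q Ep Eq|p q Ep Eq].
- by rewrite derC meval0.
- rewrite der_var raddf_sum /= -[RHS](cz_low s ji bij); apply: eq_bigr => l _.
  by rewrite mevalZ mevalXU.
- by rewrite derD mevalD Ep Eq addr0.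
- by rewrite derM mevalD !mevalM Ep Eq mul0r mulr0 addr0.
Qed.

(** An intertwiner [T] sending [u] to a multiple of [m] is an invariant of the dual of one module
    tensored with the other; [p] is this invariant, written with monomials in z as orthogonal basis.
    Evaluating z at [cz] applies [T] to the vector [e] representing evaluation, which gives [m]
    times [u.@[cz]] over the squared length of [u]. *)
Lemma lift nu (m : {mpoly rat[D]}) (u : {mpoly rat[n1]}) :
  phw b E wt nu m -> phw b E1 w1 nu u -> u.@[cz] != 0 ->
  exists p, pinv b Etot p /\ evt p = m.
Proof.
move=> mA uA u0; pose K := msize m; pose K2 := msize u.
have mK : (msize m <= K.+1)%N by []. have uK : (msize u <= K2.+1)%N by [].
pose MK := gmod_poly K M; pose MK2 := gmod_poly K2 M1.
have vu0 : vec K2 u != 0.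
  apply: contra_neq u0 => v0; rewrite -(vecK uK) v0 /pol big1 ?meval0 // => s _.
  by rewrite mxE scale0r.
have [T [TE Tphi]] := intertwiner MK MK2 (iffLR (phw_vec _ _ _ _ mK) mA)
  (iffLR (phw_vec _ _ _ _ uK) uA) vu0.
pose phi := \col_s ('X_[@bm n1 K2 s] : {mpoly rat[n1]}).@[cz].
pose d2 := pold (K := K2) d1.
have d2_gt0 s : 0 < d2 s := gmod_gt0 MK2 s.
have phi_low (i j : 'I_r) : (j < i)%N -> b i = b j -> polE K2 E1 i j *m phi = 0.
  move=> ji bij; apply/colP => s; rewrite mxE [RHS]mxE.
  transitivity ((der (E1 i j) 'X_[bm s]).@[cz]); last exact: meval_low.
  rewrite -[in RHS](@vecK n1 K2 (der _ _)) ?msize_der ?msizeX ?ltnS ?bm_deg //.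
  rewrite /pol raddf_sum /=; apply: eq_bigr => t _.
  by rewrite mevalZ !mxE.
pose e := \row_s (phi s 0 / d2 s).
have eD : e *m gram d2 = phi^T.
  by apply/rowP => s; rewrite mul_mx_gram !mxE divfK // gt_eqF.
have := Tphi phi phi_low e eD; set k := _ / _ => eT.
have k0 : k != 0.
  have uu := gram_neq0 d2_gt0 vu0.
  rewrite /k mulf_eq0 invr_eq0 negb_or (gt_eqF uu) andbT.
  suff -> : (vec K2 u *m phi) 0 0 = u.@[cz] by [].
  rewrite -[in RHS](vecK uK) /pol raddf_sum /= mxE; apply: eq_bigr => s _.
  by rewrite mevalZ !mxE.
pose p := \sum_s (d2 s)^-1 *: (ez 'X_[bm s] * ex (pol (row s T))).
exists (k^-1 *: p); split; last first.
  rewrite evtZ rmorph_sum /=.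
  have -> : \sum_s evt ((d2 s)^-1 *: (ez 'X_[bm s] * ex (pol (row s T)))) = pol (e *m T).
    rewrite mulmx_sum_row pol_sum; apply: eq_bigr => s _.
    by rewrite evtZ rmorphM /= evt_ex evt_ez polZ !mxE mul_mpolyC scalerA mulrC.
  by rewrite eT polZ vecK // scalerA mulVf // scale1r.
move=> i j bij; rewrite derZ; suff -> : der (Etot i j) p = 0 by rewrite scaler0.
rewrite /p der_sum.
under eq_bigr do rewrite derZ derM der_ez der_ex scalerDr.
rewrite big_split /=.
have -> : \sum_s (d2 s)^-1 *: (ez (der (- E1 j i) 'X_[bm s]) * ex (pol (row s T))) =
   - \sum_s \sum_t ((d2 s)^-1 * polE K2 E1 j i s t) *: (ez 'X_[bm t] * ex (pol (row s T))).
  rewrite -sumrN; apply: eq_bigr => s _.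
  have -> : der (- E1 j i) 'X_[bm s] = - \sum_t polE K2 E1 j i s t *: 'X_[bm t].
    rewrite -scaleN1r derZl scaleN1r; congr (- _).
    rewrite -[LHS](@vecK n1 K2) ?msize_der ?msizeX ?ltnS ?bm_deg //.
    by apply: eq_bigr => t _; rewrite !mxE.
  rewrite rmorphN rmorph_sum /= mulNr scalerN mulr_suml scaler_sumr; congr (- _).
  by apply: eq_bigr => t _; rewrite ezZ -scalerAl scalerA.
have -> : \sum_s (d2 s)^-1 *: (ez 'X_[bm s] * ex (der (E i j) (pol (row s T)))) =
   \sum_s \sum_t ((d2 s)^-1 * polE K2 E1 i j s t) *: (ez 'X_[bm s] * ex (pol (row t T))).
  apply: eq_bigr => s _.
  have -> : der (E i j) (pol (row s T)) = \sum_t polE K2 E1 i j s t *: pol (row t T).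
    rewrite -pol_der -row_mul -(TE i j bij) row_mul mulmx_sum_row pol_sum.
    by apply: eq_bigr => t _; rewrite polZ mxE.
  rewrite rmorph_sum /= mulr_sumr scaler_sumr.
  by apply: eq_bigr => t _; rewrite exZ -scalerAr scalerA.
rewrite [X in _ + X]exchange_big /=; apply/eqP; rewrite addrC subr_eq0; apply/eqP.
apply: eq_bigr => s _; apply: eq_bigr => t _; congr (_ *: _).
have := gmod_adj MK2 s t (esym bij); rewrite -/d2 => h.
apply: (mulfI (lt0r_neq0 (d2_gt0 s))); rewrite !mulrA mulfV ?gt_eqF // mul1r.
by rewrite mulrAC -h -mulrA mulfV ?mulr1 // gt_eqF.
Qed.

End Lift.

Lemma In_nth (T : Type) (x0 : T) (l : list T) i : (i < size l)%N -> List.In (nth x0 l i) l.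
Proof.
elim: l i => // a l IH [|i] /=; first by left.
by rewrite ltnS => /IH; right.
Qed.

Section LinearForm.
Variables (r : nat) (b : 'I_r -> nat) (n : nat).
Variables (E : 'I_r -> 'I_r -> 'M[rat]_n) (wt : 'I_n -> 'X_{1..r}).

Definition lin (v : 'rV[rat]_n) : {mpoly rat[n]} := \sum_s v 0 s *: 'X_s.

Lemma phw_lin w v : hwv b E wt w v -> phw b E wt w (lin v).
Proof.
move=> [wv hv]; split=> [m|i j ij bij].
  rewrite mcoeff_msupp /lin raddf_sum /= => h.
  have [s] : exists s, (v 0 s *: 'X_s : {mpoly rat[n]})@_m != 0.
    apply/existsP; apply: contraNT h; rewrite negb_exists => /forallP h.
    by rewrite big1 // => s _; apply/eqP; rewrite -[_ == _]negbK.
  rewrite mcoeffZ mcoeffX; case: (_ =P m) => [<-|_]; last by rewrite mulr0 eqxx.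
  by rewrite mulr1 mwtU => /wv.
rewrite /lin der_sum; under eq_bigr do rewrite derZ der_var scaler_sumr.
rewrite exchange_big /= big1 // => l _; have /rowP/(_ l) := hv i j ij bij.
rewrite mxE [RHS]mxE => h; under eq_bigr do rewrite scalerA.
by rewrite -scaler_suml h scale0r.
Qed.

End LinearForm.

Section Bounded.
Variables (r : nat) (b : 'I_r -> nat) (D : nat).
Variables (E : 'I_r -> 'I_r -> 'M[rat]_D).
Variables (wt : 'I_D -> 'X_{1..r}) (d : 'I_D -> rat).
Hypothesis M : gmod b E wt d.
Variable degw : 'X_{1..r} -> nat.
Hypothesis degw_mdeg : forall m : 'X_{1..D}, degw (mwt wt m) = mdeg m.

Local Notation A := (phw b E wt).

Lemma phw_wcomp w p : (forall i j : 'I_r, (i < j)%N -> b i = b j -> der (E i j) p = 0) ->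
  A w (wcomp wt w p).
Proof.
move=> ph; split=> [m|i j ij bij]; last exact/(der_wcomp M)/ph.
by rewrite mcoeff_msupp mcoeff_wcomp; case: (_ =P w) => // _; rewrite eqxx.
Qed.

(* Lift the highest weight vectors of weights psi + k chi to invariants of a
   larger polynomial ring, where the Reynolds operator and Hilbert's basis
   theorem give finitely many generators over the invariants. *)
Theorem dimA_bounded chi f psi : A chi f -> f != 0 ->
  (forall k p, A (chi *+ k)%MM p -> exists c, p = c *: f ^+ k) ->
  exists N, forall k, (dimA b E degw (psi + chi *+ k)%MM <= N)%N.
Proof.
move=> fA f0 chi1; have d_gt0 := gmod_gt0 M.
have [[k0 [m0 [m0A m00]]]|nz] :=
  classic (exists k0 m0, A (psi + chi *+ k0)%MM m0 /\ m0 != 0); last first.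
  exists 0%N => k; rewrite leqn0; apply/eqP; apply: (dimA_eq0 M) => p pA.
  by apply/eqP; apply: contra_notT nz => p0; exists k, p.
pose K1 := maxn (msize f) (msize m0).
have fK : (msize f <= K1.+1)%N by rewrite leqW // leq_maxl.
have mK : (msize m0 <= K1.+1)%N by rewrite leqW // leq_maxr.
pose fv := vec K1 f; pose mv := vec K1 m0.
have fh : hwv b (polE K1 E) (polw wt) chi fv by apply/phw_vec.
have mh : hwv b (polE K1 E) (polw wt) (psi + chi *+ k0)%MM mv by apply/phw_vec.
pose d1 := pold (K := K1) d; have d1_gt0 s : 0 < d1 s by apply: pold_gt0.
pose B (x y : 'rV[rat]_#|{: 'X_{1..D < K1.+1}}|) := \sum_s x 0 s * (d1 s * y 0 s).
have Bsym x y : B x y = B y x by apply: eq_bigr => s _; ring.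
have BD x y z : B x (y + z) = B x y + B x z.
  by rewrite -big_split; apply: eq_bigr => s _; rewrite mxE !mulrDr.
have Bxx x : x != 0 -> B x x != 0.
  move=> x0; have := gram_neq0 d1_gt0 x0; rewrite gram_form => /lt0r_neq0.
  by rewrite (_ : \sum_k _ = B x x) //; apply: eq_bigr => s _; rewrite expr2 mulrCA.
have fv0 : fv != 0.
  by apply: contra_neq f0 => v0; rewrite -(vecK fK) -/fv v0 /pol big1 // => s _; rewrite mxE scale0r.
have mv0 : mv != 0.
  by apply: contra_neq m00 => v0; rewrite -(vecK mK) -/mv v0 /pol big1 // => s _; rewrite mxE scale0r.
(* [g] must pair nontrivially with both [fv] and [mv], so that [lin fv ^+ (k - k0) * lin mv] does
   not vanish there. If they are orthogonal their sum works, otherwise [fv] does. *)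
have [g [gh gf gm]] : exists g, [/\ forall i j : 'I_r, (i < j)%N -> b i = b j ->
    g *m polE K1 E i j = 0, B fv g != 0 & B mv g != 0].
  have [Bmf|Bmf] := eqVneq (B mv fv) 0.
    exists (fv + mv); split=> [i j ij bij||].
    - by rewrite mulmxDl fh.2 // mh.2 // addr0.
    - by rewrite BD (Bsym fv mv) Bmf addr0 Bxx.
    - by rewrite BD Bmf add0r Bxx.
  by exists fv; split=> //; [exact: fh.2|exact: Bxx].
have linE v : (lin v).@[cz d g] = B v g.
  rewrite /lin raddf_sum; apply: eq_bigr => s _ /=.
  by rewrite mevalZ mevalXU.
have liftA k m : (k0 <= k)%N -> A (psi + chi *+ k)%MM m ->
    exists p, pinv b (Etot E K1) p /\ evt d g p = m.
  move=> kk mA; apply: (lift M gh mA (u := lin fv ^+ (k - k0) * lin mv)); last first.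
    rewrite mevalM rmorphXn /= !linE mulf_neq0 // expf_neq0 //.
  have -> : (psi + chi *+ k = chi *+ (k - k0) + (psi + chi *+ k0))%MM.
    by apply/mnmP => p; rewrite !(mnmDE, mulmnE); nia.
  by apply: phwM; [apply: phwX; apply: phw_lin|apply: phw_lin].
(* All lifts for all [k] at once: the ideal they generate does not depend on [k], so one finite list
   of generators serves every weight. *)
pose S p := exists k, (k0 <= k)%N /\ pinv b (Etot E K1) p /\ A (psi + chi *+ k)%MM (evt d g p).
have [l [lS lgen]] := hilbert_basis S.
have [kf kfP] : exists kf : {mpoly rat[D + #|{: 'X_{1..D < K1.+1}}|]} -> nat, forall q, List.In q l ->
    pinv b (Etot E K1) q /\ A (psi + chi *+ kf q)%MM (evt d g q).
  apply: (choice (fun q k => List.In q l -> pinv b (Etot E K1) q /\ A (psi + chi *+ k)%MM (evt d g q))) => q.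
  have [ql|nql] := classic (List.In q l); last by exists 0%N.
  by have [k [_ h]] := lS q ql; exists k.
(* The finitely many [k] below [k0], where no lift is constructed, are covered by their own
   dimensions. *)
exists (\sum_(j < k0) dimA b E degw (psi + chi *+ j)%MM + size l)%N => k.
have [kk|kk] := ltnP k k0.
  by rewrite (bigD1 (Ordinal kk)) //= -addnA leq_addr.
apply: leq_trans (leq_addl _ _).
rewrite -(size_map (fun q => f ^+ (k - kf q) * evt d g q) l).
apply: (dimA_span M) => p pA.
have [P [Pinv Pp]] := liftA k p kk pA.
have /lgen/ideal_span_list [c cE] : S P by exists k; rewrite Pp.
have lI (i : 'I_(size l)) := kfP _ (In_nth 0 (ltn_ord i)).
have red (i : 'I_(size l)) : exists sy : {mpoly rat[D + #|{: 'X_{1..D < K1.+1}}|]} * ('I_r * 'I_r -> {mpoly rat[D + #|{: 'X_{1..D < K1.+1}}|]}),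
    c i = sy.1 + \sum_(q | b q.1 == b q.2) der (Etot E K1 q.1 q.2) (sy.2 q) /\ pinv b (Etot E K1) sy.1.
  have [s' [y h]] := poly_reynolds_decomp (gsumd_gt0 M (K1 := K1)) (Etot_adj M (K1 := K1)) (c i).
  by exists (s', y).
have [sy syP] := choice _ red.
(* Coefficients may be replaced by their invariant parts: the generators being invariant, the error
   is a sum of images of derivations; it is also invariant, hence zero. *)
have PE : P = \sum_(i < size l) (sy i).1 * nth 0 l i.
  apply/eqP; rewrite -subr_eq0; apply/eqP.
  pose Y q := \sum_(i < size l) (sy i).2 q * nth 0 l i.
  have YE : P - \sum_(i < size l) (sy i).1 * nth 0 l i =
      \sum_(q | b q.1 == b q.2) der (Etot E K1 q.1 q.2) (Y q).
    rewrite cE -sumrB.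
    under eq_bigr => i _ do rewrite (syP i).1 mulrDl addrC addrA addNr add0r mulr_suml.
    rewrite exchange_big; apply: eq_bigr => q /eqP bq; rewrite /Y der_sum.
    by apply: eq_bigr => i _; rewrite derM (lI i).1 // mulr0 addr0.
  have Dinv : pinv b (Etot E K1) (P - \sum_(i < size l) (sy i).1 * nth 0 l i).
    move=> i j bij; rewrite derB Pinv // der_sum big1 ?subr0 // => t _.
    by rewrite derM (syP t).2 // (lI t).1 // mul0r mulr0 addr0.
  rewrite YE; apply: (poly_reynolds_uniq (gsumd_gt0 M (K1 := K1)) (Etot_adj M (K1 := K1))).
  by rewrite -YE.
have pE : p = \sum_(i < size l) wcomp wt (psi + chi *+ k)%MM (evt d g (sy i).1 * evt d g (nth 0 l i)).
  rewrite -wcomp_sum -[LHS](@wcomp_id _ _ wt (psi + chi *+ k)%MM) -?Pp; last by rewrite Pp; case: pA.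
  by rewrite {1}PE rmorph_sum; congr wcomp; apply: eq_bigr => i _; rewrite rmorphM.
(* Only the component of the coefficient whose weight is the difference of the two weights
   contributes; if there is one, its weight is [chi *+ (k - kf q)] and it is a scalar times a power
   of [f]. *)
have term (i : 'I_(size l)) : exists a, wcomp wt (psi + chi *+ k)%MM (evt d g (sy i).1 * evt d g (nth 0 l i)) =
    a *: (f ^+ (k - kf (nth 0 l i)) * evt d g (nth 0 l i)).
  set q := nth 0 l i; have [qinv qA] := lI i.
  have [[w' w'E]|nw] := classic (exists w', (psi + chi *+ k = w' + (psi + chi *+ kf q))%MM); last first.
    exists 0; rewrite scale0r; apply: (wcompM0 (v := (psi + chi *+ kf q)%MM)); first by case: qA.
    by move=> w' e; apply: nw; exists w'.
  rewrite {1}w'E (wcompM _ _ (v := (psi + chi *+ kf q)%MM)); last by case: qA.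
  have w'k : w' = (chi *+ (k - kf q))%MM.
    apply/mnmP => x; have /mnmP/(_ x) := w'E; rewrite !(mnmDE, mulmnE) => e.
    by rewrite mulnBr; lia.
  have /chi1 [a ->] : A (chi *+ (k - kf q))%MM (wcomp wt w' (evt d g (sy i).1)).
    rewrite -w'k; apply: phw_wcomp => x y xy bxy.
    by rewrite (der_evt M gh) // (syP i).2 // rmorph0.
  by exists a; rewrite scalerAl.
have [a aE] := choice _ term.
have sz : size [seq f ^+ (k - kf q) * evt d g q | q <- l] = size l by rewrite size_map.
exists (fun i => a (cast_ord sz i)); rewrite pE (reindex (cast_ord sz)) /=.
  by apply: eq_bigr => i _; rewrite aE (nth_map 0) // -sz.
by exists (cast_ord (esym sz)) => i _; rewrite ?cast_ordK ?cast_ordKV.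
Qed.

End Bounded.

(** * The Jacobi-Trudi formula *)

Section Complete.
Variable R : comNzRingType.
Implicit Types (s : seq R) (x : R).

Fixpoint hs s (k : nat) : R :=
  if s is a :: s' then \sum_(p < k.+1) a ^+ p * hs s' (k - p) else (k == 0%N)%:R.

Lemma hs0 s : hs s 0 = 1.
Proof. by elim: s => //= a s IH; rewrite big_ord1 expr0 mul1r subn0. Qed.

Lemma hs_rec a s k : hs (a :: s) k.+1 = hs s k.+1 + a * hs (a :: s) k.
Proof.
rewrite /= big_ord_recl expr0 mul1r subn0 mulr_sumr; congr (_ + _).
by apply: eq_bigr => p _; rewrite lift0 exprS mulrA subSS.
Qed.

(** The generating function, with geometric series truncated so as to stay among polynomials. It
    shows that [hs], defined by recursion along the list, is symmetric. *)
Lemma hs_coef K s k : (k <= K)%N -> (\prod_(a <- s) \poly_(p < K.+1) a ^+ p)`_k = hs s k.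
Proof.
elim: s k => [|a s IH] k kK; first by rewrite big_nil coef1.
rewrite big_cons coefM /=; apply: eq_bigr => p _.
rewrite IH; last exact: leq_trans (leq_subr _ _) kK.
by rewrite coef_poly ltnS (leq_trans _ kK) // -ltnS.
Qed.

Lemma hs_perm s1 s2 : perm_eq s1 s2 -> hs s1 =1 hs s2.
Proof. by move=> e k; rewrite -!(hs_coef (K := k)) // (perm_big _ e). Qed.

Lemma hs_cons0 s k : hs (0 :: s) k = hs s k.
Proof. by case: k => [|k]; rewrite ?hs0 // hs_rec mul0r addr0. Qed.

Lemma hs_filter0 s k : hs [seq a <- s | a != 0] k = hs s k.
Proof.
rewrite -!(hs_coef _ (leqnn k)) big_filter big_mkcond.
rewrite (eq_bigr (fun a => \poly_(p < k.+1) a ^+ p)) // => a _.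
case: eqP => //= ->; apply/polyP => i.
by rewrite coef_poly coef1; case: i => [|i]; rewrite ?expr0 // expr0n /= if_same.
Qed.

Definition hh s (a b : nat) : R := if (b <= a)%N then hs s (a - b) else 0.

Lemma hh_rec x s a b : hh (x :: s) a.+1 b = hh s a.+1 b + x * hh (x :: s) a b.
Proof.
rewrite /hh; case: (ltngtP b a.+1) => [|h|->].
- by rewrite ltnS => ba; rewrite ba subSn // hs_rec.
- by rewrite leqNgt (ltnW h) /= mulr0 addr0.
- by rewrite ltnn subnn !hs0 mulr0 addr0.
Qed.

Lemma hh_sum x s a b : hh (x :: s) a b = \sum_(0 <= c < a.+1) x ^+ (a - c) * hh s c b.
Proof.
elim: a => [|a IH].
  rewrite big_nat1 subnn expr0 mul1r /hh; case: b => [|b] //.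
  by rewrite subnn !hs0.
rewrite hh_rec IH [RHS]big_nat_recr //= subnn expr0 mul1r addrC; congr (_ + _).
rewrite mulr_sumr; apply: eq_big_nat => c /andP[_ ca].
by rewrite subSn // exprS mulrA.
Qed.

Lemma hh_diff x s a a' b : (a' < a)%N ->
  hh (x :: s) a b - x ^+ (a - a') * hh (x :: s) a' b =
  \sum_(a'.+1 <= c < a.+1) x ^+ (a - c) * hh s c b.
Proof.
move=> aa; rewrite !hh_sum (big_cat_nat (n := a'.+1)) //= ?ltnS 1?ltnW //.
rewrite addrAC -[RHS]add0r; congr (_ + _); apply/eqP; rewrite subr_eq0; apply/eqP.
rewrite mulr_sumr; apply: eq_big_nat => c /andP[_ ca].
rewrite mulrA -exprD; congr (_ ^+ _ * _); lia.
Qed.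

End Complete.

Lemma hs_morph (R S : comNzRingType) (f : {rmorphism R -> S}) s k :
  f (hs s k) = hs (map f s) k.
Proof.
elim: s k => [|a s IH] k /=; first by rewrite rmorph_nat.
by rewrite rmorph_sum; apply: eq_bigr => p _; rewrite rmorphM rmorphXn IH.
Qed.

Section JacobiTrudi.
Variables (R : comNzRingType) (l m : nat).
Implicit Types (s : seq R) (kap xi : {ffun 'I_l -> 'I_m.+1}).

(** The entry is the complete symmetric polynomial of index [kap i - i + j]; both arguments of [hh]
    are shifted to remain natural numbers. *)
Definition jt s (kap : 'I_l -> nat) : R :=
  \det (\matrix_(i < l, j < l) hh s (kap i + (l - 1 - i)) (l - 1 - j)).

Definition nxt (kap : 'I_l -> nat) (i : 'I_l) : nat := oapp kap 0%N (insub i.+1).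

Lemma nxt_lt (kap : 'I_l -> nat) (i j : 'I_l) : i.+1 = j -> nxt kap i = kap j.
Proof.
move=> ij; rewrite /nxt; case: insubP => [u _ uE|]; last by rewrite ij ltn_ord.
by congr (kap _); apply: val_inj; rewrite uE.
Qed.

Lemma nxt_last (kap : 'I_l -> nat) (i : 'I_l) : i.+1 = l -> nxt kap i = 0%N.
Proof. by move=> il; rewrite /nxt insubF // il ltnn. Qed.

Definition inter xi kap := [forall i, (nxt (fun i => kap i) i <= xi i <= kap i)%N].

Lemma det_sum_rows n (I : finType) (P : 'I_n -> pred I) (V : 'I_n -> I -> 'I_n -> R) :
  \det (\matrix_(i < n, j < n) \sum_(c | P i c) V i c j) =
  \sum_(f : {ffun 'I_n -> I} | [forall i, P i (f i)]) \det (\matrix_(i < n, j < n) V i (f i) j).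
Proof.
rewrite /determinant [RHS]exchange_big /=; apply: eq_bigr => sg _.
rewrite -mulr_sumr; congr (_ * _); under eq_bigr do rewrite mxE.
rewrite bigA_distr_big_dep; apply: eq_big => [f|f _]; last by apply: eq_bigr => i _; rewrite mxE.
by apply/familyP/forallP => h i; apply: h.
Qed.

Lemma det_scale_rows n (c : 'I_n -> R) (A : 'I_n -> 'I_n -> R) :
  \det (\matrix_(i < n, j < n) (c i * A i j)) = (\prod_i c i) * \det (\matrix_(i < n, j < n) A i j).
Proof.
rewrite /determinant mulr_sumr; apply: eq_bigr => sg _; rewrite mulrCA; congr (_ * _).
by rewrite -big_split; apply: eq_bigr => i _; rewrite !mxE.
Qed.

Lemma sum_shift (G : nat -> R) lo hi e : (hi < m.+1)%N ->
  \sum_(c < m.+1 | (lo <= c <= hi)%N) G (c + e)%N = \sum_(lo + e <= c < (hi + e).+1) G c.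
Proof.
move=> him; rewrite -addSn big_addn addnK.
rewrite -(big_mkord (fun c => (lo <= c <= hi)%N) (fun c => G (c + e)%N)).
rewrite [RHS](big_nat_widenl _ 0) // [RHS](big_nat_widen _ _ m.+1) //.
Qed.

(* Subtracting from each row a multiple of the next one leaves, by the
   recursion for complete symmetric polynomials, the sum over the
   interlacing shapes. *)
Lemma jt_cons x s kap : (forall i j : 'I_l, (i <= j)%N -> (kap j <= kap i)%N) ->
  jt (x :: s) (fun i => kap i) =
  \sum_(xi | inter xi kap) (\prod_i x ^+ (kap i - xi i)) * jt s (fun i => xi i).
Proof.
move=> kdec; rewrite /jt.
pose a (i : 'I_l) := (kap i + (l - 1 - i))%N.
pose A := \matrix_(i < l, j < l) hh (x :: s) (a i) (l - 1 - j).
pose U := \matrix_(i < l, j < l) ((i == j)%:R - (i.+1 == j :> nat)%:R * x ^+ (a i - a j)) : 'M[R]_l.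
have detU : \det U = 1.
  rewrite -det_tr det_trig; last first.
    apply/is_trig_mxP => i j ij; rewrite !mxE -val_eqE /= (gtn_eqF ij).
    by rewrite gtn_eqF ?mul0r ?subrr //; apply: ltnW.
  rewrite big1 // => i _; rewrite !mxE eqxx.
  by rewrite gtn_eqF // mul0r subr0.
have -> : \det (\matrix_(i < l, j < l) hh (x :: s) (kap i + (l - 1 - i)) (l - 1 - j)) = \det (U *m A).
  by rewrite det_mulmx detU mul1r.
have -> : U *m A = \matrix_(i < l, j < l)
    \sum_(c : 'I_m.+1 | (nxt (fun i => kap i) i <= c <= kap i)%N)
       x ^+ (kap i - c) * hh s (c + (l - 1 - i)) (l - 1 - j).
  apply/matrixP => i j; rewrite [RHS]mxE mxE.
  have -> : \sum_(c < m.+1 | (nxt (fun i => kap i) i <= c <= kap i)%N)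
       x ^+ (kap i - c) * hh s (c + (l - 1 - i)) (l - 1 - j) =
     \sum_(nxt (fun i => kap i) i + (l - 1 - i) <= c < (a i).+1) x ^+ (a i - c) * hh s c (l - 1 - j).
    rewrite -sum_shift //; apply: eq_bigr => c /andP[_ ck].
    by congr (x ^+ _ * _); rewrite /a; lia.
  rewrite (bigD1 i) //= !mxE eqxx gtn_eqF // mul0r subr0 mul1r.
  case: (ltngtP i.+1 l) => il; last first.
  - rewrite big1 ?addr0 => [|k ki]; last first.
      rewrite !mxE eq_sym (negPf ki) gtn_eqF ?mul0r ?subrr ?mul0r // il.
      exact: ltn_ord.
    rewrite nxt_last // (_ : l - 1 - i = 0)%N; last by lia.
    by rewrite hh_sum.
  - by have := ltn_ord i; lia.
  pose i' := Ordinal il.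
  rewrite (bigD1 i') /=; last by rewrite -val_eqE /= gtn_eqF.
  rewrite big1 ?addr0 => [|k /andP[ki ki']]; last first.
    rewrite !mxE eq_sym (negPf ki) (_ : (i.+1 == k :> nat) = false) ?mul0r ?subrr ?mul0r //.
    by apply: contraNF ki' => /eqP e; apply/eqP/val_inj; rewrite /= -e.
  rewrite !mxE -val_eqE /= ltn_eqF // eqxx mul1r sub0r mulNr.
  rewrite hh_diff; last by rewrite /a /=; have := kdec i i' (leqnSn _); lia.
  rewrite (@nxt_lt _ i i') // (_ : kap i' + (l - 1 - i) = (a i').+1)%N //.
  by rewrite /a /=; lia.
rewrite det_sum_rows; apply: eq_big => [xi|xi _] //.
by rewrite det_scale_rows.
Qed.

Lemma jt_nil (kap : 'I_l -> nat) : (forall i j : 'I_l, (i <= j)%N -> (kap j <= kap i)%N) ->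
  jt [::] kap = [forall i, kap i == 0%N]%:R.
Proof.
move=> kdec; rewrite /jt; case: (boolP [forall i, kap i == 0%N]) => [/forallP k0|].
  rewrite (_ : (\matrix_(i < l, j < l) _) = 1%:M) ?det1 //; apply/matrixP => i j; rewrite !mxE.
  rewrite (eqP (k0 i)) /hh /=; have := ltn_ord i; have := ltn_ord j; rewrite -val_eqE /= => hj hi.
  rewrite add0n; have [ij|/eqP ij] := eqVneq (i : nat) j; first by rewrite ij leqnn subnn.
  by case: leqP => h //; rewrite (_ : (_ == 0)%N = false) //; apply/eqP; lia.
rewrite negb_forall => /existsP [i ki].
have l0 : (0 < l)%N by apply: leq_ltn_trans (ltn_ord i).
pose i0 := Ordinal l0.
rewrite (expand_det_row _ i0) big1 // => j _; rewrite mxE.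
have hk : (0 < kap i0)%N by apply: leq_trans (kdec i0 i (leq0n _)); rewrite lt0n.
suff -> : hh [::] (kap i0 + (l - 1 - i0)) (l - 1 - j) = 0 :> R by rewrite mul0r.
rewrite /hh /=; case: leqP => // h; case: (_ =P 0%N) => // e; exfalso.
by have := ltn_ord j; lia.
Qed.

End JacobiTrudi.

Lemma card_ord_lt m k : (k <= m)%N -> #|[pred j : 'I_m | (j < k)%N]| = k.
Proof.
move=> km; rewrite -sum1_card (eq_bigl (fun j : 'I_m => (j < k)%N)) //.
by rewrite (big_ord_narrow km) sum1_card card_ord.
Qed.

Lemma card_prefix m (P : pred 'I_m) :
  (forall j j' : 'I_m, (j <= j')%N -> P j' -> P j) -> forall j, P j = (j < #|P|)%N.
Proof.
move=> dc j; apply/idP/idP => [Pj|].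
  rewrite -[X in (X <= _)%N](card_ord_lt (ltn_ord j)); apply: subset_leq_card.
  by apply/subsetP => j'; rewrite !inE ltnS => /dc; apply.
apply: contraTT => nPj; rewrite -leqNgt -[X in (_ <= X)%N](card_ord_lt (ltnW (ltn_ord j))).
apply: subset_leq_card; apply/subsetP => j' Pj'; rewrite inE ltnNge.
by apply: contra nPj => jj'; apply: dc Pj'.
Qed.

(** * Branching of semistandard tableaux along the largest entry *)

Section Tableaux.
Variables (R : comNzRingType) (l m : nat) (w : nat -> R).

Local Notation fil n := {ffun 'I_l * 'I_m -> option 'I_n}.

(** The conditions of [ssyt] in a rectangle independent of the shape, so that a tableau and what is
    left after removing its largest entries have the same cells. *)
Definition sst n (kap : 'I_l -> nat) (t : fil n) : bool :=
  [forall c, (t c == None) == (kap c.1 <= c.2)%N] &&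
  [forall c, forall c',
     match t c, t c' with
     | Some x, Some y =>
         ((c.1 == c'.1) && (c.2 < c'.2)%N ==> (x <= y)%N) &&
         ((c.2 == c'.2) && (c.1 < c'.1)%N ==> (x < y)%N)
     | _, _ => true
     end].

Lemma sstP n kap (t : fil n) : reflect
  [/\ forall i j, (t (i, j) == None) = (kap i <= j)%N,
      forall i (j j' : 'I_m) x y, (j < j')%N -> t (i, j) = Some x -> t (i, j') = Some y -> (x <= y)%N &
      forall (i i' : 'I_l) j x y, (i < i')%N -> t (i, j) = Some x -> t (i', j) = Some y -> (x < y)%N]
  (sst kap t).
Proof.
apply: (iffP andP) => [[/forallP h1 /forallP h2]|[h1 h2 h3]].
  split=> [i j|i j j' x y jj tx ty|i i' j x y ii tx ty]; first by have /eqP := h1 (i, j).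
    by have /forallP/(_ (i, j')) := h2 (i, j); rewrite tx ty /= eqxx jj /= => /andP[].
  by have /forallP/(_ (i', j)) := h2 (i, j); rewrite tx ty /= eqxx ii /= => /andP[].
split; first by apply/forallP => -[i j]; rewrite h1.
apply/forallP => -[i j]; apply/forallP => -[i' j'] /=.
case tx: (t (i, j)) => [x|//]; case ty: (t (i', j')) => [y|//].
apply/andP; split; apply/implyP => /andP[/eqP e h].
  by apply: (h2 i j j') => //; rewrite e.
by apply: (h3 i i' j) => //; rewrite e.
Qed.

Definition wgt n (t : fil n) : R := \prod_c (if t c is Some k then w k else 1).

Definition SS n (kap : 'I_l -> nat) : R := \sum_(t : fil n | sst kap t) wgt t.

Fixpoint ws n : seq R := if n is n'.+1 then w n' :: ws n' else [::].

Section Branch.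
Variables (n : nat) (kap : {ffun 'I_l -> 'I_m.+1}).
Hypothesis kdec : forall i j : 'I_l, (i <= j)%N -> (kap j <= kap i)%N.

(** [insub] erases the entry [n], the largest one; [ext] restores it in the empty cells of [kap]. *)
Definition res (t : fil n.+1) : fil n :=
  [ffun c : 'I_l * 'I_m => if t c is Some k then insub (k : nat) else None].

Definition ext (t : fil n) : fil n.+1 :=
  [ffun c : 'I_l * 'I_m => if (c.2 < kap c.1)%N then
     Some (if t c is Some k then widen_ord (leqnSn n) k else ord_max) else None].

Definition shp (t : fil n) : {ffun 'I_l -> 'I_m.+1} :=
  [ffun i => inord #|[pred j | t (i, j) != None]|].

Lemma shpE (t : fil n) i : shp t i = #|[pred j | t (i, j) != None]| :> nat.
Proof. by rewrite ffunE inordK // ltnS -[X in (_ <= X)%N](card_ord m) max_card. Qed.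

Lemma ext_res (t : fil n.+1) : sst (fun i => kap i) t -> ext (res t) = t.
Proof.
case/sstP => h1 _ _; apply/ffunP => -[i j]; rewrite !ffunE /=.
have := h1 i j; rewrite leqNgt; case: ltnP => /= _; last by move/eqP.
case: (t (i, j)) => [k _|//]; congr Some; case: insubP => [u _ uE|nk]; apply: val_inj => //=.
by have := ltn_ord k; move: nk; rewrite -leqNgt; lia.
Qed.

Lemma ext_some (t : fil n) i (j : 'I_m) : (j < kap i)%N ->
  ext t (i, j) = Some (if t (i, j) is Some k then widen_ord (leqnSn n) k else ord_max).
Proof. by move=> h; rewrite ffunE /= h. Qed.

Section Restricted.
Variable t : fil n.
Hypotheses (t_sst : sst (fun i => kap i) (ext t)) (t_res : res (ext t) = t).

Lemma res_kap i (j : 'I_m) : t (i, j) != None -> (j < kap i)%N.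
Proof. by rewrite -t_res !ffunE /=; case: ltnP. Qed.

Lemma shp_prefix i (j : 'I_m) : (t (i, j) != None) = (j < shp t i)%N.
Proof.
rewrite shpE; apply: (card_prefix (P := [pred j | t (i, j) != None])) => j0 j1 /= le01 tj1.
have jk := res_kap tj1.
case: (ltngtP j0 j1) le01 => // [lt01 _|e _]; last by rewrite (val_inj e).
have /sstP[_ h2 _] := t_sst.
have := h2 i j0 j1 _ _ lt01 (ext_some t (ltn_trans lt01 jk)) (ext_some t jk).
case: (t (i, j0)) => // ; case: (t (i, j1)) tj1 => // x _ /=.
by rewrite leqNgt ltn_ord.
Qed.

(** If row [i + 1] of [kap] were longer than what remains of row [i], some cell of row [i] holding
    the largest entry would have a cell below it, against strictness in columns. *)
Lemma shp_inter : inter (shp t) kap.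
Proof.
apply/forallP => i; apply/andP; split; last first.
  rewrite shpE -[X in (_ <= X)%N](card_ord_lt (m := m) (k := kap i)); last by rewrite -ltnS ltn_ord.
  by apply: subset_leq_card; apply/subsetP => j; rewrite !inE => /res_kap.
case: (ltngtP i.+1 l) => il; last by rewrite nxt_last.
  pose i' := Ordinal il; rewrite (@nxt_lt _ _ i i') // leqNgt; apply/negP => lt.
  have jm : (shp t i < m)%N by apply: leq_trans lt _; rewrite -ltnS ltn_ord.
  pose j := Ordinal jm.
  have ji' : (j < kap i')%N by [].
  have ji : (j < kap i)%N by apply: leq_trans ji' _; apply: kdec; rewrite /= leqnSn.
  have tij : t (i, j) = None.
    by apply/eqP; rewrite -[_ == _]negbK shp_prefix ltnn.
  have /sstP[_ _ h3] := t_sst.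
  have := h3 i i' j _ _ (ltnSn i) (ext_some t ji) (ext_some t ji').
  by rewrite tij ltnNge -ltnS /=; case: (t (i', j)) => [x|] /=; rewrite ?ltnSn // ltnS ltnW.
by have := ltn_ord i; lia.
Qed.

Lemma shp_sst : sst (fun i => shp t i) t.
Proof.
have /sstP[_ h2 h3] := t_sst; apply/sstP; split.
- by move=> i j; rewrite -[_ == _]negbK shp_prefix -leqNgt.
- move=> i j j' x y jj tx ty.
  have k1 : (j < kap i)%N by apply: res_kap; rewrite tx.
  have k2 : (j' < kap i)%N by apply: res_kap; rewrite ty.
  by have := h2 i j j' _ _ jj (ext_some t k1) (ext_some t k2); rewrite tx ty.
- move=> i i' j x y ii tx ty.
  have k1 : (j < kap i)%N by apply: res_kap; rewrite tx.
  have k2 : (j < kap i')%N by apply: res_kap; rewrite ty.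
  by have := h3 i i' j _ _ ii (ext_some t k1) (ext_some t k2); rewrite tx ty.
Qed.

End Restricted.

Section Extended.
Variables (t : fil n) (xi : {ffun 'I_l -> 'I_m.+1}).
Hypotheses (xi_inter : inter xi kap) (t_sst : sst (fun i => xi i) t).

Lemma inter_le i : (xi i <= kap i)%N.
Proof. by have /forallP/(_ i)/andP[] := xi_inter. Qed.

Lemma inter_next (i i' : 'I_l) : (i < i')%N -> (kap i' <= xi i)%N.
Proof.
move=> ii; have /forallP/(_ i)/andP[h _] := xi_inter; apply: leq_trans h.
have il : (i.+1 < l)%N by apply: leq_ltn_trans (ltn_ord i').
by rewrite (@nxt_lt _ _ i (Ordinal il)) // kdec.
Qed.

Lemma ext_sst : sst (fun i => kap i) (ext t).
Proof.
have /sstP[h1 h2 h3] := t_sst; apply/sstP; split.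
- by move=> i j; rewrite ffunE /=; case: ltnP.
- move=> i j j' x y jj; rewrite !ffunE /=; case: ltnP => // _ [<-]; case: ltnP => // _ [<-].
  case tj: (t (i, j)) => [x'|] /=; case tj': (t (i, j')) => [y'|] //=.
  + exact: h2 tj tj'.
  + exact/ltnW/ltn_ord.
  + have := h1 i j; rewrite tj eqxx => /esym xj; have := h1 i j'; rewrite tj' /=.
    by rewrite (leq_trans (xj : is_true (xi i <= j)%N) (ltnW jj)).
- move=> i i' j x y ii; rewrite !ffunE /=; case: ltnP => // _ [<-]; case: ltnP => // jk [<-].
  have : t (i, j) != None by rewrite h1 -ltnNge; apply: leq_trans jk (inter_next ii).
  case tj: (t (i, j)) => [x'|] //= _; case tj': (t (i', j)) => [y'|] //=.
  exact: h3 tj tj'.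
Qed.

Lemma res_ext : res (ext t) = t.
Proof.
have /sstP[h1 _ _] := t_sst; apply/ffunP => -[i j]; rewrite !ffunE /=.
case: ltnP => [jk|kj].
  case: (t (i, j)) => [k|]; last by rewrite insubF //= ltnn.
  by rewrite insubT //= => h; congr Some; apply: val_inj.
by apply/esym/eqP; rewrite h1 (leq_trans (inter_le i)).
Qed.

Lemma shp_ext : shp t = xi.
Proof.
have /sstP[h1 _ _] := t_sst; apply/ffunP => i; apply: val_inj; rewrite /= shpE.
have xm : (xi i <= m)%N by rewrite -ltnS ltn_ord.
rewrite -[RHS](card_ord_lt xm).
by apply: eq_card => j; rewrite !inE h1 -ltnNge.
Qed.

Lemma wgt_ext : wgt (ext t) = (\prod_i w n ^+ (kap i - xi i)) * wgt t.
Proof.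
have /sstP[h1 _ _] := t_sst; rewrite /wgt.
have pr (F : 'I_l * 'I_m -> R) : \prod_c F c = \prod_i \prod_j F (i, j).
  by rewrite pair_big; apply: eq_bigr => -[].
rewrite !pr -big_split; apply: eq_bigr => i _ /=.
have -> : w n ^+ (kap i - xi i) = \prod_(j < m) (if (xi i <= j < kap i)%N then w n else 1).
  have kim : (kap i <= m)%N by rewrite -ltnS ltn_ord.
  rewrite -big_mkcond -(big_mkord (fun j => (xi i <= j < kap i)%N) (fun=> w n)).
  rewrite -prodr_const_nat [LHS](big_nat_widenl _ 0) // [LHS](big_nat_widen _ _ m) //.
rewrite -big_split; apply: eq_bigr => j _ /=; rewrite ffunE /=.
have := h1 i j; case tij: (t (i, j)) => [x|] /= h.
  have xj : (j < xi i)%N by rewrite ltnNge -h.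
  by rewrite (leq_trans xj (inter_le i)) leqNgt xj mul1r.
by rewrite -h /=; case: ltnP; rewrite mulr1.
Qed.

End Extended.

(** Tableaux are sorted by the shape of their entries below [n]; the cells outside it contribute
    powers of [w n]. This is the recursion that [jt_cons] proves for the determinant. *)
Lemma SS_cons : SS n.+1 (fun i => kap i) =
  \sum_(xi | inter xi kap) (\prod_i w n ^+ (kap i - xi i)) * SS n (fun i => xi i).
Proof.
rewrite /SS (reindex_onto ext res); last by move=> t; apply: ext_res.
rewrite (partition_big shp (fun xi => inter xi kap)) /=; last first.
  by move=> t /andP[ts /eqP tr]; apply: shp_inter.
apply: eq_bigr => xi xik; rewrite mulr_sumr; apply: eq_big => t.
  apply/andP/idP => [[/andP[ts /eqP tr] /eqP <-]|ts]; first exact: shp_sst.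
  by rewrite (ext_sst xik ts) (res_ext xik ts) (shp_ext ts) !eqxx.
by case/andP=> /andP[ts /eqP tr] /eqP <-; apply: wgt_ext; [apply: shp_inter|apply: shp_sst].
Qed.

End Branch.

Lemma SS_nil (kap : {ffun 'I_l -> 'I_m.+1}) :
  SS 0 (fun i => kap i) = [forall i, kap i == 0%N :> nat]%:R.
Proof.
have none (t : fil 0) c : t c = None by case: (t c) => // -[].
rewrite /SS; have [/forallP k0|] := boolP [forall i, kap i == 0%N :> nat].
  rewrite (big_pred1 [ffun=> None]) => [|t].
    by rewrite /wgt big1 // => c _; rewrite ffunE.
  rewrite /=; apply/sstP/eqP => [_|->].
    by apply/ffunP => c; rewrite ffunE none.
  by split=> [i j|i j j' x y _|i i' j x y _]; rewrite !ffunE // (eqP (k0 i)) eqxx.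
rewrite negb_forall => /existsP[i ki]; rewrite big1 // => t /sstP[h1 _ _].
have m0 : (0 < m)%N by rewrite -ltnS (leq_ltn_trans _ (ltn_ord (kap i))) // lt0n.
by have := h1 i (Ordinal m0); rewrite none eqxx leqn0 (negPf ki).
Qed.

Theorem SS_jt n (kap : {ffun 'I_l -> 'I_m.+1}) :
  (forall i j : 'I_l, (i <= j)%N -> (kap j <= kap i)%N) ->
  SS n (fun i => kap i) = jt (ws n) (fun i => kap i).
Proof.
elim: n kap => [|n IH] kap kdec; first by rewrite SS_nil jt_nil.
rewrite SS_cons // jt_cons //; apply: eq_bigr => xi xik; rewrite IH // => i j.
rewrite leq_eqVlt => /orP[/eqP/val_inj->//|ij].
by apply: leq_trans (inter_next kdec xik ij); apply: inter_le xik _.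
Qed.

End Tableaux.

Definition jtn (R : comNzRingType) l (s : seq R) (k : nat -> nat) : R :=
  jt (l := l) s (fun i => k i).

Section JtPad.
Variable R : comNzRingType.
Implicit Types (s : seq R) (k : nat -> nat).

(** Enlarging the determinant by one row and column shifts both indices of [hh] by one, without
    effect on the minor. *)
Lemma hhS s a b : hh s a.+1 b.+1 = hh s a b.
Proof. by rewrite /hh ltnS subSS. Qed.

Lemma jtnS l s k : k l = 0%N -> jtn l.+1 s k = jtn l s k.
Proof.
move=> kl; rewrite /jtn /jt (expand_det_row _ ord_max) (bigD1 ord_max) //=.
have h0 (j : 'I_l.+1) : hh s (k l + (l.+1 - 1 - l)) (l.+1 - 1 - j) = (j == ord_max)%:R.
  rewrite kl /hh add0n subn1 /= subnn leqn0 subn_eq0 -val_eqE /= hs0.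
  by have jl := ltn_ord j; case: (leqP l j) => h1; case: ((j : nat) =P l) => h2 //; exfalso; lia.
rewrite [X in _ + X]big1 ?addr0 => [|j /negPf jm]; last by rewrite mxE h0 jm mul0r.
rewrite mxE h0 eqxx mul1r /cofactor.
rewrite addnn -signr_odd odd_double expr0 mul1r; congr (\det _).
apply/matrixP => i j; rewrite !mxE !lift_max /= -[RHS]hhS.
have /= il := ltn_ord i; have /= jl := ltn_ord j; congr (hh s _ _); lia.
Qed.

Lemma jtn_pad l l' s k : (l <= l')%N -> (forall i, (l <= i)%N -> k i = 0%N) ->
  jtn l' s k = jtn l s k.
Proof.
move=> ll k0; rewrite -(subnKC ll); elim: (l' - l)%N => [|e IH]; first by rewrite addn0.
by rewrite addnS jtnS ?k0 ?leq_addr.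
Qed.

Lemma eq_jtn l s s' k : (forall c, hs s c = hs s' c) -> jtn l s k = jtn l s' k.
Proof.
move=> e; rewrite /jtn /jt; congr (\det _); apply/matrixP => i j; rewrite !mxE /hh.
by rewrite e.
Qed.

End JtPad.

Lemma jtn_morph (R S : comNzRingType) (f : {rmorphism R -> S}) l s k :
  f (jtn l s k) = jtn l (map f s) k.
Proof.
rewrite /jtn /jt -det_map_mx; congr (\det _); apply/matrixP => i j; rewrite !mxE /hh.
by case: ifP => _; rewrite ?rmorph0 // hs_morph.
Qed.

Lemma partition_nth la i j : is_partition la -> (i <= j)%N -> (nth 0 la j <= nth 0 la i)%N.
Proof.
move=> pla ij; have [js|js] := ltnP j (size la); last by rewrite nth_default.
have tr : transitive geq by move=> y x z /= xy yz; apply: leq_trans yz xy.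
by apply: (sorted_leq_nth tr leqnn 0%N pla) => //; rewrite inE // (leq_ltn_trans ij).
Qed.

(** Stated for the image under a morphism [f] so that the identity, the substitution of monomials in
    [plethysm] and the killing of a variable are all instances. *)
Theorem schur_jt (R : comNzRingType) N la l (S : comNzRingType)
    (f : {rmorphism {mpoly R[N]} -> S}) : is_partition la -> (size la <= l)%N ->
  f (schur R N la) = jtn l [seq f 'X_i | i <- enum 'I_N] (nth 0%N la).
Proof.
move=> pla sl; rewrite (jtn_pad (l := size la)) //; last first.
  by move=> i; apply: nth_default.
have hd i : (nth 0 la i < (head 0 la).+1)%N.
  by rewrite ltnS -nth0; apply: partition_nth.
pose w x := if insub x is Some i then f 'X_(i : 'I_N) else 0.
pose kap : {ffun 'I_(size la) -> 'I_(head 0 la).+1} := [ffun i : 'I_(size la) => Ordinal (hd i)].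
have kapE i : kap i = nth 0 la i :> nat by rewrite ffunE.
have -> : f (schur R N la) = SS (head 0%N la) w N (fun i : 'I_(size la) => nth 0%N la i).
  rewrite /schur rmorph_sum; apply: eq_bigr => t _; rewrite rmorph_prod; apply: eq_bigr => c _.
  by case: (t c) => [k|]; rewrite ?rmorph1 // /w valK.
have -> : SS (head 0%N la) w N (fun i : 'I_(size la) => nth 0%N la i) =
    SS (head 0%N la) w N (fun i => kap i).
  apply: eq_bigl => t; rewrite /sst; congr (_ && _).
  by apply: eq_forallb => c; rewrite kapE.
rewrite SS_jt; last by move=> i j ij; rewrite !kapE partition_nth.
rewrite /jtn /jt; congr (\det _); apply/matrixP => i j; rewrite !mxE kapE /hh; case: ifP => // _.
apply: hs_perm.
have -> : [seq f 'X_i | i <- enum 'I_N] = [seq w x | x <- iota 0 N].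
  rewrite -val_enum_ord -map_comp; apply: eq_map => x /=; by rewrite /w valK.
elim: (N) => // n IH; rewrite -addn1 iotaD map_cat /= addn1 /=.
by rewrite perm_sym perm_catC /= perm_cons perm_sym.
Qed.

(** * The tensor module W (x) C^l *)

Section VandermondeExpand.
Variables (R : comNzRingType) (n : nat).

Definition vand : {mpoly R[n]} := \prod_(i < n) \prod_(j < n | (i < j)%N) ('X_i - 'X_j).

Definition dperm (sg : 'S_n) : 'X_{1..n} := [multinom (n - 1 - sg i)%N | i < n].

(** The exponents of [Vandermonde] increase; reversing variables and exponents by the same
    permutation costs its sign twice. *)
Lemma vand_det : vand = \det (\matrix_(i < n, j < n) ('X_i : {mpoly R[n]}) ^+ (n - 1 - j)).
Proof.
pose B := \matrix_(i < n, j < n) ('X_i : {mpoly R[n]}) ^+ (n - 1 - j).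
pose s : 'S_n := perm rev_ord_inj.
have sE i : s i = rev_ord i by rewrite permE.
transitivity (\det (Vandermonde n (\row_j ('X_(rev_ord j) : {mpoly R[n]})))).
  rewrite det_Vandermonde /vand.
  rewrite !pair_big_dep /=.
  pose h (p : 'I_n * 'I_n) := (rev_ord p.2, rev_ord p.1).
  have hI : involutive h by move=> [i j]; rewrite /h /= !rev_ordK.
  rewrite (reindex_inj (inv_inj hI)) /=; apply: eq_big => [[i j]|[i j] _] /=; last by rewrite !mxE.
  by have := ltn_ord i; have := ltn_ord j; lia.
rewrite -det_tr.
have -> : (Vandermonde n (\row_j ('X_(rev_ord j) : {mpoly R[n]})))^T = row_perm s (col_perm s B).
  apply/matrixP => i j; rewrite !mxE !sE; congr (_ ^+ _).
  by have := ltn_ord j; rewrite /=; lia.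
by rewrite row_permE col_permE !det_mulmx !det_perm mulrCA -signr_addb odd_permV addbb mulr1.
Qed.

Lemma vand_expand : vand = \sum_(sg : 'S_n) (-1) ^+ sg * 'X_[dperm sg].
Proof.
rewrite vand_det; apply: eq_bigr => sg _; congr (_ * _).
by rewrite mpolyXE_id; apply: eq_bigr => i _; rewrite mxE mnmE.
Qed.

End VandermondeExpand.

Section JoinedVariables.
Variables (N l : nat).

Definition comb (w : 'X_{1..N}) (u : 'X_{1..l}) : 'X_{1..N + l} :=
  [multinom match split i with inl a => w a | inr c => u c end | i < N + l].

Definition lpart (m : 'X_{1..N + l}) : 'X_{1..N} := [multinom m (lshift l i) | i < N].
Definition rpart (m : 'X_{1..N + l}) : 'X_{1..l} := [multinom m (rshift N i) | i < l].

Lemma comb_l w u a : comb w u (lshift l a) = w a.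
Proof. by rewrite mnmE (unsplitK (inl a)). Qed.

Lemma comb_r w u c : comb w u (rshift N c) = u c.
Proof. by rewrite mnmE (unsplitK (inr c)). Qed.

Lemma combP (m m' : 'X_{1..N + l}) : (forall a, m (lshift l a) = m' (lshift l a)) ->
  (forall c, m (rshift N c) = m' (rshift N c)) -> m = m'.
Proof. by move=> hl hr; apply/mnmP => i; case: (split_ordP i) => k ->. Qed.

Lemma comb_parts m : comb (lpart m) (rpart m) = m.
Proof. by apply: combP => i; rewrite ?comb_l ?comb_r mnmE. Qed.

Lemma lpart_comb w u : lpart (comb w u) = w.
Proof. by apply/mnmP => i; rewrite mnmE comb_l. Qed.

Lemma rpart_comb w u : rpart (comb w u) = u.
Proof. by apply/mnmP => i; rewrite mnmE comb_r. Qed.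

Lemma lpartD m m' : lpart (m + m') = (lpart m + lpart m')%MM.
Proof. by apply/mnmP => i; rewrite mnmE !mnmDE ![lpart _ _]mnmE. Qed.

Lemma rpartD m m' : rpart (m + m') = (rpart m + rpart m')%MM.
Proof. by apply/mnmP => i; rewrite mnmE !mnmDE ![rpart _ _]mnmE. Qed.

Lemma combD w u w' u' : (comb w u + comb w' u')%MM = comb (w + w') (u + u').
Proof. by apply: combP => i; rewrite mnmDE ?comb_l ?comb_r mnmDE. Qed.

Definition emx : {mpoly rat[N]} -> {mpoly rat[N + l]} :=
  mmap (@mpolyC _ rat) (fun k => 'X_(lshift l k)).
HB.instance Definition _ := GRing.RMorphism.copy emx
  (mmap (@mpolyC _ rat) (fun k => 'X_(lshift l k))).

Lemma lshiftU a : U_(lshift l a)%MM = comb U_(a) 0.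
Proof.
apply: combP => i; rewrite ?comb_l ?comb_r ?mnm0E mnm1E ?mnm1E.
  by rewrite eq_lshift.
by rewrite eq_lrshift.
Qed.

Lemma rshiftU c : U_(rshift N c)%MM = comb 0 U_(c).
Proof.
apply: combP => i; rewrite ?comb_l ?comb_r ?mnm0E mnm1E ?mnm1E.
  by rewrite eq_rlshift.
by rewrite eq_rshift.
Qed.

Lemma emxX m : emx 'X_[m] = 'X_[comb m 0].
Proof.
rewrite /emx mmapX /mmap1 mpolyXE_id big_split_ord /= [X in _ = _ * X]big1 ?mulr1 => [|i _].
  by apply: eq_bigr => i _; rewrite comb_l.
by rewrite comb_r mnm0E expr0.
Qed.

Lemma emxZ c p : emx (c *: p) = c *: emx p.
Proof. by rewrite -!mul_mpolyC rmorphM /= /emx mmapC. Qed.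

(** The coefficient of the monomial [u] in the last [l] variables y, as a polynomial in the first
    [N]. *)
Definition cy (u : 'X_{1..l}) (p : {mpoly rat[N + l]}) : {mpoly rat[N]} :=
  \sum_(m <- msupp p | rpart m == u) p@_m *: 'X_[lpart m].

Lemma mcoeff_cy u p w : (cy u p)@_w = p@_(comb w u).
Proof.
rewrite /cy raddf_sum /= (eq_bigr (fun m => p@_m * (lpart m == w)%:R)); last first.
  by move=> m _; rewrite mcoeffZ mcoeffX.
have [mp|mp] := boolP (comb w u \in msupp p); last first.
  rewrite (memN_msupp_eq0 mp) big_seq_cond big1 // => m /andP[ms /eqP mu].
  case: eqP => [mw|_]; last by rewrite mulr0.
  by rewrite -mw -mu comb_parts ms in mp.
rewrite big_mkcond (bigD1_seq (comb w u)) //= rpart_comb lpart_comb !eqxx mulr1.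
rewrite big1 ?addr0 // => m mc; case: eqP => // mu; case: eqP => [mw|_]; last by rewrite mulr0.
by rewrite -mw -mu comb_parts eqxx in mc.
Qed.

Lemma cyD u p q : cy u (p + q) = cy u p + cy u q.
Proof. by apply/mpolyP => w; rewrite mcoeffD !mcoeff_cy mcoeffD. Qed.

Lemma cy_sum u (I : Type) (s : seq I) P (f : I -> {mpoly rat[N + l]}) :
  cy u (\sum_(x <- s | P x) f x) = \sum_(x <- s | P x) cy u (f x).
Proof.
by apply: (big_morph _ (cyD u)); apply/mpolyP => w; rewrite mcoeff_cy !mcoeff0.
Qed.

Lemma cyZ u c p : cy u (c *: p) = c *: cy u p.
Proof. by apply/mpolyP => w; rewrite mcoeffZ !mcoeff_cy mcoeffZ. Qed.

Lemma cyX u m : cy u 'X_[m] = if rpart m == u then 'X_[lpart m] else 0.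
Proof.
apply/mpolyP => w; rewrite mcoeff_cy mcoeffX; case: ifP => [/eqP <-|h].
  rewrite mcoeffX; congr (nat_of_bool _)%:R; apply/eqP/eqP => [->|<-].
    by rewrite lpart_comb.
  by rewrite comb_parts.
rewrite mcoeff0; case: eqP => // e; by rewrite e rpart_comb eqxx in h.
Qed.

Lemma cy_emx u f p : cy u (emx f * p) = f * cy u p.
Proof.
rewrite (mpolyE f) rmorph_sum /= !mulr_suml cy_sum; apply: eq_bigr => a _.
rewrite emxZ -!scalerAl cyZ; congr (_ *: _); rewrite emxX.
rewrite (mpolyE p) mulr_sumr !cy_sum mulr_sumr; apply: eq_bigr => m _.
rewrite -scalerAr !cyZ -scalerAr; congr (_ *: _); rewrite -mpolyXD !cyX.
rewrite rpartD lpartD rpart_comb lpart_comb add0m.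
by case: ifP => _; rewrite ?mulr0 // -mpolyXD.
Qed.

Lemma cy_mulY u k p : cy u ('X_[comb 0 k] * p) =
  if (k <= u)%MM then cy (u - k)%MM p else 0.
Proof.
rewrite {1}(mpolyE p) mulr_sumr cy_sum.
have -> : (if (k <= u)%MM then cy (u - k)%MM p else 0) =
   \sum_(m <- msupp p) (if (k <= u)%MM then cy (u - k)%MM (p@_m *: 'X_[m]) else 0).
  case: ifP => _; last by rewrite big1.
  by rewrite {1}(mpolyE p) cy_sum.
apply: eq_bigr => m _; rewrite -scalerAr !cyZ -mpolyXD !cyX.
rewrite rpartD lpartD rpart_comb lpart_comb add0m.
have [ku|ku] := boolP (k <= u)%MM.
  congr (_ *: _); rewrite -{1}(submK ku) addmC eqm_add2r //.
rewrite ifN ?scaler0 //; apply: contra ku => /eqP <-; exact: lem_addr.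
Qed.

End JoinedVariables.

Section TwoBlocks.
Variables (N l : nat) (c : bool).

(* For c = true the Levi subalgebra is gl_N x gl_l, for c = false it is the
   product of the diagonal torus of gl_N and gl_l. *)
Definition bc (i : 'I_(N + l)) : nat :=
  match split i with inl a => if c then 0%N else a.+2 | inr _ => 1%N end.

Lemma bc_l a : bc (lshift l a) = if c then 0%N else a.+2.
Proof. by rewrite /bc (unsplitK (inl a)). Qed.

Lemma bc_r a : bc (rshift N a) = 1%N.
Proof. by rewrite /bc (unsplitK (inr a)). Qed.

Lemma bc_lr a d : bc (lshift l a) == bc (rshift N d) = false.
Proof. by rewrite bc_l bc_r; case: c. Qed.

Lemma bc_ll a a' : bc (lshift l a) == bc (lshift l a') = c || (a == a').
Proof. by rewrite !bc_l; case: c. Qed.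

Definition emy : {mpoly rat[l]} -> {mpoly rat[N + l]} :=
  mmap (@mpolyC _ rat) (fun k => 'X_(rshift N k)).
HB.instance Definition _ := GRing.RMorphism.copy emy
  (mmap (@mpolyC _ rat) (fun k => 'X_(rshift N k))).

Lemma emyX m : emy 'X_[m] = 'X_[comb 0 m].
Proof.
rewrite /emy mmapX /mmap1 mpolyXE_id big_split_ord /= [X in _ = X * _]big1 ?mul1r => [|i _].
  by apply: eq_bigr => i _; rewrite comb_r.
by rewrite comb_l mnm0E expr0.
Qed.

Lemma emyU k : emy 'X_k = 'X_(rshift N k).
Proof. by rewrite emyX rshiftU. Qed.

Lemma emxU k : emx l 'X_k = 'X_(lshift l k) :> {mpoly rat[N + l]}.
Proof. by rewrite emxX lshiftU. Qed.

Definition xvand : {mpoly rat[N]} := if c then vand rat N else 1.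

Lemma vdm_bc : vdm bc = emx l xvand * emy (vand rat l).
Proof.
rewrite /vdm (eq_bigl (fun p => xpredT p.1 && posroot bc (p.1, p.2))); last by case.
rewrite -(pair_big_dep xpredT (fun i j => posroot bc (i, j))
  (fun i j => 'X_i - 'X_j : {mpoly rat[N + l]})) /= big_split_ord /=.
congr (_ * _).
  rewrite /xvand; case cE: c; last first.
    rewrite rmorph1 big1 // => a _; rewrite big1 // => j; rewrite /posroot /=.
    case: (split_ordP j) => k ->; last by rewrite bc_lr andbF.
    by rewrite bc_ll cE /= => /andP[ak /eqP e]; rewrite e ltnn in ak.
  rewrite /vand rmorph_prod; apply: eq_bigr => a _; rewrite rmorph_prod big_split_ord /=.
  rewrite [X in _ * X]big_pred0 ?mulr1 => [|k]; last by rewrite /posroot /= bc_lr andbF.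
  apply: eq_big => [k|k _]; first by rewrite /posroot /= bc_ll cE andbT.
  by rewrite rmorphB /= !emxU.
rewrite /vand rmorph_prod; apply: eq_bigr => a _; rewrite rmorph_prod big_split_ord /=.
rewrite [X in X * _]big_pred0 ?mul1r => [|k]; last first.
  by rewrite /posroot /= eq_sym bc_lr andbF.
apply: eq_big => [k|k _]; last by rewrite rmorphB /= !emyU.
by rewrite /posroot /= !bc_r eqxx andbT ltn_add2l.
Qed.

Definition xdelta : 'X_{1..N} := if c then dperm 1%g else 0%MM.
Definition ydelta : 'X_{1..l} := dperm 1%g.

Lemma sum_gt n (a : 'I_n) : (\sum_(j < n | (a < j)%N) 1 = n - 1 - a)%N.
Proof.
rewrite -(big_mkord (fun j => (a < j)%N) (fun=> 1%N)) -(big_nat_widenl _ _ _ xpredT) //.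
by rewrite sum_nat_const_nat muln1; have := ltn_ord a; lia.
Qed.

Lemma rdelta_bc : rdelta bc = comb xdelta ydelta.
Proof.
apply: combP => i; rewrite mnmE big_split_ord /=.
  rewrite [X in (_ + X)%N]big_pred0 ?addn0 => [|k]; last by rewrite bc_lr andbF.
  rewrite comb_l /xdelta; case cE: c.
    rewrite mnmE perm1 -sum_gt; apply: eq_bigl => k.
    by rewrite bc_ll cE andbT.
  rewrite mnm0E big_pred0 // => k; rewrite bc_ll cE /=.
  by apply/negP => /andP[ik /eqP e]; rewrite e ltnn in ik.
rewrite [X in (X + _)%N]big_pred0 ?add0n => [|k]; last by rewrite eq_sym bc_lr andbF.
rewrite comb_r mnmE perm1 -sum_gt; apply: eq_bigl => k.
by rewrite !bc_r eqxx andbT ltn_add2l.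
Qed.

Lemma nsim_l a : nsim bc (lshift l a) = if c then (N - 1)%N else 0%N.
Proof.
rewrite /nsim big_split_ord /= [X in (_ + X)%N]big_pred0 ?addn0 => [|k]; last first.
  by rewrite eq_sym bc_lr.
case cE: c; last first.
  rewrite big_pred0 // => k; rewrite bc_ll cE eq_lshift /=.
  by case: eqP.
rewrite (eq_bigl (fun k => k != a)) => [|k]; last by rewrite bc_ll cE eq_lshift.
by rewrite sum1_card cardC1 card_ord subn1.
Qed.

Lemma nsim_r a : nsim bc (rshift N a) = (l - 1)%N.
Proof.
rewrite /nsim big_split_ord /= [X in (X + _)%N]big_pred0 ?add0n => [|k]; last first.
  by rewrite bc_lr.
rewrite (eq_bigl (fun k => k != a)) => [|k]; last by rewrite !bc_r eqxx eq_rshift.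
by rewrite sum1_card cardC1 card_ord subn1.
Qed.

Lemma msupp_vand n t : t \in msupp (vand rat n) -> exists sg, t = dperm sg.
Proof.
rewrite vand_expand mcoeff_msupp raddf_sum /= => h.
have [sg] : exists sg : 'S_n, ((-1) ^+ sg * 'X_[dperm sg] : {mpoly rat[n]})@_t != 0.
  apply/existsP; apply: contraNT h; rewrite negb_exists => /forallP h.
  by rewrite big1 // => s _; apply/eqP; rewrite -[_ == _]negbK.
rewrite -signr_odd; case: (odd sg); rewrite ?expr0 ?expr1 ?mulN1r ?mul1r ?mcoeffN mcoeffX.
  by case: (dperm sg =P t) => [<- _|_]; [exists sg|rewrite oppr0 eqxx].
by case: (dperm sg =P t) => [<- _|_]; [exists sg|rewrite eqxx].
Qed.

(** Exponents in a Vandermonde product arise from [rdelta] by permutations inside the blocks, and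
    [nsim] is constant on each block. *)
Lemma vdm_qf_bc t : t \in msupp (vdm bc) -> qf bc t = qf bc (rdelta bc).
Proof.
have dsum n (sg : 'S_n) (F : nat -> rat) : \sum_(i < n) F (dperm sg i) = \sum_(i < n) F (dperm 1%g i).
  rewrite (reindex_inj (@perm_inj _ sg^-1%g)); apply: eq_bigr => i _.
  by rewrite !mnmE permKV perm1.
rewrite vdm_bc rdelta_bc => /msuppM_le/allpairsP [[t1 t2] /= [h1 h2 ->]].
have [s2 ->] : exists s2, t2 = comb 0 (dperm s2).
  move: h2; rewrite mcoeff_msupp (mpolyE (vand rat l)) rmorph_sum raddf_sum /= => h.
  have [k kv kt] : exists2 k, k \in msupp (vand rat l) & t2 = comb 0 k.
    apply: NNPP => nk; move: h; rewrite big_seq big1 ?eqxx // => k kv.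
    rewrite -mul_mpolyC rmorphM /= emyX /emy mmapC mcoeffCM mcoeffX.
    by case: (comb 0 k =P t2) => [e|_]; [case: nk; exists k|rewrite mulr0].
  by have [s2 ks] := msupp_vand kv; exists s2; rewrite kt ks.
have [w1 [-> w1E]] : exists w1, t1 = comb w1 0 /\
    forall F : nat -> rat, \sum_(i < N) F (w1 i) = \sum_(i < N) F (xdelta i).
  move: h1; rewrite mcoeff_msupp (mpolyE xvand) rmorph_sum raddf_sum /= => h.
  have [k kv kt] : exists2 k, k \in msupp xvand & t1 = comb k 0.
    apply: NNPP => nk; move: h; rewrite big_seq big1 ?eqxx // => k kv.
    rewrite emxZ emxX mcoeffZ mcoeffX.
    by case: (comb k 0 =P t1) => [e|_]; [case: nk; exists k|rewrite mulr0].
  exists k; split=> // F; move: kv; rewrite /xvand /xdelta; case: c.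
    by move=> /msupp_vand [s1 ->]; apply: dsum.
  by rewrite -mpolyX0 => /mem_msuppXP <-.
rewrite combD addm0 add0m /qf !big_split_ord /=; congr (_ + _).
  under eq_bigr do rewrite comb_l nsim_l; under [RHS]eq_bigr do rewrite comb_l nsim_l.
  exact: (w1E (fun x => x%:R * (x%:R - (if c then (N - 1)%N else 0%N)%:R))).
under eq_bigr do rewrite comb_r nsim_r; under [RHS]eq_bigr do rewrite comb_r nsim_r.
exact: (dsum _ s2 (fun x => x%:R * (x%:R - (l - 1)%N%:R))).
Qed.

End TwoBlocks.

Lemma gmod_finer r (b b' : 'I_r -> nat) n E wt d :
  (forall i j, b' i = b' j -> b i = b j) -> @gmod r b n E wt d -> gmod b' E wt d.
Proof.
move=> bb [h1 h2 h3 h4]; split=> //.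
  by move=> i j k l' /bb bij /bb bkl; apply: h1.
by move=> i j k l' /bb bij; apply: h3.
Qed.

Section Tensor.
Variables (N l n : nat).
Variables (EW : 'I_N -> 'I_N -> 'M[rat]_n) (wtW : 'I_n -> 'X_{1..N}) (dW : 'I_n -> rat).
Hypothesis MW : gmod (fun=> 0%N) EW wtW dW.

Local Notation "A *t B" := (tensmx A B) (at level 40, left associativity).

Definition tE (i j : 'I_(N + l)) : 'M[rat]_(n * l) :=
  match split i, split j with
  | inl a, inl a' => EW a a' *t 1%:M
  | inr k, inr k' => 1%:M *t delta_mx k' k
  | _, _ => 0
  end.

Definition twt (v : 'I_(n * l)) : 'X_{1..N + l} :=
  comb (wtW (mxtens_unindex v).1) U_((mxtens_unindex v).2).

Definition td (v : 'I_(n * l)) : rat := dW (mxtens_unindex v).1.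

Lemma tE_ll a a' : tE (lshift l a) (lshift l a') = EW a a' *t 1%:M.
Proof. by rewrite /tE (unsplitK (inl a)) (unsplitK (inl a')). Qed.

Lemma tE_rr k k' : tE (rshift N k) (rshift N k') = 1%:M *t delta_mx k' k.
Proof. by rewrite /tE (unsplitK (inr k)) (unsplitK (inr k')). Qed.

Lemma gmod_tensor : gmod (@bc N l true) tE twt td.
Proof.
split.
- move=> i j p q; case: (split_ordP i) => i' ->; case: (split_ordP j) => j' ->;
    case: (split_ordP p) => p' ->; case: (split_ordP q) => q' ->;
    rewrite ?bc_l ?bc_r // => _ _; rewrite ?tE_ll ?tE_rr !tensmx_mul ?mulmx1 ?mul1mx.
  + have -> : (EW p' q' *m EW i' j') *t 1%:M - (EW i' j' *m EW p' q') *t 1%:M =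
      (EW p' q' *m EW i' j' - EW i' j' *m EW p' q') *t (1%:M : 'M[rat]_l).
      by apply/matrixP => x y; rewrite !mxE mulrBl.
    rewrite (gmod_comm MW) // !eq_lshift.
    by apply/matrixP => x y; rewrite !mxE mulrBl !mulrA.
  + by rewrite subrr eq_lrshift eq_rlshift !scale0r subrr.
  + by rewrite subrr eq_lrshift eq_rlshift !scale0r subrr.
  + rewrite !eq_rshift !mul_delta_mx_cond [p' == j']eq_sym [i' == q']eq_sym.
    apply/matrixP => x y; rewrite !mxE.
    by case: (j' == p'); case: (q' == i'); rewrite ?mulr1n ?mulr0n !mxE ?mulr0 ?mul0r ?mul1r ?subr0.
- move=> i v v'; rewrite -[v]mxtens_unindexK -[v']mxtens_unindexK.
  case: (mxtens_unindex v) => k j; case: (mxtens_unindex v') => k' j'.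
  rewrite /twt mxtens_indexK /= (inj_eq (can_inj (@mxtens_indexK _ _))) xpair_eqE.
  case: (split_ordP i) => a ->.
    rewrite tE_ll tensmxE (gmod_diag MW) comb_l mxE.
    by case: (k == k'); case: (j == j'); rewrite ?mulr1n ?mulr0n ?mulr1 ?mulr0 ?mul0r.
  rewrite tE_rr tensmxE comb_r !mxE mnm1E.
  case: (k == k'); rewrite ?mul0r //= mul1r; case: (eqVneq j a) => [->|ja] /=.
    by rewrite eq_sym; case: (a == j'); rewrite ?mulr1n ?mulr0n.
  by rewrite mul0rn.
- move=> i j v v'; rewrite -[v]mxtens_unindexK -[v']mxtens_unindexK.
  case: (mxtens_unindex v) => k y; case: (mxtens_unindex v') => k' y'.
  rewrite /td !mxtens_indexK /=.
  case: (split_ordP i) => i' ->; case: (split_ordP j) => j' ->; rewrite ?bc_l ?bc_r // => _.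
    rewrite !tE_ll !tensmxE !mxE (eq_sym y') mulrAC (gmod_adj MW) // mulrA; ring.
  rewrite !tE_rr !tensmxE !mxE (eq_sym k'); case: eqP => [->|_]; rewrite ?mul0r ?mulr0 //.
  by rewrite !mul1r mulrC andbC.
- by move=> v; apply: (gmod_gt0 MW).
Qed.

Lemma rpart_mwt m : mdeg (rpart (mwt twt m)) = mdeg m.
Proof.
rewrite !mdegE (eq_bigr (fun i => \sum_v (twt v (rshift N i) * m v)%N)) => [|i _]; last first.
  by rewrite mnmE mwtE.
rewrite exchange_big; apply: eq_bigr => v _ /=; rewrite -big_distrl /=.
rewrite (bigD1 (mxtens_unindex v).2) //= big1 ?addn0; last first.
  by move=> i /negPf iv; rewrite comb_r mnm1E eq_sym iv.
by rewrite comb_r mnm1E eqxx mul1n.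
Qed.

Definition wtl : seq {mpoly rat[N]} := [seq 'X_[wtW k] | k <- enum 'I_n].

Section CharPoly.
Variable K : nat.

Definition pch : {mpoly rat[N + l]} := \sum_s 'X_[polw (K := K) twt s].

Definition bigP : {mpoly rat[N + l]} := \prod_v \sum_(p < K.+1) 'X_[twt v] ^+ p.

(** Each basis vector has degree one in y. In y-degree at most [K], neither the bound on the total
    degree in [pch] nor the bound on single exponents in [bigP] excludes anything. *)
Lemma pch_bigP w u : (mdeg u <= K)%N -> pch@_(comb w u) = bigP@_(comb w u).
Proof.
move=> uK; pose fm (f : {ffun 'I_(n * l) -> 'I_K.+1}) : 'X_{1..n * l} := [multinom (f v : nat) | v < n * l].
have -> : bigP = \sum_(f : {ffun 'I_(n * l) -> 'I_K.+1}) 'X_[mwt twt (fm f)].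
  rewrite /bigP bigA_distr_bigA; apply: eq_bigr => f _ /=.
  rewrite /mwt -mprodXE; apply: eq_bigr => v _.
  by rewrite mpolyXn mnmE.
rewrite /pch !raddf_sum /=; under eq_bigr do rewrite mcoeffX.
under [RHS]eq_bigr do rewrite mcoeffX.
have cnt (I : finType) (P : pred I) : \sum_i (P i)%:R = \sum_(i | P i) 1 :> rat.
  by rewrite [RHS]big_mkcond; apply: eq_bigr => x _; case: (P x).
rewrite !cnt.
pose h (s : 'I_#|{: 'X_{1..(n * l) < K.+1}}|) : {ffun 'I_(n * l) -> 'I_K.+1} := [ffun v => inord (bm s v)].
pose h' (f : {ffun 'I_(n * l) -> 'I_K.+1}) : 'I_#|{: 'X_{1..(n * l) < K.+1}}| :=
  enum_rank (insubd (@bm0 (n * l)%N K) (fm f)).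
have fmh s : fm (h s) = bm s.
  apply/mnmP => v; rewrite mnmE ffunE inordK // ltnS.
  apply: leq_trans (bm_deg s); rewrite mdegE (bigD1 v) //=; exact: leq_addr.
rewrite [RHS](reindex_onto h h') => [|f /eqP fe].
  apply: eq_bigl => s; rewrite fmh /h' fmh -/(polw _ _).
  rewrite (_ : insubd _ _ = enum_val s) ?enum_valK ?eqxx ?andbT //.
  by apply: val_inj; rewrite insubdK //; apply: bmdeg.
have fK : (mdeg (fm f) < K.+1)%N by rewrite -rpart_mwt fe rpart_comb.
apply/ffunP => v; rewrite ffunE /h' /bm enum_rankK.
by rewrite -[bmnm _]/(val _) insubdK //; rewrite mnmE inord_val.
Qed.

Lemma bigP_prod : exists G : nat -> {mpoly rat[N]}, (forall k, (k <= K)%N -> G k = hs wtl k) /\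
  exists m, (K < m)%N /\
    bigP = \prod_(j < l) \sum_(k < m) emx l (G k) * 'X_[comb 0 U_(j)] ^+ k.
Proof.
pose G : {poly {mpoly rat[N]}} := \prod_(a <- wtl) \poly_(p < K.+1) a ^+ p.
exists (fun k => G`_k); split=> [k kK|]; first by rewrite hs_coef.
pose m := (size (map_poly (emx l) G) + K).+1; exists m; split; first by rewrite ltnS leq_addl.
transitivity (\prod_(j < l) (map_poly (emx l) G).['X_[comb 0 U_(j)]]); last first.
  apply: eq_bigr => j _; rewrite (@horner_coef_wide _ m) ?leqW ?leq_addr //.
  by apply: eq_bigr => k _; rewrite coef_map.
rewrite /bigP; transitivity (\prod_(i < n) \prod_(j < l) \sum_(p < K.+1)
    ('X_[comb (wtW i) U_(j)] : {mpoly rat[N + l]}) ^+ p).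
  rewrite pair_big (reindex (@mxtens_index n l)) /=; last first.
    by exists (@mxtens_unindex n l) => x _; rewrite ?mxtens_indexK ?mxtens_unindexK.
  by apply: eq_bigr => -[i j] _; rewrite /twt mxtens_indexK.
rewrite exchange_big; apply: eq_bigr => j _ /=.
rewrite /G rmorph_prod horner_prod /wtl big_map big_enum /=; apply: eq_bigr => i _.
rewrite poly_def rmorph_sum horner_sum; apply: eq_bigr => p _ /=.
rewrite map_polyZ /= map_polyXn hornerZ hornerXn rmorphXn /= emxX -exprMn -mpolyXD combD addm0.
by rewrite add0m.
Qed.

(** Cauchy's kernel: its part in the [j]-th variable y is the generating function of the complete
    symmetric polynomials in the weights of W. *)
Lemma cy_pch u : (mdeg u <= K)%N -> cy u pch = \prod_(j < l) hs wtl (u j).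
Proof.
move=> uK; have -> : cy u pch = cy u bigP.
  by apply/mpolyP => w; rewrite !mcoeff_cy pch_bigP.
have [G [GE [m [Km ->]]]] := bigP_prod.
have uj j : (u j <= K)%N.
  by apply: leq_trans uK; rewrite mdegE (bigD1 j) //= leq_addr.
rewrite bigA_distr_bigA cy_sum /=.
have term (f : {ffun 'I_l -> 'I_m}) :
    cy u (\prod_j (emx l (G (f j)) * 'X_[comb 0 U_(j)] ^+ f j)) =
    if f == [ffun j => Ordinal (leq_ltn_trans (uj j) Km)] then \prod_j G (u j) else 0.
  rewrite big_split /= -rmorph_prod cy_emx.
  have -> : \prod_(j < l) ('X_[comb 0 U_(j)] : {mpoly rat[N + l]}) ^+ f j =
      'X_[comb 0 [multinom (f j : nat) | j < l]].
    rewrite -emyX mpolyXE_id rmorph_prod; apply: eq_bigr => j _.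
    by rewrite rmorphXn /= emyX mnmE.
  rewrite cyX rpart_comb lpart_comb mpolyX0; case: eqP => [fu|fu]; last first.
    rewrite mulr0; case: eqP => // fE; case: fu; apply/mnmP => j.
    by rewrite mnmE fE ffunE.
  have fj j : f j = u j :> nat by rewrite -fu mnmE.
  rewrite mulr1; case: eqP => [_|[]]; first by apply: eq_bigr => j _; rewrite fj.
  by apply/ffunP => j; apply: val_inj; rewrite ffunE /= fj.
under eq_bigr do rewrite term.
rewrite -big_mkcond big_pred1_eq; apply: eq_bigr => j _; exact: GE.
Qed.

End CharPoly.
End Tensor.

Section TensorCount.
Variables (N l n : nat) (c : bool).
Variables (E : 'I_(N + l) -> 'I_(N + l) -> 'M[rat]_(n * l)).
Variables (wtW : 'I_n -> 'X_{1..N}) (d : 'I_(n * l) -> rat).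
Hypothesis M : gmod (@bc N l c) E (@twt N l n wtW) d.

(* The l-block alternating sum turns products of complete symmetric
   polynomials into the Jacobi-Trudi determinant. *)
Lemma rank_tensor (nu : 'X_{1..N}) (kf : nat -> nat) :
  let kap := [multinom kf i | i < l] in
  wdom (@bc N l c) (comb nu kap) ->
  (\rank (HW (@bc N l c) (polE (mdeg kap) E) (comb nu kap)))%:R =
  (xvand N c * jtn l (wtl wtW) kf)@_(nu + xdelta N c) :> rat.
Proof.
move=> kap dom; set K := mdeg kap.
rewrite (rank_HW (gmod_poly K M) (@vdm_qf_bc N l c) dom) -/(pch l wtW K).
rewrite rdelta_bc combD -mcoeff_cy vdm_bc -mulrA cy_emx; congr (_ @_ _); congr (_ * _).
rewrite vand_expand rmorph_sum mulr_suml cy_sum /jtn /jt /determinant.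
apply: eq_bigr => sg _; rewrite rmorphM rmorphXn rmorphN1 /= emyX -mulrA.
have -> : cy (kap + ydelta l) ((-1) ^+ sg * ('X_[comb 0 (dperm sg)] * pch l wtW K)) =
    (-1) ^+ sg * cy (kap + ydelta l) ('X_[comb 0 (dperm sg)] * pch l wtW K).
  by case: (odd_perm sg); rewrite ?expr0 ?expr1 ?mul1r // !mulN1r -!scaleN1r cyZ.
congr (_ * _); rewrite cy_mulY.
have yE i : (kap + ydelta l)%MM i = (kf i + (l - 1 - i))%N.
  by rewrite mnmDE !mnmE perm1.
case: ifP => [/mnm_lepP le|/mnm_lepP nle]; last first.
  have [i hi] : exists i, ~ (dperm sg i <= (kap + ydelta l)%MM i)%N by apply: not_all_ex_not.
  rewrite (bigD1 i) //= mxE /hh; case: ifP => [h|_]; last by rewrite mul0r.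
  by case: hi; rewrite yE mnmE.
(* Removing a permuted staircase from [kap + ydelta] leaves total degree [mdeg kap], so truncation
   at degree [K] is enough. *)
rewrite cy_pch; last first.
  rewrite /K -(leq_add2r (mdeg (dperm sg))) -mdegD submK; last exact/mnm_lepP.
  rewrite mdegD leq_add2l !mdegE (reindex_inj (@perm_inj _ sg)) /=.
  have -> // : (\sum_(j < l) ydelta l (sg j) = \sum_i dperm sg i)%N.
  by apply: eq_bigr => i _; rewrite !mnmE perm1.
apply: eq_bigr => i _; rewrite mxE /hh mnmBE yE.
by have := le i; rewrite yE mnmE => ->.
Qed.

End TensorCount.

(** * Plethysm coefficients as dimensions *)

Section OrthogonalBasis.
Variables (r : nat) (b : 'I_r -> nat).
Variables (n : nat) (E : 'I_r -> 'I_r -> 'M[rat]_n).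
Variables (wt : 'I_n -> 'X_{1..r}) (d : 'I_n -> rat).
Hypothesis M : gmod b E wt d.

Local Notation D := (gram d).

(** Weight vectors are split off one at a time: the orthogonal of one inside [S] is again stable
    under the diagonal operators, which are self-adjoint. Orthogonality keeps the form diagonal, as
    [gmod] requires. *)
Lemma orth_weight_basis (S : 'rV[rat]_n -> Prop) :
  S 0 -> (forall c u v, S u -> S v -> S (c *: u + v)) ->
  (forall i u, S u -> S (u *m E i i)) ->
  exists m (Q : 'M[rat]_(m, n)) (wq : 'I_m -> 'X_{1..r}),
    [/\ forall a, isw wt (wq a) (row a Q), forall a, row a Q != 0,
        forall a a', a != a' -> row a Q *m D *m (row a' Q)^T = 0 &
        forall v, S v <-> (v <= Q)%MS].
Proof.
move=> S0 Slin SE; have [A AS] := subspace_mx S0 Slin.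
have [k] := ubnP (\rank A); elim: k S S0 Slin SE A AS => // k IH S S0 Slin SE A AS rA.
have [[v [Sv v0]]|nz] := classic (exists v, S v /\ v != 0); last first.
  exists 0%N, 0, (fun=> 0%MM); split; try by case.
  move=> v; split=> [Sv|/submxP [e ->]]; last by rewrite mulmx0.
  have [->|v0] := eqVneq v 0; first exact: sub0mx.
  by case: nz; exists v.
have [w [q [Sq q0 qw]]] := wt_extract M SE Slin Sv v0.
pose S' u := S u /\ u *m D *m q^T = 0.
have S'0 : S' 0 by split=> //; rewrite !mul0mx.
have S'lin c x y : S' x -> S' y -> S' (c *: x + y).
  by move=> [Sx x0] [Sy y0]; split; [exact: Slin|rewrite !mulmxDl -!scalemxAl x0 y0 scaler0 addr0].
have S'E i u : S' u -> S' (u *m E i i).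
  move=> [Su u0]; split; first exact: SE.
  rewrite -(mulmxA u) (gmod_adjE M) // mulmxA -mulmxA -trmx_mul.
  by move/(iswP M): qw => ->; rewrite linearZ /= -scalemxAr u0 scaler0.
have [A' A'S] := subspace_mx S'0 S'lin.
have rA' : (\rank A' < k)%N.
  have : (A' < A)%MS.
    rewrite ltmxE; apply/andP; split; first by apply/rV_subP => u /A'S [/AS].
    apply/negP => /rV_subP AA'; have /AA'/A'S [_ /(gram_eq0 (gmod_gt0 M)) qe] : (q <= A)%MS by apply/AS.
    by rewrite qe eqxx in q0.
  by rewrite ltmxErank => /andP[_ lt]; apply: leq_trans lt _; rewrite -ltnS.
have [m [Q [wq [Qw Q0 Qo QS]]]] := IH S' S'0 S'lin S'E A' A'S rA'.
pose Q1 := col_mx q Q : 'M_(1 + m, n).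
have rowl a : row (lshift m a) Q1 = q by rewrite rowKu row_id.
have rowr a : row (rshift 1 a) Q1 = row a Q by rewrite rowKd.
have qQ a : row a Q *m D *m q^T = 0 by have /QS [] := row_sub a Q.
exists (1 + m)%N, Q1, (fun a => match split a with inl _ => w | inr a' => wq a' end); split.
- by move=> a; rewrite /=; case: (split_ordP a) => a' -> /=; rewrite ?rowl ?rowr.
- by move=> a; case: (split_ordP a) => a' ->; rewrite ?rowl ?rowr.
- move=> a a'; case: (split_ordP a) => x ->; case: (split_ordP a') => y ->; rewrite ?rowl ?rowr //.
  + by rewrite [x]ord1 [y]ord1 eqxx.
  + move=> _; apply: trmx_inj; rewrite !trmx_mul trmxK tr_diag_mx mulmxA.
    by rewrite -/(gram d) qQ trmx0.
  + by rewrite eq_rshift => /Qo.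
- move=> v'; split=> [Sv'|].
    pose c := (v' *m D *m q^T) 0 0 / (q *m D *m q^T) 0 0.
    have qq : (q *m D *m q^T) 0 0 != 0 by rewrite gt_eqF // (gram_neq0 (gmod_gt0 M)).
    have : S' (- c *: q + v').
      split; first exact: Slin.
      rewrite !mulmxDl -!scalemxAl; apply/matrixP => i j; rewrite !ord1 mxE [X in X + _]mxE [RHS]mxE.
      by rewrite mulNr /c divfK // addNr.
    move=> /QS/submxP [e eE]; apply/submxP; exists (row_mx c%:M e).
    by rewrite mul_row_col -eE mul_scalar_mx scaleNr addNKr.
  case/submxP=> e ->; rewrite -[e]hsubmxK mul_row_col [lsubmx e]mx11_scalar mul_scalar_mx.
  apply: Slin => //; have /QS [] // : (rsubmx e *m Q <= Q)%MS by rewrite submxMl.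
Qed.

End OrthogonalBasis.

Section Cut.
Variables (N l n : nat).
Variables (E : 'I_(N + l) -> 'I_(N + l) -> 'M[rat]_n).
Variables (wt : 'I_n -> 'X_{1..N + l}) (d : 'I_n -> rat).
Hypothesis M : gmod (@bc N l true) E wt d.
Variable kap : 'X_{1..l}.

Local Notation D := (gram d).

(* The vectors of highest weight kap for the factor gl_l. *)
Definition rhw (v : 'rV[rat]_n) :=
  (forall x y : 'I_l, (x < y)%N -> v *m E (rshift N x) (rshift N y) = 0) /\
  forall x, v *m E (rshift N x) (rshift N x) = (kap x)%:R *: v.

Lemma bcT_l a a' : @bc N l true (lshift l a) = @bc N l true (lshift l a').
Proof. by rewrite !bc_l. Qed.

Lemma bcT_r a a' : @bc N l true (rshift N a) = @bc N l true (rshift N a').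
Proof. by rewrite !bc_r. Qed.

Lemma rhw_stable a a' v : rhw v -> rhw (v *m E (lshift l a) (lshift l a')).
Proof.
have comm x y : E (lshift l a) (lshift l a') *m E (rshift N x) (rshift N y) =
    E (rshift N x) (rshift N y) *m E (lshift l a) (lshift l a').
  apply/eqP; rewrite -subr_eq0 (gmod_comm M (bcT_r x y) (bcT_l a a')).
  by rewrite eq_rlshift eq_lrshift !scale0r subrr.
move=> [h1 h2]; split=> [x y xy|x]; rewrite -mulmxA comm mulmxA; first by rewrite h1 // mul0mx.
by rewrite h2 scalemxAl.
Qed.

Lemma rhw_lin c u v : rhw u -> rhw v -> rhw (c *: u + v).
Proof.
move=> [u1 u2] [v1 v2]; split=> [x y xy|x]; rewrite mulmxDl -scalemxAl.
  by rewrite u1 // v1 // scaler0 addr0.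
by rewrite u2 v2 scalerDr !scalerA mulrC.
Qed.

(** The two factors commute, so gl_N acts on the vectors of highest weight [kap] for gl_l. Those of
    gl_N-weight [w] are the highest weight vectors for torus x gl_l, whence [bc] at [false]. *)
Lemma cut_module : exists m (EW : 'I_N -> 'I_N -> 'M[rat]_m) wtW dW,
  gmod (fun=> 0%N) EW wtW dW /\
  forall w, #|[pred k | wtW k == w]| = \rank (HW (@bc N l false) E (comb w kap)).
Proof.
have rhw0 : rhw 0 by split=> [x y _|x]; rewrite mul0mx ?scaler0.
have rhwE i u : rhw u -> rhw (u *m E i i).
  move=> hu; case: (split_ordP i) => x ->; first exact: rhw_stable.
  by rewrite hu.2 -[_ *: _]addr0; apply: rhw_lin.
have [m [Q [wq [Qw Q0 Qo QS]]]] := orth_weight_basis M rhw0 rhw_lin rhwE.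
pose dW a : rat := (row a Q *m D *m (row a Q)^T) 0 0.
have dW_gt0 a : 0 < dW a by apply: gram_neq0 (Q0 a); apply: (gmod_gt0 M).
have GE : Q *m D *m Q^T = gram dW.
  apply/matrixP => a a'; rewrite gramE.
  have -> : (Q *m D *m Q^T) a a' = (row a Q *m D *m (row a' Q)^T) 0 0.
    by rewrite -row_mul !mxE; apply: eq_bigr => k _; rewrite !mxE.
  by have [->|aa'] := eqVneq a a'; rewrite ?mulr1n // Qo // mxE mulr0n.
have Qfree : row_free Q.
  rewrite -kermx_eq0 -submx0; apply/rV_subP => e /sub_kermxP eQ.
  have : e *m gram dW = 0 by rewrite -GE !mulmxA eQ !mul0mx.
  move=> /rowP h; suff -> : e = 0 by rewrite sub0mx.
  apply/rowP => k; have := h k; rewrite mul_mx_gram !mxE => /eqP.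
  by rewrite mulf_eq0 (gt_eqF (dW_gt0 k)) orbF => /eqP.
pose EW a a' := Q *m E (lshift l a) (lshift l a') *m pinvmx Q.
have EWQ a a' : EW a a' *m Q = Q *m E (lshift l a) (lshift l a').
  rewrite /EW mulmxKpV //; apply/row_subP => k; rewrite row_mul; apply/QS.
  by apply: rhw_stable; apply/QS; rewrite row_sub.
have wqr k x : wq k (rshift N x) = kap x.
  have [_ /(_ x)] : rhw (row k Q) by apply/QS; rewrite row_sub.
  have /(iswP M)/(_ (rshift N x)) -> := Qw k => /eqP.
  by rewrite -subr_eq0 -scalerBl scaler_eq0 (negPf (Q0 k)) orbF subr_eq0 eqr_nat => /eqP.
pose wtW k := lpart (wq k).
have wqE k : wq k = comb (wtW k) kap.
  by apply: combP => x; rewrite ?comb_l ?comb_r ?wqr ?mnmE.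
exists m, EW, wtW, dW; split.
  split=> //.
  - move=> i j p q _ _; apply: (row_free_inj Qfree).
    have EWQ2 x y z t : EW x y *m EW z t *m Q =
        Q *m (E (lshift l x) (lshift l y) *m E (lshift l z) (lshift l t)).
      by rewrite -mulmxA EWQ mulmxA EWQ mulmxA.
    rewrite mulmxBl !EWQ2 -mulmxBr (gmod_comm M (bcT_l i j) (bcT_l p q)) !eq_lshift.
    by rewrite mulmxBl mulmxBr -!scalemxAl -!scalemxAr !EWQ.
  - move=> i; suff -> : EW i i = diag_mx (\row_k (wtW k i)%:R) by move=> k k'; rewrite !mxE.
    apply: (row_free_inj Qfree); rewrite EWQ; apply/row_matrixP => k.
    have /(iswP M) wk := Qw k; rewrite (row_mul k Q) wk wqE comb_l.
    by apply/rowP => x; rewrite !mxE (bigD1 k) //= big1 ?addr0 ?mxE ?eqxx ?mulr1n //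
      => k' /negPf kk'; rewrite !mxE eq_sym kk' mul0r.
  - move=> i j k k' _.
    have : EW i j *m gram dW = gram dW *m (EW j i)^T.
      rewrite -GE -[RHS]mulmxA -trmx_mul EWQ trmx_mul !mulmxA EWQ -(mulmxA Q).
      rewrite (gmod_adjE M) //; last exact: bcT_l.
      by rewrite !mulmxA.
    move=> /matrixP/(_ k k'); rewrite mul_mx_gram => ->.
    by rewrite mul_diag_row_mx mxE.
move=> w; pose pi := diag_mx (\row_k (wtW k == w)%:R : 'rV[rat]_m).
have pipi : pi *m pi = pi.
  apply/matrixP => k k'; rewrite mul_mx_diag_row !mxE.
  by case: (k =P k') => [->|_]; case: (wtW k' == w); rewrite ?mulr1n ?mulr0n ?mulr1 ?mulr0.
have rk : \rank pi = #|[pred k | wtW k == w]|.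
  apply/eqP; rewrite -(eqr_nat rat) -(mxtrace_idem pipi) mxtrace_diag.
  rewrite -sum1_card natr_sum [in X in _ == X]big_mkcond; apply/eqP; apply: eq_bigr => k _.
  by rewrite mxE inE; case: (wtW k == w).
rewrite -rk -(mxrankMfree pi Qfree); apply/eqP; rewrite eqn_leq.
have Mf : gmod (@bc N l false) E wt d.
  apply: gmod_finer M => i j; case: (split_ordP i) => x ->; case: (split_ordP j) => y ->;
    by rewrite ?bc_l ?bc_r.
apply/andP; split; apply: mxrankS; apply/rV_subP => v.
  case/submxP=> e vE; apply/(HWP Mf).
  have wv : isw wt (comb w kap) v.
    move=> k; rewrite vE mulmxA mxE => s0.
    have [p] : exists p, (e *m pi) 0 p * Q p k != 0.
      apply/existsP; apply: contraNT s0; rewrite negb_exists => /forallP s0.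
      by rewrite big1 // => p _; apply/eqP; rewrite -[_ == _]negbK.
    rewrite mul_mx_diag_row; case: (wtW p =P w) => [<-|_]; last by rewrite mulr0 mul0r eqxx.
    rewrite mulr1 mulf_eq0 negb_or -wqE => /andP[_ Qpk].
    by apply: Qw; rewrite mxE.
  have Sv : rhw v by apply/QS; rewrite vE mulmxA submxMl.
  split=> // i j; case: (split_ordP i) => x ->; case: (split_ordP j) => y -> ij /eqP;
    rewrite ?bc_ll ?bc_lr // 1?eq_sym ?bc_lr //=.
    by move=> /eqP e2; rewrite e2 ltnn in ij.
  by move=> _; apply: Sv.1; rewrite ltn_add2l in ij.
move=> /(HWP Mf) [wv hv].
have Sv : rhw v.
  split=> [x y xy|x]; first by apply: hv; rewrite ?bc_r //= ltn_add2l.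
  by move/(iswP Mf): wv => ->; rewrite comb_r.
have /QS/submxP [e eE] := Sv; apply/submxP; exists e; rewrite mulmxA {1}eE; congr (_ *m _).
apply/rowP => k; rewrite mul_mx_diag_row; case: (wtW k =P w) => [_|kw]; first by rewrite mulr1.
rewrite mulr0; have : (e *m gram dW) 0 k = 0.
  rewrite -GE !mulmxA -eE mxE big1 // => p _; rewrite mul_mx_gram [Q^T _ _]mxE.
  have [->|vp] := eqVneq (v 0 p) 0; first by rewrite !mul0r.
  have [->|Qkp] := eqVneq (Q k p) 0; first by rewrite mulr0.
  case: kw; have e1 := wv p vp; have e2 : wt p = wq k by apply: Qw; rewrite mxE.
  by rewrite /wtW -e2 e1 lpart_comb.
by rewrite mul_mx_gram => /eqP; rewrite mulf_eq0 (gt_eqF (dW_gt0 k)) orbF => /eqP.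
Qed.

End Cut.

Lemma gmod_std N : gmod (fun=> 0%N) (fun a a' : 'I_N => delta_mx a' a) (fun k => U_(k)%MM) (fun=> 1).
Proof.
split=> [i j k p _ _|i k p|i j k p _|k] //.
- rewrite !mul_delta_mx_cond [k == j]eq_sym [i == p]eq_sym.
  by case: (j == k); case: (p == i); rewrite ?mulr1n ?mulr0n ?scale1r ?scale0r.
- rewrite mxE mnm1E; have [->|ik] := eqVneq k i; first by rewrite eq_sym; case: (i == p).
  by rewrite mul0rn.
- by rewrite !mxE mulr1 mul1r andbC.
Qed.

Lemma count_monomial_list N (f : {mpoly int[N]}) w : count_mem w (monomial_list f) = `|f@_w|%N.
Proof.
transitivity (\sum_(m <- msupp f) (m == w) * `|f@_m|)%N.
  by rewrite /monomial_list count_flatten sumnE !big_map; apply: eq_bigr => m _; rewrite count_nseq.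
have [wf|wf] := boolP (w \in msupp f).
  rewrite (bigD1_seq w) ?msupp_uniq //= eqxx mul1n big1 ?addn0 // => m /negPf.
  by move=> ->.
rewrite (memN_msupp_eq0 wf) big_seq big1 // => m mf.
by case: eqP => [mw|//]; rewrite -mw mf in wf.
Qed.

Lemma plethysmE N la (f : {mpoly int[N]}) l : is_partition la -> (size la <= l)%N ->
  plethysm la f = jtn l [seq 'X_[m] | m <- monomial_list f] (nth 0%N la).
Proof.
move=> pla sl; rewrite /plethysm (schur_jt _ pla sl).
set L := monomial_list f; congr (jtn _ _ _).
rewrite -[in RHS](mkseq_nth 0%MM L) /mkseq -val_enum_ord -!map_comp.
by apply: eq_map => i; rewrite /= mevalXU.
Qed.

Lemma schur_map (R S : comNzRingType) (f : {rmorphism R -> S}) N mu :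
  map_mpoly f (schur R N mu) = schur S N mu.
Proof.
rewrite /schur rmorph_sum; apply: eq_bigr => t _; rewrite rmorph_prod; apply: eq_bigr => c _.
by case: (t c) => [k|]; rewrite ?rmorph1 // /= map_mpolyX.
Qed.

Lemma schur_int_ge0 N mu w : 0 <= (schur int N mu)@_w.
Proof.
rewrite /schur raddf_sum sumr_ge0 // => t _ /=.
suff [m ->] : exists m, \prod_c (if t c is Some k then 'X_k else 1) = 'X_[m] :> {mpoly int[N]}.
  by rewrite mcoeffX ler0n.
apply: (big_ind (fun p => exists m, p = 'X_[m])) => [|_ _ [m1 ->] [m2 ->]|c _].
- by exists 0%MM; rewrite mpolyX0.
- by exists (m1 + m2)%MM; rewrite mpolyXD.
- by case: (t c) => [k|]; [exists U_(k)%MM|exists 0%MM; rewrite mpolyX0].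
Qed.

Lemma vandermonde_map N : map_mpoly (intr : int -> rat) (vandermonde N) = vand rat N.
Proof.
rewrite rmorph_prod; apply: eq_bigr => i _; rewrite rmorph_prod; apply: eq_bigr => j _ /=.
by rewrite rmorphB /= !map_mpolyX.
Qed.

Lemma wdom_partition N l (c : bool) (w : 'X_{1..N}) (la : nat -> nat) :
  (forall i j : 'I_N, (i < j)%N -> c -> (w j <= w i)%N) ->
  (forall i j, (i < j)%N -> (la j <= la i)%N) ->
  wdom (@bc N l c) (comb w [multinom la i | i < l]).
Proof.
move=> wd ld i j; case: (split_ordP i) => x ->; case: (split_ordP j) => y -> ij.
- move=> /eqP; rewrite bc_ll => /orP[cT|/eqP xy]; last by rewrite xy ltnn in ij.
  by rewrite !comb_l wd.
- by move=> /eqP; rewrite bc_lr.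
- by move=> /eqP; rewrite eq_sym bc_lr.
- by move=> _; rewrite !comb_r !mnmE; apply: ld; rewrite ltn_add2l in ij.
Qed.

Lemma partition_lt la i j : is_partition la -> (i < j)%N -> (nth 0 la j <= nth 0 la i)%N.
Proof. by move=> pla /ltnW; apply: partition_nth. Qed.

(** For the torus [xvand] is 1, so [rank_tensor] gives the weight multiplicities as plain
    coefficients of the Jacobi-Trudi determinant, that is, of the Schur polynomial. *)
Lemma schur_module N mu : is_partition mu ->
  exists n (EW : 'I_N -> 'I_N -> 'M[rat]_n) wtW dW,
    gmod (fun=> 0%N) EW wtW dW /\
    perm_eq (monomial_list (schur int N mu)) [seq wtW k | k <- enum 'I_n].
Proof.
move=> pmu; pose kap := [multinom nth 0%N mu i | i < size mu].
have M := @gmod_tensor _ (size mu) _ _ _ _ (gmod_std N).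
have [n [EW [wtW [dW [MW cW]]]]] := cut_module (gmod_poly (mdeg kap) M) kap.
exists n, EW, wtW, dW; split=> //; apply/allP => w _ /=; apply/eqP.
rewrite count_monomial_list count_map.
have -> : count (preim wtW (pred1 w)) (enum 'I_n) = #|[pred k | wtW k == w]|.
  by rewrite -sum1_count -sum1_card big_enum_cond; apply: eq_bigl => k; rewrite inE.
rewrite cW; apply/eqP; rewrite -(eqr_nat rat).
have finer (i j : 'I_(N + size mu)) : @bc N (size mu) false i = bc false j -> bc true i = bc true j.
  by case: (split_ordP i) => x ->; case: (split_ordP j) => y ->; rewrite ?bc_l ?bc_r.
have Mf := gmod_finer finer M.
rewrite (rank_tensor Mf) /xvand /xdelta ?mul1r ?addm0; last first.
  by apply: wdom_partition => // i j ij; apply: partition_lt.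
have := schur_jt (idfun : {rmorphism {mpoly rat[N]} -> {mpoly rat[N]}}) pmu (leqnn _).
move=> /= <-; rewrite -(schur_map (intr : {rmorphism int -> rat})) mcoeff_map_mpoly /=.
by rewrite -[in X in _ == X](gez0_abs (schur_int_ge0 mu w)) -pmulrn.
Qed.

Definition nthm N (la : seq nat) : 'X_{1..N} := [multinom nth 0%N la i | i < N].

(** Plethysm evaluates the Jacobi-Trudi determinant at the weights of W, and for gl_N x gl_l the
    factor [xvand] and the shift [xdelta] of [rank_tensor] are those built into [schur_coeff]. *)
Theorem schur_coeff_dimA N l n (EW : 'I_N -> 'I_N -> 'M[rat]_n) wtW dW la mu nu :
  gmod (fun=> 0%N) EW wtW dW ->
  perm_eq (monomial_list (schur int N mu)) [seq wtW k | k <- enum 'I_n] ->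
  is_partition la -> is_partition nu -> (size la <= l)%N ->
  schur_coeff (plethysm la (schur int N mu)) nu =
  (dimA (@bc N l true) (@tE N l n EW) (fun w => mdeg (rpart w)) (comb (nthm N nu) (nthm l la)))%:Z.
Proof.
move=> MW pW pla pnu sl; apply: (@intr_inj rat); rewrite /dimA rpart_comb.
rewrite [RHS](rank_tensor (@gmod_tensor _ l _ _ _ _ MW)); last first.
  by apply: wdom_partition => i j ij *; rewrite ?mnmE; apply: partition_lt.
rewrite /schur_coeff -[LHS]mcoeff_map_mpoly rmorphM /= vandermonde_map (plethysmE _ pla sl).
rewrite jtn_morph -map_comp (@eq_jtn _ l _ (wtl wtW)); last first.
  apply: hs_perm; rewrite (eq_map (g := fun m => 'X_[m])) => [|m]; last exact: map_mpolyX.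
  by rewrite /wtl [X in perm_eq _ X]map_comp; apply: perm_map.
congr (_ @_ _); apply/mnmP => i; rewrite !mnmE perm1 //.
Qed.

(** * Independence of the number of variables *)

Lemma mcoeff_mulX N (R : comNzRingType) (a u : 'X_{1..N}) (p : {mpoly R[N]}) :
  ('X_[a] * p)@_(a + u) = p@_u.
Proof.
rewrite [in LHS](mpolyE p) [in RHS](mpolyE p) mulr_sumr !raddf_sum /=; apply: eq_bigr => m _.
by rewrite -scalerAr -mpolyXD !mcoeffZ !mcoeffX eqm_add2l.
Qed.

Section LastVariable.
Variable N : nat.

Local Notation wid := (widen_ord (leqnSn N)).

Definition mnm_pad (w : 'X_{1..N}) : 'X_{1..N.+1} :=
  [multinom oapp (fun j => w j) 0%N (insub (val i)) | i < N.+1].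

Definition mnm_trunc (m : 'X_{1..N.+1}) : 'X_{1..N} := [multinom m (wid i) | i < N].

Definition kill : {mpoly int[N.+1]} -> {mpoly int[N]} :=
  mmap (@mpolyC _ int) (fun i => oapp (fun j => 'X_j) 0 (insub (val i))).
HB.instance Definition _ := GRing.RMorphism.copy kill
  (mmap (@mpolyC _ int) (fun i => oapp (fun j => 'X_j) 0 (insub (val i)))).

Lemma insub_wid (i : 'I_N) : insub (val (wid i)) = Some i.
Proof. exact: (valK i). Qed.

Lemma insub_max : insub (val (ord_max : 'I_N.+1)) = None :> option 'I_N.
Proof. by rewrite insubF //= ltnn. Qed.

Lemma mnm_pad_wid w i : mnm_pad w (wid i) = w i.
Proof. by rewrite mnmE insub_wid. Qed.

Lemma mnm_pad_max w : mnm_pad w ord_max = 0%N.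
Proof. by rewrite mnmE insub_max. Qed.

Lemma eq_mnm_pad m w : (m == mnm_pad w) = (m ord_max == 0%N) && (mnm_trunc m == w).
Proof.
apply/eqP/andP => [->|[/eqP m0 /eqP <-]].
  by rewrite mnm_pad_max; split=> //; apply/eqP/mnmP => i; rewrite mnmE mnm_pad_wid.
apply/mnmP => i; rewrite mnmE; case: insubP => [j _ ji|] /=.
  by rewrite mnmE; congr (m _); apply: val_inj.
by rewrite -leqNgt => Ni; rewrite -m0; congr (m _); apply: val_inj; apply/eqP; rewrite eqn_leq Ni -ltnS ltn_ord.
Qed.

Lemma killX m : kill 'X_[m] = if m ord_max == 0%N then 'X_[mnm_trunc m] else 0.
Proof.
rewrite /kill mmapX /mmap1 big_ord_recr insub_max /= expr0n.
under eq_bigr do rewrite insub_wid /=.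
case: (m ord_max == 0%N); last by rewrite mulr0.
by rewrite mulr1 mpolyXE_id; apply: eq_bigr => i _; rewrite mnmE.
Qed.

Lemma kill_wid i : kill 'X_(wid i) = 'X_i.
Proof. by rewrite /kill mmapX mmap1U insub_wid. Qed.

Lemma kill_max : kill 'X_ord_max = 0.
Proof. by rewrite /kill mmapX mmap1U insub_max. Qed.

Lemma mcoeff_kill p w : (kill p)@_w = p@_(mnm_pad w).
Proof.
rewrite [in LHS](mpolyE p) [in RHS](mpolyE p) rmorph_sum !raddf_sum; apply: eq_bigr => m _ /=.
rewrite -!mul_mpolyC rmorphM /= {1}/kill mmapC killX !mul_mpolyC !mcoeffZ mcoeffX eq_mnm_pad.
by case: (_ == 0%N); rewrite ?mcoeff0 ?mcoeffX.
Qed.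

Lemma kill_schur mu : is_partition mu -> kill (schur int N.+1 mu) = schur int N mu.
Proof.
move=> pmu; rewrite (schur_jt kill pmu (leqnn _)).
have := schur_jt (idfun : {rmorphism {mpoly int[N]} -> {mpoly int[N]}}) pmu (leqnn _).
move=> /= ->; apply: eq_jtn => k.
rewrite -(hs_cons0 [seq 'X_i | i <- enum 'I_N]); apply: hs_perm.
rewrite enum_ordSr map_rcons -map_comp /= kill_max perm_rcons perm_cons.
by rewrite (eq_map (g := fun i => 'X_i)) // => i; apply: kill_wid.
Qed.

(** Monomials containing the last variable become zero, and zero arguments do not affect complete
    symmetric polynomials; the others are the monomials of the Schur polynomial in one variable
    less. *)
Lemma kill_plethysm la mu : is_partition la -> is_partition mu ->
  kill (plethysm la (schur int N.+1 mu)) = plethysm la (schur int N mu).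
Proof.
move=> pla pmu; rewrite !(plethysmE _ pla (leqnn _)) jtn_morph -map_comp.
apply: eq_jtn => k; rewrite -hs_filter0; set L := monomial_list _.
have -> : [seq a <- [seq (kill \o (fun m => 'X_[m])) i | i <- L] | a != 0] =
    [seq 'X_[m] | m <- [seq mnm_trunc m | m <- filter (fun m : 'X_{1..N.+1} => m ord_max == 0%N) L]].
  elim: L => //= m L IH; rewrite killX; case: (m ord_max == 0%N); last by rewrite eqxx.
  have -> : 'X_[mnm_trunc m] != 0 :> {mpoly int[N]}.
    by apply/eqP => /(congr1 (mcoeff (mnm_trunc m))) /eqP; rewrite mcoeffX eqxx mcoeff0 oner_eq0.
  by rewrite /= IH.
apply: hs_perm; apply: perm_map; apply/allP => w _ /=; apply/eqP.
rewrite count_monomial_list -kill_schur // mcoeff_kill -count_monomial_list -/L.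
rewrite count_map count_filter; apply: eq_count => m /=.
by rewrite eq_mnm_pad andbC.
Qed.

(** The extra monomial matches the shift by one of the staircase exponents when a variable is
    added. *)
Lemma kill_vandermonde : kill (vandermonde N.+1) = 'X_[[multinom 1%N | i < N]] * vandermonde N.
Proof.
rewrite /vandermonde big_ord_recr /= [X in _ * X]big1 ?mulr1 => [|j]; last first.
  by rewrite ltnNge -ltnS ltn_ord.
rewrite mpolyXE_id -big_split rmorph_prod; apply: eq_bigr => i _ /=.
rewrite big_mkcond big_ord_recr /= ltn_ord rmorphM rmorphB /= kill_wid kill_max subr0.
rewrite mnmE expr1 mulrC; congr (_ * _).
rewrite rmorph_prod [RHS]big_mkcond; apply: eq_bigr => j _ /=.
by case: ifP => _; rewrite ?rmorph1 // rmorphB /= !kill_wid.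
Qed.

(* pleth_coeff works in max(plen mu, plen nu) variables, a number that varies
   with the multiples of al and ga in the theorem. *)
Theorem schur_coeff_kill la mu nu : is_partition la -> is_partition mu ->
  nth 0%N nu N = 0%N ->
  schur_coeff (plethysm la (schur int N.+1 mu)) nu =
  schur_coeff (plethysm la (schur int N mu)) nu.
Proof.
move=> pla pmu nuN; rewrite /schur_coeff -(kill_plethysm pla pmu).
set del := [multinom (nth 0%N nu i + (N - 1 - i))%N | i < N].
have -> : [multinom (nth 0%N nu i + (N.+1 - 1 - i))%N | i < N.+1] =
    mnm_pad ([multinom 1%N | i < N] + del)%MM.
  apply/eqP; rewrite eq_mnm_pad mnmE nuN subn1 subnn /=; apply/eqP/mnmP => i.
  by rewrite mnmDE !mnmE /=; have := ltn_ord i; lia.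
by rewrite -mcoeff_kill rmorphM /= kill_vandermonde -mulrA mcoeff_mulX.
Qed.

End LastVariable.

Lemma plen_nth nu i : is_partition nu -> (plen nu <= i)%N -> nth 0%N nu i = 0%N.
Proof.
elim: nu i => [|a nu IH] i pn; first by rewrite nth_nil.
have pn' : is_partition nu by apply: path_sorted pn.
case: a pn => [|a] pn; last by case: i => //= i; apply: IH.
move=> _; apply/eqP; rewrite -leqn0; exact: (partition_nth pn (leq0n i)).
Qed.

Lemma schur_coeff_stable N N' la mu nu : is_partition la -> is_partition mu ->
  is_partition nu -> (plen nu <= N)%N -> (N <= N')%N ->
  schur_coeff (plethysm la (schur int N' mu)) nu =
  schur_coeff (plethysm la (schur int N mu)) nu.
Proof.
move=> pla pmu pnu nuN /subnKC <-; elim: (N' - N)%N => [|e IH]; first by rewrite addn0.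
by rewrite addnS schur_coeff_kill // plen_nth // (leq_trans nuN) ?leq_addr.
Qed.

Lemma nth_padd a b i : nth 0%N (padd a b) i = (nth 0 a i + nth 0 b i)%N.
Proof.
rewrite /padd; have [im|im] := ltnP i (maxn (size a) (size b)); first by rewrite nth_mkseq.
rewrite !nth_default ?size_mkseq //; move: im; rewrite geq_max => /andP[] //.
Qed.

Lemma nth_pscale d a i : nth 0%N (pscale d a) i = (d * nth 0 a i)%N.
Proof.
have [ia|ia] := ltnP i (size a); first by rewrite (nth_map 0%N).
by rewrite !nth_default ?size_map ?muln0.
Qed.

Lemma is_partition_nth s :
  (forall i j, (i <= j)%N -> (nth 0 s j <= nth 0 s i)%N) -> is_partition s.
Proof.
by move=> h; apply/(sortedP 0%N) => i _; apply: h.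
Qed.

Lemma partition_padd a b : is_partition a -> is_partition b -> is_partition (padd a b).
Proof.
move=> pa pb; apply: is_partition_nth => i j ij.
by rewrite !nth_padd leq_add // partition_nth.
Qed.

Lemma partition_pscale d a : is_partition a -> is_partition (pscale d a).
Proof.
move=> pa; apply: is_partition_nth => i j ij.
by rewrite !nth_pscale leq_mul2l partition_nth // orbT.
Qed.

Lemma plen_le s n : (forall i, (n <= i)%N -> nth 0%N s i = 0%N) -> (plen s <= n)%N.
Proof.
elim: s n => [|a s IH] [|n] h //=.
  by have /= -> := h 0%N isT; rewrite add0n; apply: IH => i _; apply: (h i.+1).
rewrite -[n.+1]add1n leq_add ?leq_b1 //; apply: IH => i ni; exact: (h i.+1).
Qed.

Lemma pleth_coeff_stable N la mu nu : is_partition la -> is_partition mu ->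
  is_partition nu -> (plen mu <= N)%N -> (plen nu <= N)%N ->
  pleth_coeff la mu nu = schur_coeff (plethysm la (schur int N mu)) nu.
Proof.
move=> pla pmu pnu muN nuN; rewrite /pleth_coeff; symmetry.
by apply: schur_coeff_stable; rewrite ?leq_maxr // geq_max muN.
Qed.

(** Induction on the room [B - a d0], which every later strict increase reduces. *)
Lemma bounded_nondecreasing_stable (a : nat -> nat) B :
  (forall d, (a d <= a d.+1)%N) -> (forall d, (a d <= B)%N) ->
  exists D, forall d, (D <= d)%N -> a d = a D.
Proof.
move=> mono aB; suff h m : forall d0, (B - a d0 <= m)%N ->
    exists D, forall d, (D <= d)%N -> a d = a D by apply: (h (B - a 0)%N 0%N).
have mono' d e : (d <= e)%N -> (a d <= a e)%N by apply: (homo_leq leqnn leq_trans).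
elim: m => [|m IH] d0 hd.
  by exists d0 => d /mono' dd; have := aB d; lia.
have [[d [dd ad]]|nz] := classic (exists d, (d0 <= d)%N /\ a d <> a d0).
  by apply: (IH d); have := mono' _ _ dd; lia.
by exists d0 => d dd; apply: NNPP => ad; apply: nz; exists d.
Qed.

Theorem theorem4p5 (la mu nu al ga : seq nat) :
  is_partition la -> is_partition mu -> is_partition nu ->
  is_partition al -> is_partition ga ->
  (sumn la * sumn mu = sumn nu)%N ->
  (forall d : nat, (0 < d)%N ->
     pleth_coeff (pscale d al) mu (pscale d ga) = 1) ->
  (forall d : nat,
     pleth_coeff (padd la (pscale d al)) mu (padd nu (pscale d ga))
     <= pleth_coeff (padd la (pscale d.+1 al)) mu (padd nu (pscale d.+1 ga)))
  /\
  (exists D : nat, forall d : nat, (D <= d)%N ->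
     pleth_coeff (padd la (pscale d al)) mu (padd nu (pscale d ga))
     = pleth_coeff (padd la (pscale D al)) mu (padd nu (pscale D ga))).
Proof.
move=> pla pmu pnu pal pga _ one.
(* Both numbers are independent of [d]: adding multiples of [ga] and [al] creates no part beyond
   them, so all coefficients are dimensions in one graded algebra. *)
pose N := maxn (plen mu) (maxn (plen nu) (plen ga)); pose l := maxn (size la) (size al).
have [muN nuN gaN] : [/\ plen mu <= N, plen nu <= N & plen ga <= N]%N.
  by rewrite /N; split; lia.
have [n [EW [wtW [dW [MW pW]]]]] := schur_module N pmu.
have M := @gmod_tensor N l n EW wtW dW MW.
pose degw (w : 'X_{1..N + l}) := mdeg (rpart w).
have degE : forall m : 'X_{1..n * l}, degw (mwt (@twt N l n wtW) m) = mdeg m.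
  exact: rpart_mwt.
pose dim := dimA (@bc N l true) (@tE N l n EW) degw.
have plethE la' nu' : is_partition la' -> is_partition nu' -> (size la' <= l)%N ->
    (plen nu' <= N)%N -> pleth_coeff la' mu nu' = (dim (comb (nthm N nu') (nthm l la')))%:Z.
  move=> pl pn sl pN; rewrite (pleth_coeff_stable pl pmu pn muN pN).
  exact: schur_coeff_dimA MW pW pl pn sl.
pose chi := comb (nthm N ga) (nthm l al); pose psi := comb (nthm N nu) (nthm l la).
have dim_chi k : (0 < k)%N -> dim (chi *+ k)%MM = 1%N.
  move=> k0; have := one k k0; rewrite plethE; first last.
  - apply: plen_le => i Ni; rewrite nth_pscale plen_nth ?muln0 //; exact: leq_trans gaN Ni.
  - by rewrite size_map leq_maxr.
  - exact: partition_pscale.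
  - exact: partition_pscale.
  move=> [<-]; congr (dim _); apply: combP => i; rewrite ?mulmnE ?comb_l ?comb_r ?mnmE.
    by rewrite nth_pscale mulnC.
  by rewrite nth_pscale mulnC.
have plethD d : pleth_coeff (padd la (pscale d al)) mu (padd nu (pscale d ga)) =
    (dim (psi + chi *+ d)%MM)%:Z.
  rewrite plethE.
  - congr (dim _)%:Z; apply: combP => i; rewrite mnmDE ?mulmnE ?comb_l ?comb_r ?mnmE.
      by rewrite nth_padd nth_pscale mulnC.
    by rewrite nth_padd nth_pscale mulnC.
  - by apply: partition_padd => //; apply: partition_pscale.
  - by apply: partition_padd => //; apply: partition_pscale.
  - by rewrite size_mkseq size_map.
  - apply: plen_le => i Ni; rewrite nth_padd nth_pscale !plen_nth ?muln0 //.
      exact: leq_trans gaN Ni.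
    exact: leq_trans nuN Ni.
have [f fA f0] : exists2 f, phw (@bc N l true) (@tE N l n EW) (@twt N l n wtW) chi f & f != 0.
  by apply: (dimA_neq0 M (degw := degw)); rewrite -[chi]mulm1n -/dim dim_chi.
have chi_span k p : phw (@bc N l true) (@tE N l n EW) (@twt N l n wtW) (chi *+ k)%MM p ->
    exists c, p = c *: f ^+ k.
  case: k => [|k] pA; last first.
    apply: (dimA1P M degE) pA; last exact: dim_chi.
      exact: phwX.
    by rewrite expf_neq0.
  (* The case [k = 0] is not covered by the hypothesis on multiples, but weight zero forces degree
     zero, so [p] is constant. *)
  exists p@_0; rewrite expr0 -mul_mpolyC mulr1; apply: msize1_polyC.
  have := phw_size degE pA; rewrite /degw mulm0n mdegE big1 // => i _.
  by rewrite mnmE mnm0E.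
have mono d : (dim (psi + chi *+ d)%MM <= dim (psi + chi *+ d.+1)%MM)%N.
  by rewrite mulmSr addmA; apply: (dimA_mono M degE) fA f0.
have [B dimB] := dimA_bounded M degw psi fA f0 chi_span.
split=> [d|]; first by rewrite !plethD lez_nat.
have [D hD] := bounded_nondecreasing_stable mono dimB.
by exists D => d Dd; rewrite !plethD hD.
Qed.
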